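(* Let $I$ be an open interval, $f:I\to\mathbb R$ a smooth non-vanishing function, and $L^4_1(f,0)=I\times\mathbb E^3$ with metric $-dt^2+f(t)^2(dx_1^2+dx_2^2+dx_3^2)$. The Robertson-Walker spacetime $L^4_1(f,0)$ admits a space-like, biconservative PMCV surface $M$ with mean curvature $H_0$ if and only if $f$ satisfies $$\left(a^2-4 H_0^2\right) f^3 f''-\left((f')^2-\left(a^2-4 H_0^2\right) f^2\right)^2-(f')^4=0$$ for a constant $a$ such that $a^2-4 H_0^2>0$. In this case, $M$ is locally congruent to the rotational surface $$\phi(u,v)=\left(u,\frac{1}{a f(u)}\sin (a v),\frac{1}{a f(u)}\cos (a v),\frac{2 H_0}{a^2 c_2 f(u)}\right),$$ where $c_2$ is a constant satisfying $4H_0^2+c_2^2a^2=a^2$ and $c_2>0$.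
   Context: Write $\langle\cdot,\cdot\rangle$ for the metric of $L^4_1(f,0)$, $\widetilde\nabla$ for its Levi-Civita connection, and $\widetilde R(X,Y)Z=\widetilde\nabla_X\widetilde\nabla_YZ-\widetilde\nabla_Y\widetilde\nabla_XZ-\widetilde\nabla_{[X,Y]}Z$. Points are written in coordinates $(t,x_1,x_2,x_3)$. Let $M$ be a space-like surface (isometrically immersed by $\phi$, with positive definite induced metric), with second fundamental form $h$, shape operators $A$, normal connection $\nabla^\perp$ and mean curvature vector $H=\frac12\mathrm{tr}\,h$. $M$ is PMCV (has parallel mean curvature vector) if $\nabla^\perp H=0$. $M$ is biconservative if the tangential part of the bitension field $\tau_2(\phi)=\Delta\tau(\phi)-\mathrm{tr}\,\widetilde R(d\phi,\tau(\phi))d\phi$ vanishes, where $\tau(\phi)=\mathrm{tr}\,\nabla d\phi=2H$ and $\Delta$ is the rough Laplacian; equivalently $2\nabla\|H\|^2+4\,\mathrm{tr}\,A_{\nabla^\perp_\cdot H}(\cdot)+4\,\mathrm{tr}(\widetilde R(\cdot,H)\cdot)^T=0$. ''Mean curvature $H_0$'' means $H=H_0e_4$ for a unit normal vector field $e_4$ and a non-zero constant $H_0$. Standing assumptions: writing $\frac{\partial}{\partial t}|_M=T+\eta$ with $T$ tangent and $\eta$ normal to $M$, $T$ vanishes nowhere on $M$; $\frac{f''}{f}-\frac{(f')^2}{f^2}\neq0$ everywhere on $I$; surfaces are connected and oriented, all objects are smooth; $H\neq0$.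
   Formalization: The equation for f is required on the time range J of M (any open subinterval of I) rather than all of I, and the right-hand side also has f'^2 > (a^2-4H_0^2) f^2 on J (the rotational surface is space-like), without which the ''if'' fails. *)

(* Defs.v *)
From HB Require Import structures.
From mathcomp Require Import all_boot all_order all_algebra.
From mathcomp Require Import all_classical all_reals all_analysis.

Set Implicit Arguments.
Unset Strict Implicit.
Unset Printing Implicit Defensive.

Import Order.TTheory GRing.Theory Num.Theory.
Import numFieldNormedType.Exports.
Local Open Scope classical_set_scope.
Local Open Scope ring_scope.

Definition pd (R : realType) (n : nat) (W : normedModType R)
    (k : 'I_n.+1) (F : 'rV[R]_n.+1 -> W) : 'rV[R]_n.+1 -> W :=
  fun x => 'D_(delta_mx 0 k) F x.

(* Only used for open A, where it means C^infinity on A. *)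
Definition smooth_on (R : realType) (n : nat) (W : normedModType R)
    (A : set 'rV[R]_n.+1) (F : 'rV[R]_n.+1 -> W) : Prop :=
  forall (s : seq 'I_n.+1) x, A x -> differentiable (foldr (@pd R n W) F s) x.

Definition smooth_on1 (R : realType) (I : set R) (f : R -> R) : Prop :=
  forall n t, I t -> derivable (derive1n n f) t 1.

Definition open_interval (R : realType) (I : set R) : Prop :=
  [/\ I !=set0, open I & is_interval I].

Definition diffeo_on (R : realType) (n : nat) (A : set 'rV[R]_n.+1)
    (theta : 'rV[R]_n.+1 -> 'rV[R]_n.+1) : Prop :=
  [/\ open A, open (theta @` A), smooth_on A theta &
      exists2 theta' : 'rV[R]_n.+1 -> 'rV[R]_n.+1,
        smooth_on (theta @` A) theta' & forall x, A x -> theta' (theta x) = x].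

(* [chart i] is meaningful on [cdom i] only, and [param i] on its image. *)
Record surface (R : realType) := Surface {
  point_of :> topologicalType;
  surface_nonempty : [set: point_of] !=set0;
  surface_connected : connected [set: point_of];
  surface_hausdorff : hausdorff_space point_of;
  surface_second_countable : @second_countable point_of;
  cidx : Type;
  cdom : cidx -> set point_of;
  chart : cidx -> point_of -> 'rV[R]_2;
  param : cidx -> 'rV[R]_2 -> point_of;
  cdom_open : forall i, open (cdom i);
  cdom_cover : forall p, exists i, cdom i p;
  crange_open : forall i, open (chart i @` cdom i);
  chartK : forall i p, cdom i p -> param i (chart i p) = p;
  chart_continuous : forall i p, cdom i p -> {for p, continuous (chart i)};
  param_continuous : forall i x, (chart i @` cdom i) x ->
    {for x, continuous (param i)};
  transition_smooth : forall i j,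
    smooth_on (chart i @` cdom i `&` param i @^-1` cdom j)
              (chart j \o param i);
  transition_oriented : forall i j x,
    (chart i @` cdom i `&` param i @^-1` cdom j) x ->
    0 < \det (jacobian (chart j \o param i) x)
}.

Definition crange (R : realType) (M : surface R) (i : cidx M) : set 'rV[R]_2 :=
  chart i @` cdom i.

Definition smooth_map (R : realType) (M : surface R) (F : M -> 'rV[R]_4) : Prop :=
  forall i : cidx M, smooth_on (crange i) (F \o param i).

(* Semi-Riemannian geometry of a metric g given by its Gram matrices in the
   coordinates of R^(n+1); vectors are the rows of their components. *)

Section Metric.
Variables (R : realType) (n : nat) (g : 'rV[R]_n.+1 -> 'M[R]_n.+1).
Implicit Types (q : 'rV[R]_n.+1) (X Y Z : 'rV[R]_n.+1 -> 'rV[R]_n.+1).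

Definition inner q (v w : 'rV[R]_n.+1) : R := (v *m g q *m w^T) 0 0.

Definition christoffel q (k i j : 'I_n.+1) : R :=
  2^-1 * \sum_(l < n.+1) invmx (g q) k l *
    (pd i (fun y => g y j l : R^o) q + pd j (fun y => g y i l : R^o) q
     - pd l (fun y => g y i j : R^o) q).

Definition gam q (v w : 'rV[R]_n.+1) : 'rV[R]_n.+1 :=
  \row_k \sum_(i < n.+1) \sum_(j < n.+1) christoffel q k i j * v 0 i * w 0 j.

Definition cov X Y : 'rV[R]_n.+1 -> 'rV[R]_n.+1 :=
  fun q => 'D_(X q) Y q + gam q (X q) (Y q).

Definition lie X Y : 'rV[R]_n.+1 -> 'rV[R]_n.+1 :=
  fun q => 'D_(X q) Y q - 'D_(Y q) X q.

Definition curvature_fields X Y Z : 'rV[R]_n.+1 -> 'rV[R]_n.+1 :=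
  fun q => cov X (cov Y Z) q - cov Y (cov X Z) q - cov (lie X Y) Z q.

(* By tensoriality, tangent vectors at q may be extended by constant fields. *)
Definition curvature q (u v w : 'rV[R]_n.+1) : 'rV[R]_n.+1 :=
  curvature_fields (cst u) (cst v) (cst w) q.

End Metric.

(* Geometry of X : R^2 -> R^4, the coordinate expression of an immersion, with
   respect to an ambient metric g; W denotes a vector field along X. *)

Section Immersion.
Variables (R : realType) (g : 'rV[R]_4 -> 'M[R]_4) (X : 'rV[R]_2 -> 'rV[R]_4).
Implicit Types (x : 'rV[R]_2) (w : 'rV[R]_4) (W : 'rV[R]_2 -> 'rV[R]_4).

Definition first_form x : 'M[R]_2 :=
  \matrix_(k, l) inner g (X x) (pd k X x) (pd l X x).

Definition first_form_inv x : 'M[R]_2 := invmx (first_form x).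

Definition tangent_part x w : 'rV[R]_4 :=
  \sum_(k < 2) \sum_(l < 2)
    (first_form_inv x k l * inner g (X x) w (pd l X x)) *: pd k X x.

Definition normal_part x w : 'rV[R]_4 := w - tangent_part x w.

Definition trace2 x (B : 'I_2 -> 'I_2 -> 'rV[R]_4) : 'rV[R]_4 :=
  \sum_(k < 2) \sum_(l < 2) first_form_inv x k l *: B k l.

Definition cov_along (k : 'I_2) W : 'rV[R]_2 -> 'rV[R]_4 :=
  fun x => pd k W x + gam g (X x) (pd k X x) (W x).

Definition second_form x (k l : 'I_2) : 'rV[R]_4 :=
  normal_part x (cov_along k (pd l X) x).

Definition mean_curv x : 'rV[R]_4 := 2^-1 *: trace2 x (second_form x).

Definition normal_cov (k : 'I_2) W : 'rV[R]_2 -> 'rV[R]_4 :=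
  fun x => normal_part x (cov_along k W x).

(* (nabla dX)(d_k, d_l), with the Levi-Civita connection of the induced metric
   on the source *)
Definition hess_map x (k l : 'I_2) : 'rV[R]_4 :=
  cov_along k (pd l X) x
  - \sum_(m < 2) christoffel first_form x m k l *: pd m X x.

Definition tension x : 'rV[R]_4 := trace2 x (hess_map x).

(* Rough Laplacian, with the sign Delta = + tr nabla^2: it is the one for which
   tau_2 = Delta tau - tr R(dX, tau) dX is the bitension field. *)
Definition rough_laplacian W x : 'rV[R]_4 :=
  trace2 x (fun k l => cov_along k (cov_along l W) x
    - \sum_(m < 2) christoffel first_form x m k l *: cov_along m W x).

Definition bitension x : 'rV[R]_4 :=
  rough_laplacian tension x
  - trace2 x (fun k l => curvature g (X x) (pd k X x) (tension x) (pd l X x)).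

End Immersion.

(* Gram matrix of -dt^2 + f(t)^2 (dx_1^2 + dx_2^2 + dx_3^2); coordinate 0 is t. *)
Definition rw_metric (R : realType) (f : R -> R) (q : 'rV[R]_4) : 'M[R]_4 :=
  \matrix_(i, j)
    (if i != j then 0 else if i == 0 then - 1 else f (q 0 0) ^+ 2).

Definition rw_space (R : realType) (I : set R) : set 'rV[R]_4 :=
  [set q | I (q 0 0)].

Definition dt_field (R : realType) : 'rV[R]_4 := delta_mx 0 0.

Definition rw_isometry (R : realType) (I : set R) (f : R -> R)
    (Psi : 'rV[R]_4 -> 'rV[R]_4) : Prop :=
  [/\ set_bij (rw_space I) (rw_space I) Psi,
      smooth_on (rw_space I) Psi &
      forall q, rw_space I q -> forall v w : 'rV[R]_4,
        inner (rw_metric f) (Psi q) ('D_v Psi q) ('D_w Psi q) =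
        inner (rw_metric f) q v w].

Section SurfacesInRW.
Variables (R : realType) (I : set R) (f : R -> R) (M : surface R).
Variable phi : M -> 'rV[R]_4.

Let g := rw_metric f.

Definition spacelike_immersion : Prop :=
  [/\ smooth_map phi, forall p, rw_space I (phi p) &
      forall (i : cidx M) x, crange i x -> forall v : 'rV[R]_2, v != 0 ->
        0 < inner (first_form g (phi \o param i)) x v v].

Definition dt_nowhere_normal : Prop :=
  forall (i : cidx M) x, crange i x ->
    tangent_part g (phi \o param i) x (dt_field R) != 0.

Definition pmcv : Prop :=
  forall (i : cidx M) x, crange i x -> forall k : 'I_2,
    normal_cov g (phi \o param i) k (mean_curv g (phi \o param i)) x = 0.

Definition biconservative : Prop :=
  forall (i : cidx M) x, crange i x ->
    tangent_part g (phi \o param i) x (bitension g (phi \o param i) x) = 0.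

(* H = H0 e4 for a unit normal field e4; since g is Lorentzian, unit means
   <e4, e4> = 1 or -1. *)
Definition has_mean_curvature (H0 : R) : Prop :=
  exists2 e4 : M -> 'rV[R]_4, smooth_map e4 &
    forall (i : cidx M) x, crange i x ->
      [/\ `| inner g (phi (param i x)) (e4 (param i x)) (e4 (param i x)) | = 1,
          tangent_part g (phi \o param i) x (e4 (param i x)) = 0 &
          mean_curv g (phi \o param i) x = H0 *: e4 (param i x)].

Definition bicons_pmcv_surface (H0 : R) : Prop :=
  [/\ spacelike_immersion, dt_nowhere_normal, pmcv, biconservative &
      has_mean_curvature H0].

(* The geometry of M constrains f on this set only. *)
Definition time_range : set R := [set phi p 0 0 | p in [set: M]].

(* Near each of its points phi(M) is carried by an isometry of the spacetime
   onto an open piece of psi(D), up to reparametrization. *)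
Definition locally_congruent (D : set 'rV[R]_2)
    (psi : 'rV[R]_2 -> 'rV[R]_4) : Prop :=
  forall p : M, exists (i : cidx M) (A : set 'rV[R]_2)
      (theta : 'rV[R]_2 -> 'rV[R]_2) (Psi : 'rV[R]_4 -> 'rV[R]_4),
    [/\ cdom i p, A (chart i p) /\ A `<=` crange i,
        diffeo_on A theta /\ theta @` A `<=` D, rw_isometry I f Psi &
        forall x, A x -> Psi (phi (param i x)) = psi (theta x)].

End SurfacesInRW.

Definition rot_surface (R : realType) (f : R -> R) (H0 a c2 : R)
    (x : 'rV[R]_2) : 'rV[R]_4 :=
  let u := x 0 0 in let v := x 0 1 in
  \row_(j < 4) [:: u;
                   1 / (a * f u) * sin (a * v);
                   1 / (a * f u) * cos (a * v);
                   2 * H0 / (a ^+ 2 * c2 * f u)]`_j.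

Definition rw_ode (R : realType) (f : R -> R) (H0 a : R) (J : set R) : Prop :=
  forall t, J t ->
    (a ^+ 2 - 4 * H0 ^+ 2) * f t ^+ 3 * derive1n 2 f t
    - (derive1 f t ^+ 2 - (a ^+ 2 - 4 * H0 ^+ 2) * f t ^+ 2) ^+ 2
    - derive1 f t ^+ 4 = 0.

(* Positivity of the induced metric of [rot_surface]: it is
   (f'^2 / ((a^2 - 4 H0^2) f^2) - 1) du^2 + dv^2. It does not follow from
   [rw_ode]: for f'(t0) = 0, say, [rot_surface] is time-like near u = t0. *)
Definition rot_spacelike (R : realType) (f : R -> R) (H0 a : R) (J : set R) :
    Prop :=
  forall t, J t -> (a ^+ 2 - 4 * H0 ^+ 2) * f t ^+ 2 < derive1 f t ^+ 2.

(* Main.v *)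
From HB Require Import structures.
Require Import Defs.
From mathcomp Require Import all_boot all_order all_algebra.
From mathcomp Require Import all_classical all_reals all_analysis.
From mathcomp Require Import ring lra.
Import Order.TTheory GRing.Theory Num.Theory.
Import numFieldNormedType.Exports.
Local Open Scope classical_set_scope.
Local Open Scope ring_scope.
Set Implicit Arguments.
Unset Strict Implicit.
Unset Printing Implicit Defensive.

(* For a surface with parallel mean curvature, the Codazzi equation reduces the
   tangential part of the bitension field to a non-zero multiple of
   (f''/f - (f'/f)^2) <H, d/dt> dt.  Since dt does not vanish on the surface, it
   is biconservative exactly when H is orthogonal to d/dt.  Writing the surface
   as X = (t, y), the spatial direction e4 of H is then part of an orthonormal
   frame (w, e2, e4) of R^3 with
     d e4 = -2 H0 om e2,  d w = b om e2,  d e2 = -om (b w - 2 H0 e4),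
     dt = -tau rho,  f dy = rho w + om e2,  b = tau f'/f,
   and Cartan's structure equations force b to be constant.  The vanishing of the
   component of H along the other normal direction gives
   d tau = (f'/f) (1 - tau^2) (2 - tau^2) rho, and together with db = 0 this is
   the differential equation for f with a^2 - 4 H0^2 = b^2; the surface is
   space-like exactly when tau^2 < 1, that is b^2 f^2 < f'^2.  Under that
   inequality b^2 is determined by f, so it is constant on a connected surface;
   and even without it a second constant root would make f'/f constant.
   Finally 2 H0 w + b e4 and y - w / (b f) are constant and b w - 2 H0 e4 runs on
   a circle, which identifies the surface with the rotational one.  Conversely,
   the rotational surface over J x R has these properties by direct computation. *)

(** * Partial derivatives and smooth functions *)

(** The Christoffel symbols depend on t alone, so every statement becomes one about t and the
    spatial part y, and a unit normal without time component becomes, up to the factor f, a unit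
    vector of E^3. The constant a has a direct meaning: on a level curve of t, where [om] is the arc
    length, e2 turns at the rate sqrt(b^2 + 4 H0^2) = |a|, so these curves are circles of radius 1 /
    |a| in the spacetime. Only b^2 enters the differential equation, and the sign of b depends on
    the orientation of the frame; charts are therefore compared through b^2. Its constancy is at
    first local. The passage to the whole surface is a clopen argument, which needs b^2 to be
    determined at each point by the value of t: this is where the space-like inequality enters.
    Congruence asks for a diffeomorphism of parameter domains; the coordinates (t, angle) are
    obtained from the inverse function theorem. *)

Lemma differentiable_eps (R : realType) (V W : normedModType R) (F : V -> W) x :
  differentiable F x -> forall e, 0 < e ->
  \forall y \near x, `|F y - F x - 'd F x (y - x)| <= e * `|y - x|.
Proof.
move=> /diffP[cF dF] e e0.
have /eqaddoP : F = cst (F x) + (fun y => 'd F x (y - x)) +o_ x (fun y => y - x).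
  by apply/funext => y /=; rewrite [LHS]dF lim_id.
by move=> /(_ e e0); apply: filterS => y /=; rewrite opprD addrA.
Qed.

(** Any continuous linear map may serve as candidate differential. This is the form in which
    differentiability passes to a locally equal function and to an inverse map. *)
Lemma differentiable_epsP (R : realType) (V W : normedModType R) (F : V -> W) x :
  differentiable F x <-> exists2 L : {linear V -> W}, continuous L &
    forall e, 0 < e -> \forall y \near x, `|F y - F x - L (y - x)| <= e * `|y - x|.
Proof.
split=> [dF|[L cL dL]].
  by exists ('d F x); [have /diffP[] := dF|exact: differentiable_eps].
have eqF : F \o shift x = cst (F x) + L +o_ 0 id.
  apply/eqaddoP => e e0; have := dL e e0.
  rewrite (near_shift 0 x).
  apply: filterS => y /=.
  by rewrite subr0 !(addrC x, addrK) opprD !addrA.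
apply/diff_locallyP; have dE := diff_unique cL eqF.
by split; rewrite dE.
Unshelve. all: by end_near.
Qed.

Lemma ler_dist_mid (R : realFieldType) (a b c d e : R) :
  `|a - c| < e / 2 -> `|b - d| < e / 2 -> d = c -> `|a - b| <= e.
Proof. move=> + + dc; rewrite {}dc => ac bc; have := ler_distD c a b; rewrite (distrC c b); lra. Qed.

Section Partial.
Context {R : realType} {n : nat}.
Local Notation V := ('rV[R]_n.+1).
Implicit Types (A : set V) (x v : V) (k l : 'I_n.+1).

Lemma pd_eq_on (W : normedModType R) A (F G : V -> W) k x :
  open A -> (forall y, A y -> F y = G y) -> A x -> pd k F x = pd k G x.
Proof.
move=> oA FG Ax; apply: near_eq_derive.
by move: (open_nbhs_nbhs (conj oA Ax)); apply: filterS => y; exact: FG.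
Qed.

Lemma differentiable_eq_on (W : normedModType R) A (F G : V -> W) x :
  open A -> (forall y, A y -> F y = G y) -> A x ->
  differentiable F x -> differentiable G x.
Proof.
move=> oA FG Ax /differentiable_epsP[L cL dL]; apply/differentiable_epsP.
exists L => // e e0; have nA := open_nbhs_nbhs (conj oA Ax).
by apply: filterS2 nA (dL e e0) => y Ay; rewrite !FG.
Qed.

Lemma dirE (W : normedModType R) (F : V -> W) x v :
  differentiable F x -> 'D_v F x = \sum_k v 0 k *: pd k F x.
Proof.
move=> dF; rewrite deriveE // [X in 'd F x X]row_sum_delta linear_sum.
by apply: eq_bigr => k _; rewrite linearZ /pd deriveE.
Qed.

Lemma differentiable_rowP m (F : V -> 'rV[R]_m) x :
  differentiable F x <-> forall j, differentiable (fun y => F y 0 j : R^o) x.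
Proof.
split=> [dF j|dF].
  apply: (differentiable_comp (f := F) (g := fun M : 'rV[R]_m => M 0 j : R^o)) => //.
  exact: differentiable_coord.
have -> : F = \sum_(j < m) (fun y => F y 0 j *: (delta_mx 0 j : 'rV[R]_m)).
  by apply/funext => y; rewrite [LHS]row_sum_delta fct_sumE.
by apply: differentiable_sum => j; exact: differentiableZl.
Qed.

Lemma pd_row m (F : V -> 'rV[R]_m) k x j :
  differentiable F x -> pd k F x 0 j = pd k (fun y => F y 0 j : R^o) x.
Proof. by move=> dF; rewrite /pd derive_mx ?mxE //; exact: diff_derivable. Qed.

Lemma MVT_dir (F : V -> R^o) x v :
  (forall s, 0 <= s <= 1 -> differentiable F (x + s *: v)) ->
  exists2 s, 0 <= s <= 1 & F (x + v) - F x = 'D_v F (x + s *: v).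
Proof.
move=> dF.
pose h (s : R) : V := x + s *: v.
have dh (s : R) : differentiable h s /\ 'd h s = *:%R^~ v :> (R -> V).
  have dv : is_diff s ( *:%R^~ v : R -> V) ( *:%R^~ v) by exact: is_diff_scalel.
  have [d1 d2] : is_diff s (cst x + *:%R^~ v : R -> V) (0 + *:%R^~ v).
    exact: is_diffD.
  by split => //; rewrite d2 add0r.
have dFh (s : R) : 0 <= s <= 1 -> is_derive s 1 (F \o h : R -> R^o) ('D_v F (h s)).
  move=> s01; have [dhs dhE] := dh s.
  have dFh : differentiable (F \o h) s.
    by apply: differentiable_comp => //; exact: dF.
  apply: DeriveDef; first exact: diff_derivable.
  rewrite deriveE // (diff_comp dhs (dF s s01)) /= dhE scale1r deriveE //.
  exact: dF.
have [||c c01] := @MVT_segment R (F \o h) (fun s => 'D_v F (h s)) 0 1 ler01.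
- by move=> s /[!in_itv] /= /andP[s0 s1]; apply: dFh; rewrite !ltW.
- apply: derivable_within_continuous => s /[!in_itv] /= s01.
  by have [] := dFh s s01.
rewrite /h /= scale1r scale0r addr0 subr0 mulr1 => e.
by exists c => //; move: c01; rewrite in_itv.
Qed.

Lemma pdE (W : normedModType R) (F : V -> W) k x :
  differentiable F x -> pd k F x = 'd F x (delta_mx 0 k).
Proof. by move=> dF; rewrite /pd deriveE. Qed.

Lemma pdD (W : normedModType R) (F G : V -> W) k x :
  differentiable F x -> differentiable G x ->
  pd k (fun y => F y + G y) x = pd k F x + pd k G x.
Proof. by move=> dF dG; apply: deriveD; exact: diff_derivable. Qed.

Lemma pdN (W : normedModType R) (F : V -> W) k x :
  differentiable F x -> pd k (fun y => - F y) x = - pd k F x.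
Proof. by move=> dF; apply: deriveN; exact: diff_derivable. Qed.

Lemma pdB (W : normedModType R) (F G : V -> W) k x :
  differentiable F x -> differentiable G x ->
  pd k (fun y => F y - G y) x = pd k F x - pd k G x.
Proof. by move=> dF dG; apply: deriveB; exact: diff_derivable. Qed.

Lemma pdM (F G : V -> R^o) k x :
  differentiable F x -> differentiable G x ->
  pd k (fun y => F y * G y : R^o) x = pd k F x * G x + F x * pd k G x.
Proof.
move=> dF dG; rewrite /pd deriveM; try exact: diff_derivable.
by rewrite addrC /GRing.scale /= [_ * 'D_ _ F x]mulrC.
Qed.

Lemma pd_cst (W : normedModType R) (c : W) k x : pd k (fun=> c) x = 0.
Proof. exact: derive_cst. Qed.

Lemma pd_coord k j x : pd k (fun y => y 0 j : R^o) x = (k == j)%:R.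
Proof.
have dF : differentiable (@id V) x by exact: (ex_diff (is_diff_def := is_diff_id x)).
by rewrite -(@pd_row n.+1 id k x j dF) /pd derive_id mxE eqxx eq_sym.
Qed.

Lemma differentiable_comp1 (h : R -> R^o) (F : V -> R^o) x :
  derivable h (F x) 1 -> differentiable F x -> differentiable (h \o F) x.
Proof.
by move=> /derivable1_diffP dh dF; apply: differentiable_comp.
Qed.

Lemma pd_comp1 (h : R -> R^o) (F : V -> R^o) k x :
  derivable h (F x) 1 -> differentiable F x ->
  pd k (fun y => h (F y) : R^o) x = derive1 h (F x) * pd k F x.
Proof.
move=> dh dF; have dh' := (derivable1_diffP _ _).1 dh.
rewrite pdE; last exact: (differentiable_comp dF dh').
rewrite (diff_comp dF dh') /= -(pdE _ dF) (deriv1E dh).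
by rewrite /GRing.scale /= mulrC.
Qed.

Lemma pd_comp m (W : normedModType R) (F : V -> 'rV[R]_m.+1)
    (G : 'rV[R]_m.+1 -> W) k x :
  differentiable F x -> differentiable G (F x) ->
  pd k (fun y => G (F y)) x = \sum_j pd k F x 0 j *: pd j G (F x).
Proof.
move=> dF dG; rewrite pdE; last exact: (differentiable_comp dF dG).
rewrite (diff_comp dF dG) /= -(pdE _ dF) -deriveE //.
rewrite deriveE // [X in 'd G _ X]row_sum_delta linear_sum.
by apply: eq_bigr => j _; rewrite linearZ /pd -deriveE.
Qed.

Lemma norm_delta (k : 'I_n.+1) : `|delta_mx 0 k : V| <= 1.
Proof.
rewrite [leLHS]/Num.Def.normr /= mx_normrE; apply: bigmax_le => // -[i j] _ /=.
by rewrite mxE; case: (_ && _); rewrite ?normr1 ?normr0.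
Qed.

Lemma pd_shift (W : normedModType R) (F : V -> W) k b x :
  pd k (fun y => F (y + b)) x = pd k F (x + b).
Proof.
rewrite /pd /derive; set d := (fun _ : R => _); set d' := (fun _ : R => _).
by suff -> : d = d' by []; apply/funext => h; rewrite /d /d' /= addrA.
Qed.

Lemma dirZ (W : normedModType R) (F : V -> W) k (h : R) x :
  differentiable F x -> 'D_(h *: delta_mx 0 k) F x = h *: pd k F x.
Proof. by move=> dF; rewrite deriveE // linearZ /= -deriveE. Qed.

Lemma differentiable_shift (W : normedModType R) (F : V -> W) b x :
  differentiable F (x + b) -> differentiable (fun y => F (y + b)) x.
Proof.
move=> dF; exact: (@differentiable_comp _ _ _ _ (fun y => y + b) F).
Qed.

(** The mean value theorem is used twice: for [F (y + v) - F y] along [u], then for [pd k F] along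
    [v]. *)
Lemma second_difference (F : V -> R^o) k l (h : R) x :
  (forall s t, 0 <= s <= 1 -> 0 <= t <= 1 ->
    let y := x + s *: (h *: delta_mx 0 k) + t *: (h *: delta_mx 0 l) in
    differentiable F y /\ differentiable (pd k F) y) ->
  exists s t, [/\ 0 <= s <= 1, 0 <= t <= 1 &
    F (x + h *: delta_mx 0 k + h *: delta_mx 0 l) - F (x + h *: delta_mx 0 k)
    - (F (x + h *: delta_mx 0 l) - F x) = h ^+ 2 *
    pd l (pd k F) (x + s *: (h *: delta_mx 0 k) + t *: (h *: delta_mx 0 l))].
Proof.
set u : V := h *: delta_mx 0 k; set v : V := h *: delta_mx 0 l => dF.
have one01 : (0 : R) <= (1 : R) <= (1 : R) by apply/andP; split.
have zero01 : (0 : R) <= (0 : R) <= (1 : R) by apply/andP; split.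
pose G (y : V) : R^o := F (y + v) - F y.
have d1 s : 0 <= s <= 1 -> differentiable F (x + s *: u + v).
  by move=> s01; have := (dF s 1 s01 one01).1; rewrite scale1r.
have d0 s : 0 <= s <= 1 -> differentiable F (x + s *: u).
  by move=> s01; have := (dF s 0 s01 zero01).1; rewrite scale0r addr0.
have dG s : 0 <= s <= 1 -> differentiable G (x + s *: u).
  move=> s01; apply: differentiableB; last exact: d0.
  by apply: differentiable_shift; exact: d1.
have [s s01 es] := MVT_dir dG.
have [t|t t01 et] := @MVT_dir (pd k F) (x + s *: u) v.
  by move=> t01; have := (dF s t s01 t01).2.
exists s, t; split=> //; move: es; rewrite /G => ->.
rewrite dirZ; last exact: dG.
rewrite pdB; [|exact: differentiable_shift (d1 _ s01)|exact: d0].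
rewrite pd_shift et dirZ; last by have := (dF s t s01 t01).2.
by rewrite /GRing.scale /= mulrA expr2.
Qed.

Lemma continuous2_ball A (P Q : V -> R^o) x (e : R) : open A -> A x ->
  {for x, continuous P} -> {for x, continuous Q} -> 0 < e ->
  exists2 r : R, 0 < r & forall y, ball x r y ->
    [/\ A y, `|P x - P y| < e & `|Q x - Q y| < e].
Proof.
move=> oA Ax cP cQ e0.
suff /nbhs_ballP[r r0 rA] : \forall y \near x,
    [/\ A y, `|P x - P y| < e & `|Q x - Q y| < e] by exists r.
have nA := open_nbhs_nbhs (conj oA Ax).
have /cvgrPdist_lt/(_ _ e0) n1 := cP; have /cvgrPdist_lt/(_ _ e0) n2 := cQ.
by apply: filterS3 nA n1 n2 => y.
Qed.

(** The second difference is symmetric in the two directions, so each mixed derivative takes, at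
    some point near x, a value which the other takes at a point near x. Continuity at x does the
    rest. *)
Lemma schwarz A (F : V -> R^o) k l x : open A -> A x ->
  (forall y, A y -> differentiable F y) ->
  (forall i y, A y -> differentiable (pd i F) y) ->
  (forall i j, {for x, continuous (pd i (pd j F))}) ->
  pd k (pd l F) x = pd l (pd k F) x.
Proof.
move=> oA Ax dF ddF cF; apply/eqP; rewrite -subr_eq0 -normr_le0.
apply/ler_addgt0Pr => e e0; rewrite add0r.
have e20 : 0 < e / 2 by rewrite divr_gt0.
have [r r0 rA] := continuous2_ball oA Ax (cF k l) (cF l k) e20.
(* Two steps of length at most [h] must stay inside the ball of radius [r]. *)
have [h h0 hr] : exists2 h : R, 0 < h & h + h < r by exists (r / 4); lra.
have inb i j s t : 0 <= s <= 1 -> 0 <= t <= 1 ->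
    ball x r (x + s *: (h *: (delta_mx 0 i : V)) + t *: (h *: delta_mx 0 j)).
  move=> /andP[s0 s1] /andP[t0 t1].
  rewrite -ball_normE /= -addrA opprD addrA subrr add0r normrN.
  apply: (le_lt_trans (ler_normD _ _)).
  have H (c : R) m : 0 <= c -> c <= 1 -> `|c *: (h *: (delta_mx 0 m : V))| <= h.
    move=> c0 c1; rewrite !normrZ (ger0_norm c0) (ger0_norm (ltW h0)) -[leRHS]mul1r.
    have H1 : h * `|delta_mx 0 m : V| <= h.
      by rewrite -[leRHS]mulr1 ler_wpM2l ?(ltW h0) // norm_delta.
    by apply: ler_pM => //; rewrite mulr_ge0 // ltW.
  by apply: (le_lt_trans (lerD (H s i s0 s1) (H t j t0 t1))).
have dFb i j s t : 0 <= s <= 1 -> 0 <= t <= 1 ->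
    let y := x + s *: (h *: (delta_mx 0 i : V)) + t *: (h *: delta_mx 0 j) in
    differentiable F y /\ differentiable (pd i F) y.
  by move=> s01 t01 y; have [Ay _ _] := rA _ (inb i j s t s01 t01); split; auto.
have [s [t [s01 t01 e1]]] := second_difference (dFb k l).
have [s' [t' [s01' t01' e2]]] := second_difference (dFb l k).
have [_ _ lt1] := rA _ (inb k l s t s01 t01).
have [_ lt2 _] := rA _ (inb l k s' t' s01' t01').
have h2 : h ^+ 2 != 0 by rewrite expf_neq0 // gt_eqF.
have eL : (F (x + h *: delta_mx 0 k + h *: delta_mx 0 l) - F (x + h *: delta_mx 0 k)
    - (F (x + h *: delta_mx 0 l) - F x) : R)
   = F (x + h *: delta_mx 0 l + h *: delta_mx 0 k) - F (x + h *: delta_mx 0 l)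
    - (F (x + h *: delta_mx 0 k) - F x).
  by rewrite (addrAC x (h *: delta_mx 0 k)) !opprB; ring.
move: eL; rewrite e1 e2 => /(mulfI h2) e12.
exact: (ler_dist_mid lt2 lt1 e12).
Qed.

Lemma const_on_ball (F : V -> R^o) x (r : R) :
  (forall y, ball x r y -> differentiable F y) ->
  (forall k y, ball x r y -> pd k F y = 0) ->
  forall y, ball x r y -> F y = F x.
Proof.
move=> dF F0 y xy.
have inb (s : R) : 0 <= s <= 1 -> ball x r (x + s *: (y - x)).
  move=> /andP[s0 s1]; move: xy; rewrite -!ball_normE /= opprD addrA subrr add0r.
  rewrite normrN normrZ (ger0_norm s0) distrC => yx; apply: le_lt_trans yx.
  by rewrite -[leRHS]mul1r ler_wpM2r.
have [s|s s01] := @MVT_dir F x (y - x); first by move=> s01; exact/dF/inb.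
rewrite (addrC x (y - x)) subrK dirE; last exact/dF/inb.
rewrite big1 => [|k _]; first by move/eqP; rewrite subr_eq0 => /eqP.
by rewrite F0 ?scaler0 //; exact: inb.
Qed.

(* Off by one: Ck A m asks for m + 1 derivatives. *)
Fixpoint Ck (W : normedModType R) A (m : nat) (F : V -> W) : Prop :=
  (forall x, A x -> differentiable F x) /\
  if m is m'.+1 then forall k, Ck A m' (pd k F) else True.

(** [smooth_on] quantifies over lists of derivatives, which gives no usable induction for products
    and compositions; grading by the order does. *)
Lemma smooth_onP (W : normedModType R) A (F : V -> W) :
  smooth_on A F <-> forall m, Ck A m F.
Proof.
split=> [sF m|cF].
  elim: m F sF => [|m IH] F sF; split=> //; try by move=> x Ax; exact: (sF [::]).
  by move=> k; apply: IH => s x Ax; have := sF (rcons s k) x Ax; rewrite foldr_rcons.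
move=> s; elim/last_ind: s F cF => [|s k IH] F cF x Ax; first exact: (cF 0).1.
by rewrite foldr_rcons; apply: IH => // m; exact: (cF m.+1).2.
Qed.

Lemma smooth_on_diff (W : normedModType R) A (F : V -> W) x :
  smooth_on A F -> A x -> differentiable F x.
Proof. by move=> sF; exact: (sF [::]). Qed.

Lemma smooth_on_pd (W : normedModType R) A (F : V -> W) k :
  smooth_on A F -> smooth_on A (pd k F).
Proof. by move=> sF s x Ax; have := sF (rcons s k) x Ax; rewrite foldr_rcons. Qed.

Lemma smooth_on_sub (W : normedModType R) A B (F : V -> W) :
  B `<=` A -> smooth_on A F -> smooth_on B F.
Proof. by move=> BA sF s x /BA; exact: sF. Qed.

Lemma smooth_schwarz A (F : V -> R^o) k l x : open A -> A x ->
  smooth_on A F -> pd k (pd l F) x = pd l (pd k F) x.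
Proof.
move=> oA Ax sF; apply: (@schwarz A F k l x oA Ax) => [y|i y|i j].
- exact: smooth_on_diff sF.
- exact/smooth_on_diff/smooth_on_pd.
- apply/differentiable_continuous/(smooth_on_diff _ Ax).
  exact/smooth_on_pd/smooth_on_pd.
Qed.

Lemma Ck_diff (W : normedModType R) A m (F : V -> W) x :
  Ck A m F -> A x -> differentiable F x.
Proof. by case: m => [|m] [dF _]; exact: dF. Qed.

Lemma CkS (W : normedModType R) A m (F : V -> W) : Ck A m.+1 F -> Ck A m F.
Proof.
elim: m F => [|m IH] F [dF cF]; split=> // k; exact: IH.
Qed.

(** The rules of differentiation hold only on [A]; this lets the closure lemmas replace a derivative
    by the expression that the rule gives there. *)
Lemma Ck_eq_on (W : normedModType R) A m (F G : V -> W) : open A ->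
  (forall x, A x -> F x = G x) -> Ck A m F -> Ck A m G.
Proof.
move=> oA; elim: m F G => [|m IH] F G FG [dF cF]; split => //;
  try by move=> x Ax; exact: (differentiable_eq_on oA FG Ax (dF x Ax)).
by move=> k; apply: IH (cF k) => x Ax; exact: (pd_eq_on k oA FG Ax).
Qed.

Lemma Ck_cst (W : normedModType R) A m (c : W) : Ck A m (fun=> c).
Proof.
elim: m c => [|m IH] c; split=> // k.
by have -> : pd k (fun=> c) = (fun=> 0) by apply/funext => x; exact: pd_cst.
Qed.

Lemma CkD (W : normedModType R) A m (F G : V -> W) : open A ->
  Ck A m F -> Ck A m G -> Ck A m (fun x => F x + G x).
Proof.
move=> oA; elim: m F G => [|m IH] F G [dF cF] [dG cG]; split=> //;
  try by move=> x Ax; apply: differentiableD; auto.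
move=> k; apply: (Ck_eq_on oA _ (IH _ _ (cF k) (cG k))) => x Ax.
by rewrite pdD; auto.
Qed.

Lemma CkM A m (F G : V -> R^o) : open A ->
  Ck A m F -> Ck A m G -> Ck A m (fun x => F x * G x : R^o).
Proof.
move=> oA; elim: m F G => [|m IH] F G cF cG; split=> //;
  try by move=> x Ax; apply: differentiableM; [exact: Ck_diff cF _|exact: Ck_diff cG _].
move=> k; have cFk := cF.2 k; have cGk := cG.2 k.
have cF' := CkS cF; have cG' := CkS cG.
apply: (Ck_eq_on oA _ (CkD oA (IH _ _ cFk cG') (IH _ _ cF' cGk))) => x Ax.
by rewrite pdM //; [exact: Ck_diff cF _|exact: Ck_diff cG _].
Qed.

Lemma Ck_comp1 A (J : set R) m (h : R -> R^o) (F : V -> R^o) : open A ->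
  smooth_on1 J h -> (forall x, A x -> J (F x)) ->
  Ck A m F -> Ck A m (fun x => h (F x) : R^o).
Proof.
move=> oA + AJ; elim: m h F AJ => [|m IH] h F AJ sh cF; split => //;
  try by move=> x Ax; apply: differentiable_comp1;
    [exact: (sh 0%N _ (AJ x Ax))|exact: Ck_diff cF _].
move=> k; have cFk := cF.2 k.
have sh' : smooth_on1 J (derive1 h).
  by move=> i t Jt; have := sh i.+1 t Jt; rewrite derive1Sn.
apply: (Ck_eq_on oA _ (CkM oA (IH _ F AJ sh' (CkS cF)) cFk)) => x Ax.
rewrite pd_comp1 //; first exact: (sh 0%N _ (AJ x Ax)).
exact: Ck_diff cF _.
Qed.

Lemma Ck_rowP m A r (F : V -> 'rV[R]_r) : open A ->
  Ck A m F <-> forall j, Ck A m (fun x => F x 0 j : R^o).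
Proof.
move=> oA; split.
  elim: m F => [|m IH] F [dF cF] j; split=> //;
    try by move=> x Ax; exact: ((differentiable_rowP F x).1 (dF x Ax) j).
  move=> k; apply: (Ck_eq_on oA _ (IH _ (cF k) j)) => x Ax.
  by rewrite pd_row //; exact: dF.
elim: m F => [|m IH] F cF; have dF x (Ax : A x) : differentiable F x by
    apply/differentiable_rowP => j; exact: Ck_diff (cF j) Ax.
  by split.
split=> // k; apply: IH => j.
by apply: (Ck_eq_on oA _ ((cF j).2 k)) => x Ax; rewrite pd_row //; exact: dF.
Qed.

End Partial.

(** * Reciprocals, square roots, determinants and inverse matrices *)

Section Smooth.
Context {R : realType} {n : nat}.
Local Notation V := ('rV[R]_n.+1).
Implicit Types (A : set V) (x v : V) (k l : 'I_n.+1).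

Lemma pdV (F : V -> R^o) k x : F x != 0 -> differentiable F x ->
  pd k (fun y => (F y)^-1 : R^o) x = - (F x)^-1 * (F x)^-1 * pd k F x.
Proof.
move=> F0 dF; rewrite /pd deriveV //; last exact: diff_derivable.
by rewrite /GRing.scale /= expr2 invfM !mulNr.
Qed.

(** Induction on the order for a fixed [F]: the derivative of the reciprocal is a product of the
    reciprocal, already known at the lower order, and a derivative of [F]. The square root is
    treated in the same way. *)
Lemma CkV A m (F : V -> R^o) : open A -> (forall x, A x -> F x != 0) ->
  Ck A m F -> Ck A m (fun x => (F x)^-1 : R^o).
Proof.
move=> oA F0; elim: m => [|m IH] cF; split=> //;
  try by move=> x Ax; apply: differentiableV; [exact: Ck_diff cF _|exact: F0].
move=> k; have cV := IH (CkS cF).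
have cN : Ck A m (fun x => -1 * (F x)^-1 * (F x)^-1 * pd k F x : R^o).
  apply: CkM => //; last exact: cF.2.
  by apply: CkM => //; apply: CkM => //; exact: Ck_cst.
apply: (Ck_eq_on oA _ cN) => x Ax.
by rewrite pdV ?mulN1r //; [exact: F0|exact: Ck_diff cF _].
Qed.

Lemma pd_sqrt (F : V -> R^o) k x : 0 < F x -> differentiable F x ->
  pd k (fun y => Num.sqrt (F y) : R^o) x = (2 * Num.sqrt (F x))^-1 * pd k F x.
Proof.
move=> F0 dF; have [d1 d2] := is_derive1_sqrt F0.
by rewrite pd_comp1 // derive1E d2.
Qed.

Lemma Ck_sqrt A m (F : V -> R^o) : open A -> (forall x, A x -> 0 < F x) ->
  Ck A m F -> Ck A m (fun x => Num.sqrt (F x) : R^o).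
Proof.
move=> oA F0; elim: m => [|m IH] cF; split=> //;
  try by move=> x Ax; apply: differentiable_comp1;
    [exact: (ex_derive (is_derive := is_derive1_sqrt (F0 _ Ax)))|exact: Ck_diff cF _].
move=> k; have cS := IH (CkS cF).
have cN : Ck A m (fun x => (2 * Num.sqrt (F x))^-1 * pd k F x : R^o).
  apply: CkM => //; last exact: cF.2.
  apply: CkV => // [x Ax|]; last by apply: CkM => //; exact: Ck_cst.
  by rewrite mulf_neq0 // gt_eqF // sqrtr_gt0 F0.
apply: (Ck_eq_on oA _ cN) => x Ax.
by rewrite pd_sqrt //; [exact: F0|exact: Ck_diff cF _].
Qed.

Lemma Ck_sum A m (T : Type) (s : seq T) (P : pred T) (F : T -> V -> R^o) : open A ->
  (forall i, Ck A m (F i)) -> Ck A m (fun x => \sum_(i <- s | P i) F i x : R^o).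
Proof.
move=> oA cF; elim: s => [|i s IH].
  have -> : (fun x => \sum_(i <- [::] | P i) F i x : R^o) = (fun=> 0).
    by apply/funext => x; rewrite big_nil.
  exact: Ck_cst.
have -> : (fun x => \sum_(j <- i :: s | P j) F j x : R^o) =
    if P i then (fun x => F i x + \sum_(j <- s | P j) F j x : R^o)
    else (fun x => \sum_(j <- s | P j) F j x : R^o).
  by case: ifPn => Pi; apply/funext => x; rewrite big_cons ?Pi // (negbTE Pi).
by case: ifP => // _; exact: CkD.
Qed.

Lemma Ck_prod A m (T : Type) (s : seq T) (P : pred T) (F : T -> V -> R^o) : open A ->
  (forall i, Ck A m (F i)) -> Ck A m (fun x => \prod_(i <- s | P i) F i x : R^o).
Proof.
move=> oA cF; elim: s => [|i s IH].
  have -> : (fun x => \prod_(i <- [::] | P i) F i x : R^o) = (fun=> 1).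
    by apply/funext => x; rewrite big_nil.
  exact: Ck_cst.
have -> : (fun x => \prod_(j <- i :: s | P j) F j x : R^o) =
    if P i then (fun x => F i x * \prod_(j <- s | P j) F j x : R^o)
    else (fun x => \prod_(j <- s | P j) F j x : R^o).
  by case: ifPn => Pi; apply/funext => x; rewrite big_cons ?Pi // (negbTE Pi).
by case: ifP => // _; exact: CkM.
Qed.

Lemma Ck_det A m p (B : V -> 'M[R]_p) : open A ->
  (forall i j, Ck A m (fun x => B x i j : R^o)) -> Ck A m (fun x => \det (B x) : R^o).
Proof.
move=> oA cB; rewrite /determinant; apply: Ck_sum => // s.
by apply: CkM => //; [exact: Ck_cst|exact: Ck_prod].
Qed.

(** Cramer's rule: the entries are cofactors divided by the determinant. *)
Lemma Ck_invmx A m p (B : V -> 'M[R]_p) i j : open A ->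
  (forall x, A x -> B x \in unitmx) ->
  (forall i j, Ck A m (fun x => B x i j : R^o)) ->
  Ck A m (fun x => invmx (B x) i j : R^o).
Proof.
move=> oA uB cB.
have cdet := Ck_det oA cB.
have c : Ck A m (fun x => (\det (B x))^-1 * ((-1) ^+ (j + i) * \det (row' j (col' i (B x)))) : R^o).
  apply: CkM => //.
    by apply: CkV => // x /uB; rewrite unitmxE unitfE.
  apply: CkM => //; first exact: Ck_cst.
  apply: Ck_det => // i' j'.
  have -> : (fun x => row' j (col' i (B x)) i' j' : R^o) =
    (fun x => B x (lift j i') (lift i j') : R^o) by apply/funext => x; rewrite !mxE.
  exact: cB.
apply: (Ck_eq_on oA _ c) => x Ax.
by rewrite /invmx uB // !mxE /cofactor.
Qed.

End Smooth.

Section CompVec.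
Context {R : realType}.

Lemma Ck_comp n m p (A : set 'rV[R]_n.+1) (B : set 'rV[R]_m.+1)
    (F : 'rV[R]_n.+1 -> 'rV[R]_m.+1) (G : 'rV[R]_m.+1 -> R^o) :
  open A -> (forall x, A x -> B (F x)) -> smooth_on B G -> Ck A p F ->
  Ck A p (fun x => G (F x)).
Proof.
move=> oA AB; elim: p G => [|p IH] G sG cF;
  have dGF x (Ax : A x) : differentiable (fun x => G (F x)) x by
    apply: (@differentiable_comp _ _ _ _ F G); [exact: Ck_diff cF _|
      exact: smooth_on_diff sG (AB x Ax)].
  by split.
split=> // k.
have c : Ck A p (fun x => \sum_j pd k F x 0 j * pd j G (F x) : R^o).
  apply: Ck_sum => // j; apply: CkM => //.
    exact: ((Ck_rowP p (pd k F) oA).1 (cF.2 k) j).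
  by apply: IH; [exact: smooth_on_pd|exact: CkS].
apply: (Ck_eq_on oA _ c) => x Ax.
by rewrite (pd_comp k (Ck_diff cF Ax) (smooth_on_diff sG (AB x Ax))).
Qed.

End CompVec.

Section SmoothRules.
Context {R : realType} {n : nat}.
Variables (A : set 'rV[R]_n.+1) (oA : open A).
Implicit Types F G : 'rV[R]_n.+1 -> R^o.

Lemma smooth_eq_on (W : normedModType R) (F G : 'rV[R]_n.+1 -> W) :
  (forall x, A x -> F x = G x) -> smooth_on A F -> smooth_on A G.
Proof. by move=> FG /smooth_onP sF; apply/smooth_onP => m; exact: Ck_eq_on (sF m). Qed.

Lemma smooth_cst (W : normedModType R) (c : W) :
  smooth_on A (fun _ : 'rV[R]_n.+1 => c).
Proof. by apply/smooth_onP => m; exact: Ck_cst. Qed.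

Lemma smooth_coord j : smooth_on A (fun x => x 0 j : R^o).
Proof.
have idx (x : 'rV[R]_n.+1) : differentiable id x.
  exact: (ex_diff (is_diff_def := is_diff_id x)).
apply/smooth_onP; case=> [|m]; split=> //;
  try by move=> x _; exact: ((differentiable_rowP id x).1 (idx x) j).
move=> k; have -> : pd k (fun x => x 0 j : R^o) = (fun=> (k == j)%:R).
  by apply/funext => x; exact: pd_coord.
exact: Ck_cst.
Qed.

Lemma smooth_D (W : normedModType R) (F G : 'rV[R]_n.+1 -> W) :
  smooth_on A F -> smooth_on A G -> smooth_on A (fun x => F x + G x).
Proof. by move=> /smooth_onP sF /smooth_onP sG; apply/smooth_onP => m; exact: CkD. Qed.

Lemma smooth_M F G : smooth_on A F -> smooth_on A G ->
  smooth_on A (fun x => F x * G x : R^o).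
Proof. by move=> /smooth_onP sF /smooth_onP sG; apply/smooth_onP => m; exact: CkM. Qed.

Lemma smooth_N F : smooth_on A F -> smooth_on A (fun x => - F x : R^o).
Proof.
move=> sF; apply: (@smooth_eq_on _ (fun x => -1 * F x : R^o)) => [x _|].
  by rewrite mulN1r.
exact/smooth_M/sF/smooth_cst.
Qed.

Lemma smooth_B F G : smooth_on A F -> smooth_on A G ->
  smooth_on A (fun x => F x - G x : R^o).
Proof. by move=> sF sG; apply: smooth_D => //; exact: smooth_N. Qed.

Lemma smooth_V F : (forall x, A x -> F x != 0) -> smooth_on A F ->
  smooth_on A (fun x => (F x)^-1 : R^o).
Proof. by move=> F0 /smooth_onP sF; apply/smooth_onP => m; exact: CkV. Qed.

Lemma smooth_sqrt F : (forall x, A x -> 0 < F x) -> smooth_on A F ->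
  smooth_on A (fun x => Num.sqrt (F x) : R^o).
Proof. by move=> F0 /smooth_onP sF; apply/smooth_onP => m; exact: Ck_sqrt. Qed.

Lemma smooth_comp1 (J : set R) (h : R -> R^o) F :
  smooth_on1 J h -> (forall x, A x -> J (F x)) -> smooth_on A F ->
  smooth_on A (fun x => h (F x)).
Proof. by move=> sh AJ /smooth_onP sF; apply/smooth_onP => m; exact: Ck_comp1 sh _ _. Qed.

Lemma smooth_X F m : smooth_on A F -> smooth_on A (fun x => F x ^+ m : R^o).
Proof.
move=> sF; elim: m => [|m IH]; first exact: smooth_cst.
by apply: (smooth_eq_on _ (smooth_M sF IH)) => x _; rewrite exprS.
Qed.

Lemma smooth_rowP m (F : 'rV[R]_n.+1 -> 'rV[R]_m) :
  smooth_on A F <-> forall j, smooth_on A (fun x => F x 0 j : R^o).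
Proof.
split=> [/smooth_onP sF j|sF]; apply/smooth_onP => p.
  exact: (Ck_rowP p F oA).1.
by apply/Ck_rowP => // j; exact: (smooth_onP _ _).1.
Qed.

End SmoothRules.

(** * The inverse function theorem *)

(** Banach's fixed point theorem, used for the openness of the image, needs complete spaces. *)
HB.instance Definition _ (R : realType) (m n : nat) :=
  Uniform_isComplete.Build 'M[R]_(m, n) (@mx_complete R m n).

Section RowNorm.
Context {R : realType}.

Lemma coord_le_norm m (v : 'rV[R]_m) j : `|v 0 j| <= `|v|.
Proof.
rewrite [leRHS]/Num.Def.normr /= mx_normrE.
exact: (le_bigmax _ (fun i : 'I_1 * 'I_m => `|v i.1 i.2|) (0, j)).
Qed.

Lemma norm_le_coord m (v : 'rV[R]_m) (c : R) :
  0 <= c -> (forall j, `|v 0 j| <= c) -> `|v| <= c.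
Proof.
move=> c0 vc; rewrite [leLHS]/Num.Def.normr /= mx_normrE.
by apply: bigmax_le => // -[i j] _ /=; rewrite ord1.
Qed.

Lemma mulmx_bound p q (B : 'M[R]_(p, q)) :
  exists2 K : R, 0 < K & forall v : 'rV_p, `|v *m B| <= K * `|v|.
Proof.
pose K : R := 1 + \sum_i \sum_j `|B i j|.
have S0 : 0 <= \sum_i \sum_j `|B i j|.
  by apply: sumr_ge0 => i _; exact: sumr_ge0.
have K0 : 0 < K by rewrite /K; lra.
exists K => // v; apply: norm_le_coord => [|j]; first by rewrite mulr_ge0 // ltW.
rewrite mxE; apply: le_trans (ler_norm_sum _ _ _) _.
apply: (@le_trans _ _ (\sum_i `|B i j| * `|v|)).
  by apply: ler_sum => i _; rewrite normrM mulrC ler_wpM2l // coord_le_norm.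
rewrite -mulr_suml ler_wpM2r // /K; apply: (@le_trans _ _ (\sum_i \sum_j `|B i j|)); last by lra.
apply: ler_sum => i _; rewrite (bigD1 j) //= lerDl.
exact: sumr_ge0.
Qed.

Lemma linear_rV_continuous n (W : normedModType R) (f : {linear 'rV[R]_n.+1 -> W}) :
  continuous f.
Proof.
have -> : f = (\sum_(k < n.+1) (fun x : 'rV[R]_n.+1 => (x 0 k : R^o) *: f (delta_mx 0 k)))
    :> ('rV[R]_n.+1 -> W).
  apply/funext => x; rewrite [in LHS](row_sum_delta x) linear_sum fct_sumE.
  by apply: eq_bigr => k _; rewrite linearZ.
move=> x; apply: differentiable_continuous; apply: differentiable_sum => k.
apply: differentiableZl.
exact: differentiable_coord.
Qed.

Lemma ball_convex (V : normedModType R) (x0 y z : V) (r s : R) :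
  ball x0 r y -> ball x0 r z -> 0 <= s <= 1 -> ball x0 r (z + s *: (y - z)).
Proof.
rewrite -ball_normE /= => xy xz /andP[s0 s1].
have -> : x0 - (z + s *: (y - z)) = (1 - s) *: (x0 - z) + s *: (x0 - y).
  rewrite scalerBl scale1r -addrA -scalerN -scalerDr !opprB opprD addrA.
  by rewrite subrKA -scalerN opprB.
apply: (le_lt_trans (ler_normD _ _)); rewrite !normrZ !ger0_norm //; last by lra.
have [->|sn] := eqVneq s 1; first by rewrite subrr mul0r add0r mul1r.
have s1' : s < 1 by rewrite lt_neqAle sn.
have H1 : (1 - s) * `|x0 - z| < (1 - s) * r by rewrite ltr_pM2l // subr_gt0.
have H2 : s * `|x0 - y| <= s * r by rewrite ler_wpM2l // ltW.
rewrite [ltRHS](_ : r = (1 - s) * r + s * r); last by ring.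
exact: ltr_leD H1 H2.
Qed.

End RowNorm.

Section InverseFunction.
Context {R : realType} {n : nat}.
Local Notation V := ('rV[R]_n.+1).

Lemma pd_sum m (W : normedModType R) (F : 'I_m -> V -> W) k x :
  (forall i, differentiable (F i) x) ->
  pd k (fun y => \sum_i F i y) x = \sum_i pd k (F i) x.
Proof.
move=> dF; have -> : (fun y => \sum_i F i y) = \sum_i F i.
  by apply/funext => y; rewrite fct_sumE.
by rewrite /pd derive_sum // => i; exact: diff_derivable.
Qed.

Lemma pd_jacobian m (F : V -> 'rV[R]_m.+1) k j x : differentiable F x ->
  pd k F x 0 j = jacobian F x k j.
Proof. by move=> dF; rewrite /pd deriveEjacobian // -rowE mxE. Qed.

Lemma pd_lin_mx m q (F : V -> 'rV[R]_m.+1) (B : 'M[R]_(m.+1, q)) k j x :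
  differentiable F x ->
  pd k (fun y => (F y *m B) 0 j : R^o) x = (pd k F x *m B) 0 j.
Proof.
move=> dF; have dFi := (differentiable_rowP F x).1 dF.
rewrite mxE (_ : (fun y => _) = (fun y => \sum_i (F y 0 i * B i j : R^o))); last first.
  by apply/funext => y; rewrite mxE.
rewrite pd_sum => [|i]; last first.
  by apply: differentiableM => //; exact: differentiable_cst.
apply: eq_bigr => i _; rewrite pdM ?pd_cst ?mulr0 ?addr0 //.
by rewrite pd_row.
Qed.

Variables (U : set V) (th : V -> V) (x0 : V).
Hypotheses (oU : open U) (Ux0 : U x0) (sth : smooth_on U th)
  (J0 : jacobian th x0 \in unitmx).

Let Li := invmx (jacobian th x0).
(** The Newton map of [th] at [x0]. Its derivative vanishes at [x0], and [th y = z] holds exactly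
    when [y] is a fixed point of [S] shifted by [z *m Li]. *)
Let S j (y : V) : R^o := y 0 j - (th y *m Li) 0 j.

Let sL j : smooth_on U (fun y => (th y *m Li) 0 j : R^o).
Proof.
apply: (smooth_eq_on oU (F := fun y => \sum_i (th y 0 i * Li i j) : R^o)) => [y _|].
  by rewrite mxE.
apply/smooth_onP => m; apply: Ck_sum => // i; apply: (CkM oU); last exact: Ck_cst.
by move: m; apply/smooth_onP; apply: (smooth_rowP oU th).1.
Qed.

Let sS j : smooth_on U (S j).
Proof. by apply: smooth_B => //; exact: smooth_coord. Qed.

Let pdS k j y : U y -> pd k (S j) y = (k == j)%:R - (pd k th y *m Li) 0 j.
Proof.
move=> Uy; have dth := smooth_on_diff sth Uy.
have d1 : differentiable (fun y : V => y 0 j : R^o) y.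
  exact: (smooth_on_diff (@smooth_coord _ _ U j) Uy).
by rewrite (pdB k d1 (smooth_on_diff (sL j) Uy)) pd_coord pd_lin_mx.
Qed.

(** Summed over the n + 1 directions, this bound on the partial derivatives gives the Newton map the
    Lipschitz constant 1/2 in the maximum norm. *)
Let c : R := (2 * n.+1%:R)^-1.

Lemma inverse_function_bound : exists r : R, [/\ 0 < r, ball x0 r `<=` U &
  forall y k j, ball x0 r y -> `|pd k (S j) y| <= c].
Proof.
have c0 : 0 < c by rewrite /c invr_gt0 mulr_gt0.
suff /nbhs_ballP[r r0 rB] : \forall y \near x0,
    U y /\ forall kj : 'I_n.+1 * 'I_n.+1, `|pd kj.1 (S kj.2) y| < c.
  exists r; split=> // [y /rB[]//|y k j /rB[_ /(_ (k, j))/ltW]//].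
apply: filterI; first exact: open_nbhs_nbhs.
suff H (kj : 'I_n.+1 * 'I_n.+1) : \forall y \near x0, `|pd kj.1 (S kj.2) y| < c.
  exact: (@filter_forall _ _ _ _ (@nbhs_filter _ x0) H).
case: kj => k j /=.
have cS : {for x0, continuous (pd k (S j))}.
  by apply: differentiable_continuous; exact: (smooth_on_diff (smooth_on_pd k (sS j))).
have z0 : pd k (S j) x0 = 0.
  rewrite pdS // /pd deriveEjacobian; last exact: (smooth_on_diff sth).
  by rewrite -mulmxA mulmxV // mulmx1 mxE eqxx /= eq_sym subrr.
have /cvgrPdist_lt/(_ _ c0) := cS; rewrite z0.
by apply: filterS => y; rewrite sub0r normrN.
Qed.

Section OnBall.
Variables (r : R) (r0 : 0 < r) (rU : ball x0 r `<=` U)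
  (rS : forall y k j, ball x0 r y -> `|pd k (S j) y| <= c).

Let cE : c * n.+1%:R = 2^-1.
Proof. by rewrite /c invfM -mulrA mulVf ?mulr1 // pnatr_eq0. Qed.

Let sum_bound (v : V) j y : ball x0 r y ->
  `|\sum_k v 0 k * pd k (S j) y| <= 2^-1 * `|v|.
Proof.
move=> by_; apply: le_trans (ler_norm_sum _ _ _) _.
apply: (@le_trans _ _ (\sum_(k < n.+1) `|v| * c)).
  apply: ler_sum => k _; rewrite normrM; apply: ler_pM => //; first exact: coord_le_norm.
  exact: rS.
by rewrite sumr_const card_ord -[leLHS]mulr_natr -mulrA cE mulrC.
Qed.

Let Sv y : V := y - th y *m Li.

Let Sv_lip y z : ball x0 r y -> ball x0 r z -> `|Sv y - Sv z| <= 2^-1 * `|y - z|.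
Proof.
move=> by_ bz; apply: norm_le_coord => [|j]; first by rewrite mulr_ge0.
have bs s : 0 <= s <= 1 -> ball x0 r (z + s *: (y - z)) by exact: ball_convex.
have [s s01|s s01 e] := @MVT_dir _ _ (S j) z (y - z).
  by apply: (smooth_on_diff (sS j)); exact/rU/bs.
have -> : (Sv y - Sv z) 0 j = S j (z + (y - z)) - S j z.
  by rewrite (addrC z (y - z)) subrK /Sv /S !mxE.
rewrite e dirE; last by apply: (smooth_on_diff (sS j)); exact/rU/bs.
exact/sum_bound/bs.
Qed.

Let Sv_inv y z : y - z = (Sv y - Sv z) + (th y - th z) *m Li.
Proof. by rewrite /Sv mulmxBl; apply/rowP => j; rewrite ![in RHS]mxE ![in LHS]mxE; ring. Qed.

(** In [Sv_inv] the first term is at most half of [y - z] and is absorbed by the left side. *)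
Lemma inverse_function_lipschitz : exists2 K : R, 0 < K &
  forall y z, ball x0 r y -> ball x0 r z -> `|y - z| <= K * `|th y - th z|.
Proof.
have [K K0 LK] := mulmx_bound Li.
exists (2 * K) => [|y z by_ bz]; first by rewrite mulr_gt0.
have := ler_normD (Sv y - Sv z) ((th y - th z) *m Li); rewrite -Sv_inv.
have := Sv_lip by_ bz; have := LK (th y - th z); lra.
Qed.

(** The differential of the Newton map fixes every vector killed by the Jacobian, yet it halves
    norms; such a vector is zero. *)
Lemma inverse_function_jacobian y : ball x0 r y -> jacobian th y \in unitmx.
Proof.
move=> by_; rewrite -row_free_unit; apply: inj_row_free => v vJ.
have dth := smooth_on_diff sth (rU by_).
have vS j : \sum_k v 0 k * pd k (S j) y = v 0 j.
  rewrite (eq_bigr (fun k => v 0 k * (k == j)%:R - v 0 k * (pd k th y *m Li) 0 j)) => [|k _].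
  2: by rewrite pdS ?mulrBr //; exact: rU.
  rewrite sumrB (bigD1 j) //= eqxx mulr1 big1 => [|k /negPf ->]; last by rewrite mulr0.
  have -> : \sum_k v 0 k * (pd k th y *m Li) 0 j = ((v *m jacobian th y) *m Li) 0 j.
    rewrite -mulmxA mxE; apply: eq_bigr => k _; congr (_ * _).
    by rewrite /pd deriveEjacobian // -mulmxA -rowE mxE.
  by rewrite vJ mul0mx mxE subr0 addr0.
have : `|v| <= 2^-1 * `|v|.
  apply: norm_le_coord => [|j]; first by rewrite mulr_ge0.
  by rewrite -[X in `|X|]vS; exact: sum_bound.
by move=> vv; apply/eqP; rewrite -normr_le0; lra.
Qed.

(** A preimage of a point near [th x] is found as the fixed point of the shifted Newton map on a
    closed ball around [x]. *)
Lemma inverse_function_open : open (th @` ball x0 r).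
Proof.
rewrite openE => _ [x bx <-].
have [K K0 LK] := mulmx_bound Li.
have /nbhs_closedballP[s sb] : nbhs x (ball x0 r).
  by apply: open_nbhs_nbhs; split => //; exact: ball_open.
have s0 : 0 < s%:num by [].
(* For [y] this close to [th x] the shift [(y - th x) *m Li] is at most s / 2; the contraction
   factor 1/2 leaves the other half, so that [T] maps the closed ball into itself. *)
pose e := s%:num / (2 * K); have e0 : 0 < e by rewrite divr_gt0 // mulr_gt0.
apply/nbhs_ballP; exists e => // y; rewrite -ball_normE /= => xy.
pose T (z : V) : V := Sv z + y *m Li.
have Kx : `|(y - th x) *m Li| <= s%:num / 2.
  apply: le_trans (LK _) _; rewrite distrC.
  have -> : s%:num / 2 = K * e by rewrite /e; field; rewrite gt_eqF.
  by rewrite ler_wpM2l // ltW.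
have inb z : closed_ball x s%:num z -> ball x0 r z by exact: sb.
have TU : {homo T : z / closed_ball x s%:num z >-> closed_ball x s%:num z}.
  move=> z bz; move: (bz); rewrite closed_ballE // /closed_ball_ /= => xz.
  have -> : x - T z = (Sv x - Sv z) - (y - th x) *m Li.
    by rewrite /T /Sv mulmxBl; apply/rowP => j; rewrite ![in RHS]mxE ![in LHS]mxE; ring.
  apply: le_trans (ler_normB _ _) _.
  have := Sv_lip bx (inb _ bz); lra.
pose Tf : {fun closed_ball x s%:num >-> closed_ball x s%:num} :=
  HB.pack T (isFun.Build _ _ _ _ T TU).
have ctr : is_contraction Tf.
  have q0 : (0 : R) <= 2^-1 by [].
  exists (NngNum q0); split => /=; first by lra.
  move=> [u v] /= [bu bv].
  have -> : T u - T v = Sv u - Sv v by rewrite /T opprD addrACA subrr addr0.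
  exact: Sv_lip (inb _ bu) (inb _ bv).
have [|z bz ez] := banach_fixed_point ctr (@closed_ball_closed _ _ _ _).
  by exists x; exact: closed_ballxx.
exists z; first by have := inb z bz; rewrite -ball_normE.
have : (th z - y) *m Li = 0.
  apply/eqP; rewrite mulmxBl subr_eq0; apply/eqP.
  have : z = Sv z + y *m Li by exact: ez.
  by rewrite /Sv -addrA => /eqP; rewrite -subr_eq0 opprD addrA subrr add0r oppr_eq0 addrC
     subr_eq0 => /eqP.
have uL : Li \in unitmx by rewrite unitmx_inv.
by move=> /(congr1 (mulmx^~ (invmx Li))); rewrite mulmxK // mul0mx => /eqP; rewrite subr_eq0 => /eqP.
Qed.

(** Differentiability comes from the Lipschitz bound. Then the derivative of the inverse is the
    inverse Jacobian composed with the inverse map itself, so each order of smoothness yields the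
    next one. *)
Lemma inverse_function_inverse (th' : V -> V) :
  (forall x, ball x0 r x -> th' (th x) = x) -> smooth_on (th @` ball x0 r) th'.
Proof.
move=> th'K; have oB := inverse_function_open; set B := th @` _ in oB *.
have inB y : B y -> ball x0 r (th' y) /\ th (th' y) = y.
  by move=> [x bx <-]; rewrite th'K.
have [K K0 HK] := inverse_function_lipschitz.
have dth' y : B y -> differentiable th' y.
  move=> By; have [bx ex] := inB y By; have uJ := inverse_function_jacobian bx.
  set x := th' y in bx ex uJ *; set J := jacobian th x in uJ.
  have [K' K'0 LK'] := mulmx_bound (invmx J).
  (* The candidate is the inverse of the Jacobian at the preimage. The bounds [K'] for this matrix
     and [K] for the inverse map explain the accuracy e / (K' K) asked of [th]. *)
  apply/differentiable_epsP; exists (mulmxr (invmx J) : {linear V -> V}).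
    exact: linear_rV_continuous.
  move=> e e0.
  have e'0 : 0 < e / (K' * K) by rewrite divr_gt0 // mulr_gt0.
  have dL := differentiable_eps (smooth_on_diff sth (rU bx)).
  have LE (v : V) : 'd th x v = v *m J by rewrite /J /jacobian mul_rV_lin1.
  have /nbhs_ballP[d d0 dd] := dL _ e'0.
  have nB : nbhs y B by apply: open_nbhs_nbhs.
  have dK : 0 < d / K by rewrite divr_gt0.
  apply: filterS2 nB (nbhsx_ballx y _ dK) => z Bz; rewrite -ball_normE /= => yz.
  have [bz ez] := inB z Bz.
  have hzx : `|th' z - x| <= K * `|z - y|.
    by have := HK _ _ bz bx; rewrite ez ex.
  have bd : ball x d (th' z).
    rewrite -ball_normE /= distrC; apply: le_lt_trans hzx _.
    by rewrite mulrC -ltr_pdivlMr // distrC.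
  have := dd _ bd; rewrite /= LE ez ex => H.
  have -> : th' z - x - (z - y) *m invmx J = - ((z - y - (th' z - x) *m J) *m invmx J).
    by rewrite [in RHS](mulmxBl (z - y)) (mulmxK uJ) opprB.
  rewrite normrN; apply: le_trans (LK' _) _.
  have H2 : `|z - y - (th' z - x) *m J| <= e / (K' * K) * (K * `|z - y|).
    by apply: le_trans H _; rewrite ler_wpM2l // ltW.
  apply: (@le_trans _ _ (K' * (e / (K' * K) * (K * `|z - y|)))).
    by rewrite ler_wpM2l // ltW.
  suff -> : K' * (e / (K' * K) * (K * `|z - y|)) = e * `|z - y| by [].
  by field; rewrite !gt_eqF.
pose G k j (x : V) : R^o := invmx (jacobian th x) k j.
have sG k j : smooth_on (ball x0 r) (G k j).
  apply/smooth_onP => m; apply: Ck_invmx.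
  - exact: ball_open.
  - exact: inverse_function_jacobian.
  move=> i l; have s1 := smooth_on_sub rU (smooth_on_pd i sth).
  have s2 := (smooth_rowP (ball_open x0 r) _).1 s1 l.
  apply: (Ck_eq_on (ball_open x0 r) _ ((smooth_onP _ _).1 s2 m)) => x bx.
  by rewrite pd_jacobian //; exact: (smooth_on_diff sth (rU bx)).
have pdth' k y : B y -> pd k th' y = delta_mx 0 k *m invmx (jacobian th (th' y)).
  move=> By; have [bx ex] := inB y By; have uJ := inverse_function_jacobian bx.
  have dx := smooth_on_diff sth (rU bx).
  have : pd k (fun z => th (th' z)) y = delta_mx 0 k.
    rewrite (pd_eq_on k oB (G := id)) //; first by rewrite /pd derive_id.
    by move=> z /inB[].
  rewrite (pd_comp k (dth' y By) dx) => e; rewrite -e.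
  have -> : \sum_j pd k th' y 0 j *: pd j th (th' y) = pd k th' y *m jacobian th (th' y).
    rewrite mulmx_sum_row; apply: eq_bigr => j _; congr (_ *: _).
    by rewrite /pd deriveEjacobian // rowE.
  by rewrite mulmxK.
apply/smooth_onP; elim=> [|p IH]; split=> //; try exact: dth'.
move=> k; apply/Ck_rowP => // j.
have c1 := Ck_comp oB (fun y By => (inB y By).1) (sG k j) IH.
apply: (Ck_eq_on oB _ c1) => y By.
by rewrite pdth' // -rowE mxE.
Qed.

End OnBall.

Theorem inverse_function : exists2 r : R, 0 < r &
  ball x0 r `<=` U /\ diffeo_on (ball x0 r) th.
Proof.
have [r [r0 rU rS]] := inverse_function_bound.
exists r => //; split=> //; split.
- exact: ball_open.
- exact: inverse_function_open.
- exact: smooth_on_sub sth.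
have [K K0 HK] := inverse_function_lipschitz rU rS.
(* The default value [x0] is taken off the image, where nothing is claimed about [th']. *)
pose th' y := xget x0 [set x | ball x0 r x /\ th x = y].
have th'K x : ball x0 r x -> th' (th x) = x.
  move=> bx; have := @xgetPex _ x0 [set z | ball x0 r z /\ th z = th x] (ex_intro _ x (conj bx erefl)).
  rewrite -/(th' (th x)) => -[/= b1 e1].
  have := HK _ _ b1 bx; rewrite e1 subrr normr0 mulr0 normr_le0 subr_eq0.
  by move/eqP.
exists th' => //; exact: inverse_function_inverse.
Qed.

End InverseFunction.

(** * Robertson-Walker geometry *)

Section Split.
Context {R : realType}.
Implicit Types (v w : 'rV[R]_4) (a b c : 'rV[R]_3).

Definition sp v : 'rV[R]_3 := \row_j v 0 (lift ord0 j).

Definition mk4 (t : R) a : 'rV[R]_4 :=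
  \row_j (if unlift ord0 j is Some k then a 0 k else t).

Fact calculus_key : unit. Proof. exact: tt. Qed.

Definition dot a b : R :=
  locked_with calculus_key (fun c d : 'rV[R]_3 => \sum_j c 0 j * d 0 j) a b.

Lemma dotE a b : dot a b = \sum_j a 0 j * b 0 j.
Proof. by rewrite /dot locked_withE. Qed.

Lemma mk4_0 t a : mk4 t a 0 0 = t.
Proof. by rewrite mxE unlift_none. Qed.

Lemma mk4_S t a j : mk4 t a 0 (lift ord0 j) = a 0 j.
Proof. by rewrite mxE liftK. Qed.

Lemma sp_mk4 t a : sp (mk4 t a) = a.
Proof. by apply/rowP => j; rewrite mxE mk4_S. Qed.

Lemma eq_row4 v w : v 0 0 = w 0 0 -> sp v = sp w -> v = w.
Proof.
move=> e0 es; apply/rowP => j; case: (unliftP ord0 j) => [k|] ->; last exact: e0.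
by have := congr1 (fun a : 'rV_3 => a 0 k) es; rewrite !mxE.
Qed.

Lemma spD v w : sp (v + w) = sp v + sp w.
Proof. by apply/rowP => j; rewrite !mxE. Qed.
Lemma spN v : sp (- v) = - sp v.
Proof. by apply/rowP => j; rewrite !mxE. Qed.
Lemma spB v w : sp (v - w) = sp v - sp w.
Proof. by rewrite spD spN. Qed.
Lemma spZ k v : sp (k *: v) = k *: sp v.
Proof. by apply/rowP => j; rewrite !mxE. Qed.
Lemma sp0 : sp 0 = 0.
Proof. by apply/rowP => j; rewrite !mxE. Qed.

Lemma e0D v w : (v + w) 0 0 = v 0 0 + w 0 0. Proof. by rewrite mxE. Qed.
Lemma e0N v : (- v) 0 0 = - v 0 0. Proof. by rewrite mxE. Qed.
Lemma e0B v w : (v - w) 0 0 = v 0 0 - w 0 0. Proof. by rewrite e0D e0N. Qed.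
Lemma e0Z k v : (k *: v) 0 0 = k * v 0 0. Proof. by rewrite mxE. Qed.

Lemma dotC a b : dot a b = dot b a.
Proof. by rewrite !dotE; apply: eq_bigr => j _; rewrite mulrC. Qed.
Lemma dotDl a b c : dot (a + b) c = dot a c + dot b c.
Proof. by rewrite !dotE -big_split; apply: eq_bigr => j _; rewrite mxE mulrDl. Qed.
Lemma dotZl k a b : dot (k *: a) b = k * dot a b.
Proof. by rewrite !dotE mulr_sumr; apply: eq_bigr => j _; rewrite mxE mulrA. Qed.
Lemma dotNl a b : dot (- a) b = - dot a b.
Proof. by rewrite -scaleN1r dotZl mulN1r. Qed.
Lemma dotBl a b c : dot (a - b) c = dot a c - dot b c.
Proof. by rewrite dotDl dotNl. Qed.
Lemma dotDr a b c : dot c (a + b) = dot c a + dot c b.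
Proof. by rewrite dotC dotDl !(dotC c). Qed.
Lemma dotZr k a b : dot a (k *: b) = k * dot a b.
Proof. by rewrite dotC dotZl dotC. Qed.
Lemma dotNr a b : dot a (- b) = - dot a b.
Proof. by rewrite dotC dotNl dotC. Qed.
Lemma dotBr a b c : dot c (a - b) = dot c a - dot c b.
Proof. by rewrite dotDr dotNr. Qed.
Lemma dot0l a : dot 0 a = 0.
Proof. by rewrite -(scale0r 0) dotZl mul0r. Qed.
Lemma dot_ge0 a : 0 <= dot a a.
Proof. by rewrite dotE; apply: sumr_ge0 => j _; rewrite -expr2 sqr_ge0. Qed.

End Split.

Section RW.
Context {R : realType}.
Variables (I : set R) (f : R -> R).
Hypotheses (I_int : open_interval I) (f_smooth : smooth_on1 I f)
  (f_neq0 : forall t, I t -> f t != 0).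
Local Notation g := (rw_metric f).
Local Notation f' := (derive1 f).
Local Notation f'' := (derive1n 2 f).
Implicit Types (q u v w z : 'rV[R]_4).

Lemma inner_rw q v w :
  inner g q v w = - (v 0 0 * w 0 0) + f (q 0 0) ^+ 2 * dot (sp v) (sp w).
Proof.
rewrite /inner mxE.
have E j : (v *m g q) 0 j = v 0 j * (if j == 0 then -1 else f (q 0 0) ^+ 2).
  rewrite mxE (bigD1 j) //= big1 ?addr0; first by rewrite mxE eqxx.
  by move=> i /negPf ij; rewrite mxE ij mulr0.
rewrite big_ord_recl E !mxE /= mulrN1 mulNr; congr (_ + _).
rewrite dotE mulr_sumr; apply: eq_bigr => j _; rewrite E !mxE /=.
by ring.
Qed.

Lemma f_der t : I t -> derivable f t 1.
Proof. exact: (@f_smooth 0%N t). Qed.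

Lemma f'_der t : I t -> derivable f' t 1.
Proof. exact: (@f_smooth 1%N t). Qed.

Lemma f'_smooth : smooth_on1 I f'.
Proof. by move=> n t It; have := @f_smooth n.+1 t It; rewrite derive1Sn. Qed.

Lemma invmx_eq n (A B : 'M[R]_n) : A *m B = 1%:M -> invmx A = B.
Proof.
move=> AB; have [uA _] := mulmx1_unit AB.
by rewrite -[LHS]mulmx1 -AB mulmxA mulVmx // mul1mx.
Qed.

Definition gdiag (c : R) : 'M[R]_4 :=
  \matrix_(i, j) (if i != j then 0 else if i == 0 then - 1 else c).

Lemma invmx_rw q : I (q 0 0) -> invmx (g q) = gdiag (f (q 0 0) ^- 2).
Proof.
move=> Iq; apply: invmx_eq; apply/matrixP => i j; rewrite mxE (bigD1 i) //= big1 => [|k ki].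
  rewrite !mxE eqxx /= addr0; case: (eqVneq i j) => [ij|_] /=; last by rewrite mulr0.
  case: (eqVneq i 0) => _; first by rewrite mulrNN mulr1.
  by rewrite mulfV // expf_neq0 // f_neq0.
by rewrite !mxE eq_sym ki mul0r.
Qed.

Lemma pd_rw_metric q (i j k : 'I_4) : I (q 0 0) ->
  pd k (fun y => g y i j : R^o) q =
  if [&& k == 0, i == j & i != 0] then 2 * f (q 0 0) * f' (q 0 0) else 0.
Proof.
move=> Iq; have -> : (fun y => g y i j : R^o) =
    if i != j then fun=> 0 else if i == 0 then fun=> -1 else
    fun y => f (y 0 0) * f (y 0 0).
  by apply/funext => y; rewrite mxE; case: eqP => //= _; case: ifP => // _; rewrite expr2.
case: eqP => _ /=; last by rewrite pd_cst andbF.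
case: eqP => _ /=; first by rewrite pd_cst andbF.
have dq : differentiable (fun y : 'rV[R]_4 => y 0 0 : R^o) q.
  exact: (smooth_on_diff (@smooth_coord _ _ setT 0)).
have df : differentiable (fun y : 'rV[R]_4 => f (y 0 0) : R^o) q.
  by apply: (differentiable_comp1 (h := f) (F := fun y => y 0 0)) => //; exact: f_der.
rewrite (pdM k df df) (pd_comp1 (h := f) k (f_der Iq) dq) pd_coord andbT.
by case: eqP => _; rewrite ?mulr1 ?mulr0 ?mul0r ?addr0 //; ring.
Qed.

(** The only non-zero Christoffel symbols have the upper index 0 and equal lower spatial indices,
    with value f f', or one lower index 0 and the other two equal and spatial, with value f'/f. *)
Lemma gam_rw q v w : I (q 0 0) -> gam g q v w =
  mk4 (f (q 0 0) * f' (q 0 0) * dot (sp v) (sp w))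
      ((f' (q 0 0) / f (q 0 0)) *: (v 0 0 *: sp w + w 0 0 *: sp v)).
Proof.
move=> Iq; have f0 := f_neq0 Iq.
set F := f (q 0 0) in f0 *; set F' := f' (q 0 0).
have C k i j : christoffel g q k i j = 2^-1 * (if k == ord0 then -1 else F ^- 2) *
    ((if [&& i == ord0, j == k & j != ord0] then 2 * F * F' else 0)
    + (if [&& j == ord0, i == k & i != ord0] then 2 * F * F' else 0)
    - (if [&& k == ord0, i == j & i != ord0] then 2 * F * F' else 0)).
  rewrite /christoffel (bigD1 k) //= big1 => [|l lk].
    by rewrite invmx_rw // mxE eqxx /= !pd_rw_metric // addr0 mulrA.
  by rewrite invmx_rw // mxE eq_sym lk mul0r.
have L0 (i : 'I_3) : (lift ord0 i == ord0 :> 'I_4) = false by [].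
apply: eq_row4.
  rewrite mk4_0 mxE; under eq_bigr do under eq_bigr do rewrite (C ord0).
  rewrite big_ord_recl big1 => [|j _]; last first.
    by rewrite !eqxx andbN !andbF /= addr0 subrr mulr0 !mul0r.
  rewrite add0r dotE mulr_sumr; apply: eq_bigr => i _.
  rewrite (bigD1 (lift ord0 i)) //= big1 => [|j ji].
    by rewrite !mxE !eqxx /= !addr0 sub0r; field.
  by rewrite (eq_sym _ j) (negPf ji) /= !andbF /= addr0 subrr mulr0 !mul0r.
rewrite sp_mk4; apply/rowP => k; rewrite [LHS]mxE mxE.
under eq_bigr do under eq_bigr do rewrite C L0 /=.
rewrite big_ord_recl (bigD1 (lift ord0 k)) //= big1 => [|j jk]; last first.
  by rewrite (negPf jk) /= !andbF /= [X in X + _]addr0 subr0 mulr0 !mul0r.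
rewrite (bigD1 k) //= [X in _ + (_ + X) = _]big1 => [|i ik]; last first.
  rewrite big1 // => j _; rewrite (inj_eq (@lift_inj _ _)) (negPf ik) /= !andbF /=.
  by rewrite addr0 subr0 mulr0 !mul0r.
rewrite big_ord_recl big1 => [|j _]; last first.
  by rewrite /= addr0 subr0 mulr0 !mul0r.
rewrite !eqxx /= !mxE !addr0 ?add0r !subr0.
by field.
Qed.

(** The first term is the curvature tensor of a space of constant curvature (f'/f)^2. The second one
    measures the deviation from it; its factor is the quantity that the standing assumption keeps
    away from zero, and the time components are, up to sign, products with d/dt. *)
Lemma curvature_rw q u v w z : I (q 0 0) ->
  inner g q (curvature g q u v w) z =
  (f' (q 0 0) / f (q 0 0)) ^+ 2 *
    (inner g q v w * inner g q u z - inner g q u w * inner g q v z)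
  + (f'' (q 0 0) / f (q 0 0) - (f' (q 0 0) / f (q 0 0)) ^+ 2) *
    (- z 0 0 * (u 0 0 * inner g q v w - v 0 0 * inner g q u w)
     + w 0 0 * (u 0 0 * inner g q v z - v 0 0 * inner g q u z)).
Proof.
move=> Iq; have f0 := f_neq0 Iq.
have Io : open I by case: I_int.
have coq : open (rw_space I).
  have /= := @open_comp _ _ (fun y : 'rV[R]_4 => y 0 0) I _ Io; apply => y _.
  exact: coord_continuous.
have covc v' w' : cov g (cst v') (cst w') = fun y => gam g y v' w'.
  by apply/funext => y; rewrite /cov derive_cst add0r.
have gam0 w' : gam g q 0 w' = 0.
  by rewrite gam_rw // mxE sp0 dot0l mulr0 scale0r scaler0 addr0 scaler0;
  apply: eq_row4; rewrite ?mk4_0 ?sp_mk4 ?mxE ?sp0.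
pose F (y : 'rV[R]_4) : R := f (y 0 0); pose F' (y : 'rV[R]_4) : R := f' (y 0 0).
have dq : differentiable (fun y : 'rV[R]_4 => y 0 0 : R^o) q.
  exact: (smooth_on_diff (@smooth_coord _ _ setT 0)).
have dF : differentiable (F : _ -> R^o) q.
  by apply: (differentiable_comp1 (h := f) (F := fun y => y 0 0)) => //; exact: f_der.
have dF' : differentiable (F' : _ -> R^o) q.
  by apply: (differentiable_comp1 (h := f') (F := fun y => y 0 0)) => //; exact: f'_der.
have pF k : pd k (F : _ -> R^o) q = f' (q 0 0) * (k == 0)%:R.
  by rewrite (pd_comp1 (h := f) k (f_der Iq) dq) pd_coord.
have pF' k : pd k (F' : _ -> R^o) q = f'' (q 0 0) * (k == 0)%:R.
  by rewrite (pd_comp1 (h := f') k (f'_der Iq) dq) pd_coord derive1nS.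
have dir (P : 'rV[R]_4 -> R^o) (c : R) u' : differentiable P q ->
    (forall k, pd k P q = c * (k == 0)%:R) -> 'D_u' P q = u' 0 0 * c.
  move=> dP eP; rewrite dirE // (bigD1 0) //= big1 => [|k /negPf k0]; rewrite eP.
    by rewrite eqxx mulr1 addr0.
  by rewrite k0 mulr0 scaler0.
have Dgam u' v' w' : 'D_u' (fun y => gam g y v' w') q =
   mk4 (u' 0 0 * ((f'' (q 0 0) * f (q 0 0) + f' (q 0 0) ^+ 2) * dot (sp v') (sp w')))
   ((u' 0 0 * (f'' (q 0 0) / f (q 0 0) - (f' (q 0 0) / f (q 0 0)) ^+ 2)) *:
     (v' 0 0 *: sp w' + w' 0 0 *: sp v')).
  pose a := dot (sp v') (sp w'); pose b := v' 0 0 *: sp w' + w' 0 0 *: sp v'.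
  pose G y := mk4 (F y * F' y * a) ((F' y * (F y)^-1) *: b).
  have dG0 : differentiable (fun y => F y * F' y * a : R^o) q.
    apply: differentiableM; last exact: differentiable_cst.
    exact: differentiableM.
  have dGj j : differentiable (fun y => F' y * (F y)^-1 * b 0 j : R^o) q.
    apply: differentiableM; last exact: differentiable_cst.
    by apply: differentiableM => //; exact: differentiableV.
  have dG : differentiable G q.
    apply/differentiable_rowP => j; case: (unliftP ord0 j) => [k|] ->.
      rewrite (_ : (fun y => _) = (fun y => F' y * (F y)^-1 * b 0 k)) //.
      by apply/funext => y; rewrite mk4_S mxE.
    rewrite (_ : (fun y => _) = (fun y => F y * F' y * a)) //.
    by apply/funext => y; rewrite mk4_0.
  have -> : 'D_u' (fun y => gam g y v' w') q = 'D_u' G q.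
    apply: near_eq_derive; have := open_nbhs_nbhs (conj coq Iq).
    by apply: filterS => y Iy; rewrite gam_rw.
  rewrite derive_mx; last exact: diff_derivable.
  apply: eq_row4.
    rewrite mk4_0 mxE (_ : (fun y => _) = (fun y => F y * F' y * a : R^o)); last first.
      by apply/funext => y; rewrite mk4_0.
    apply: dir => // k.
    have d1 : differentiable (fun y => F y * F' y : R^o) q by exact: differentiableM.
    have d2 : differentiable (fun _ : 'rV[R]_4 => a : R^o) q by exact: differentiable_cst.
    rewrite (pdM k d1 d2) (pdM k dF dF') pd_cst pF pF'.
    rewrite -/a /F /F'; ring.
  rewrite sp_mk4; apply/rowP => j; rewrite [LHS]mxE mxE.
  rewrite (_ : (fun y => _) = (fun y => F' y * (F y)^-1 * b 0 j : R^o)); last first.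
    by apply/funext => y; rewrite mk4_S mxE.
  rewrite [RHS]mxE -mulrA; apply: dir => // k.
  have dV : differentiable (fun y => (F y)^-1 : R^o) q by exact: differentiableV.
  have d1 : differentiable (fun y => F' y * (F y)^-1 : R^o) q by exact: differentiableM.
  have d2 : differentiable (fun _ : 'rV[R]_4 => b 0 j : R^o) q.
    exact: differentiable_cst.
  rewrite (pdM k d1 d2) (pdM k dF' dV) pd_cst pdV // pF pF'.
  by rewrite -[_ 0 j]/(b 0 j) /F /F'; field.
have lie0 : lie (cst u) (cst v) = cst 0.
  by apply/funext => y; rewrite /lie !derive_cst subrr.
rewrite /curvature /curvature_fields lie0 !covc gam0 subr0.
rewrite /cov !Dgam !gam_rw //.
rewrite !inner_rw !(e0B, e0D, spB, spD, mk4_0, sp_mk4).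
rewrite !(dotBl, dotDl, dotZl, dotZr, dotDr, dotBr).
rewrite (dotC (sp v) (sp u)).
by field.
Qed.

End RW.

Section Locked.
Context {R : realType} {n : nat}.
Local Notation V := ('rV[R]_n.+1).

(* Locked copies of the differential operators: unlocked, the conversion test
   on two distinct partial derivatives unfolds the definition of limits. *)
Definition dv m (k : 'I_n.+1) (F : V -> 'rV[R]_m) : V -> 'rV[R]_m :=
  locked_with calculus_key (@pd R n 'rV[R]_m) k F.

Definition ds (k : 'I_n.+1) (F : V -> R) : V -> R :=
  locked_with calculus_key (fun k (F : V -> R) => pd k (F : V -> R^o)) k F.

Definition d1 (f : R -> R) : R -> R :=
  locked_with calculus_key (fun f : R -> R => derive1 f) f.

Lemma dvE m k (F : V -> 'rV[R]_m) : dv k F = pd k F.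
Proof. by rewrite /dv locked_withE. Qed.

Lemma dsE k (F : V -> R) : ds k F = pd k (F : V -> R^o).
Proof. by rewrite /ds locked_withE. Qed.

Lemma d1E (f : R -> R) : d1 f = derive1 f.
Proof. by rewrite /d1 locked_withE. Qed.

Lemma d1d1E (f : R -> R) : d1 (d1 f) = derive1n 2 f.
Proof. by rewrite !d1E derive1nS derive1n1. Qed.

End Locked.

Section VectorRules.
Context {R : realType} {n : nat}.
Variables (A : set 'rV[R]_n.+1) (oA : open A).

Lemma smooth_Zv m (c : 'rV[R]_n.+1 -> R^o) (F : 'rV[R]_n.+1 -> 'rV[R]_m) :
  smooth_on A c -> smooth_on A F -> smooth_on A (fun x => c x *: F x).
Proof.
move=> sc sF; apply/smooth_rowP => // j.
apply: (smooth_eq_on oA (F := fun x => c x * F x 0 j : R^o)) => [x _|].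
  by rewrite mxE.
by apply: smooth_M => //; exact: (smooth_rowP oA F).1.
Qed.

Lemma smooth_Bv m (F G : 'rV[R]_n.+1 -> 'rV[R]_m) :
  smooth_on A F -> smooth_on A G -> smooth_on A (fun x => F x - G x).
Proof.
move=> /(smooth_rowP oA) sF /(smooth_rowP oA) sG; apply/(smooth_rowP oA) => j.
apply: (smooth_eq_on oA (F := fun x => F x 0 j - G x 0 j : R^o)); last exact: smooth_B.
by move=> x _; rewrite !mxE.
Qed.

Lemma smooth_e0 (F : 'rV[R]_n.+1 -> 'rV[R]_4) : smooth_on A F ->
  smooth_on A (fun x => F x 0 0 : R^o).
Proof. by move=> sF; exact: (smooth_rowP oA F).1. Qed.

Lemma smooth_sp (F : 'rV[R]_n.+1 -> 'rV[R]_4) : smooth_on A F ->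
  smooth_on A (fun x => sp (F x)).
Proof.
move=> sF; apply/smooth_rowP => // j.
apply: (smooth_eq_on oA _ ((smooth_rowP oA F).1 sF (lift ord0 j))) => x _.
by rewrite mxE.
Qed.

Lemma smooth_mk4 (t : 'rV[R]_n.+1 -> R^o) (a : 'rV[R]_n.+1 -> 'rV[R]_3) :
  smooth_on A t -> smooth_on A a -> smooth_on A (fun x => mk4 (t x) (a x)).
Proof.
move=> st sa; apply/smooth_rowP => // j; case: (unliftP ord0 j) => [k|] ->.
  by apply: (smooth_eq_on oA _ ((smooth_rowP oA a).1 sa k)) => x _; rewrite mk4_S.
by apply: (smooth_eq_on oA _ st) => x _; rewrite mk4_0.
Qed.

Lemma smooth_dot (a b : 'rV[R]_n.+1 -> 'rV[R]_3) :
  smooth_on A a -> smooth_on A b -> smooth_on A (fun x => dot (a x) (b x) : R^o).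
Proof.
move=> sa sb; apply: (smooth_eq_on oA (F := fun x => \sum_j (a x 0 j * b x 0 j : R^o))).
  by move=> x _; rewrite dotE.
apply/smooth_onP => m; apply: Ck_sum => // j.
move: m; apply/smooth_onP; apply: smooth_M => //; exact: (smooth_rowP oA _).1.
Qed.

Lemma differentiable_dot (a b : 'rV[R]_n.+1 -> 'rV[R]_3) x :
  differentiable a x -> differentiable b x ->
  differentiable (fun y => dot (a y) (b y) : R^o) x.
Proof.
move=> /differentiable_rowP da /differentiable_rowP db.
rewrite (_ : (fun y => _) = \sum_j (fun y => a y 0 j * b y 0 j : R^o)).
  by apply: differentiable_sum => j; exact: differentiableM.
by apply/funext => y; rewrite dotE fct_sumE.
Qed.

Lemma ds_eq_on (F G : 'rV[R]_n.+1 -> R) k x :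
  (forall y, A y -> F y = G y) -> A x -> ds k F x = ds k G x.
Proof. by move=> FG Ax; rewrite !dsE; exact: (pd_eq_on k oA FG Ax). Qed.

Lemma dv_eq_on m (F G : 'rV[R]_n.+1 -> 'rV[R]_m) k x :
  (forall y, A y -> F y = G y) -> A x -> dv k F x = dv k G x.
Proof. by move=> FG Ax; rewrite !dvE; exact: (pd_eq_on k oA FG Ax). Qed.

Lemma smooth_ds (F : 'rV[R]_n.+1 -> R) k :
  smooth_on A (F : _ -> R^o) -> smooth_on A (ds k F : _ -> R^o).
Proof. by rewrite dsE; exact: smooth_on_pd. Qed.

Lemma smooth_dv m (F : 'rV[R]_n.+1 -> 'rV[R]_m) k :
  smooth_on A F -> smooth_on A (dv k F).
Proof. by rewrite dvE; exact: smooth_on_pd. Qed.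

Lemma ds_cst (c : R) k x : ds k (fun _ : 'rV[R]_n.+1 => c) x = 0.
Proof. by rewrite dsE (pd_cst (c : R^o)). Qed.

Lemma ds_coord k j x : ds k (fun y : 'rV[R]_n.+1 => y 0 j) x = (k == j)%:R.
Proof. by rewrite dsE pd_coord. Qed.

Section At.
Variables (k : 'I_n.+1) (x : 'rV[R]_n.+1).
Implicit Types (F G c : 'rV[R]_n.+1 -> R).

Lemma dsD F G : differentiable (F : _ -> R^o) x -> differentiable (G : _ -> R^o) x ->
  ds k (fun y => F y + G y) x = ds k F x + ds k G x.
Proof. by move=> dF dG; rewrite !dsE; exact: (pdD k dF dG). Qed.

Lemma dsN F : differentiable (F : _ -> R^o) x -> ds k (fun y => - F y) x = - ds k F x.
Proof. by move=> dF; rewrite !dsE; exact: (pdN k dF). Qed.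

Lemma dsB F G : differentiable (F : _ -> R^o) x -> differentiable (G : _ -> R^o) x ->
  ds k (fun y => F y - G y) x = ds k F x - ds k G x.
Proof. by move=> dF dG; rewrite !dsE; exact: (pdB k dF dG). Qed.

Lemma dsM F G : differentiable (F : _ -> R^o) x -> differentiable (G : _ -> R^o) x ->
  ds k (fun y => F y * G y) x = ds k F x * G x + F x * ds k G x.
Proof. by move=> dF dG; rewrite !dsE; exact: (pdM k dF dG). Qed.

Lemma dsV F : F x != 0 -> differentiable (F : _ -> R^o) x ->
  ds k (fun y => (F y)^-1) x = - (F x)^-1 * (F x)^-1 * ds k F x.
Proof. by move=> F0 dF; rewrite !dsE; exact: (pdV k F0 dF). Qed.

Lemma ds_comp1 (h : R -> R) F : derivable h (F x) 1 -> differentiable (F : _ -> R^o) x ->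
  ds k (fun y => h (F y)) x = d1 h (F x) * ds k F x.
Proof. by move=> dh dF; rewrite !dsE d1E; exact: (pd_comp1 (h := h) k dh dF). Qed.

Lemma dv_row m (F : 'rV[R]_n.+1 -> 'rV[R]_m) j : differentiable F x ->
  dv k F x 0 j = ds k (fun y => F y 0 j) x.
Proof. by move=> dF; rewrite dvE dsE; exact: pd_row. Qed.

Lemma dvD m (F G : 'rV[R]_n.+1 -> 'rV[R]_m) : differentiable F x -> differentiable G x ->
  dv k (fun y => F y + G y) x = dv k F x + dv k G x.
Proof. by move=> dF dG; rewrite !dvE; exact: (pdD k dF dG). Qed.

Lemma dvB m (F G : 'rV[R]_n.+1 -> 'rV[R]_m) : differentiable F x -> differentiable G x ->
  dv k (fun y => F y - G y) x = dv k F x - dv k G x.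
Proof. by move=> dF dG; rewrite !dvE; exact: (pdB k dF dG). Qed.

Lemma dvZ m c (F : 'rV[R]_n.+1 -> 'rV[R]_m) :
  differentiable (c : _ -> R^o) x -> differentiable F x ->
  dv k (fun y => c y *: F y) x = ds k c x *: F x + c x *: dv k F x.
Proof.
move=> dc dF; have dFj := (differentiable_rowP F x).1 dF.
have e j : (fun y => (c y *: F y) 0 j : R^o) = fun y => c y * F y 0 j.
  by apply/funext => y; rewrite mxE.
have dcF : differentiable (fun y => c y *: F y) x.
  by apply/differentiable_rowP => j; rewrite e; exact: differentiableM.
by apply/rowP => j; rewrite dv_row // e (dsM dc (dFj j)) !mxE dv_row.
Qed.

Lemma ds_dot (a b : 'rV[R]_n.+1 -> 'rV[R]_3) :
  differentiable a x -> differentiable b x ->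
  ds k (fun y => dot (a y) (b y)) x = dot (dv k a x) (b x) + dot (a x) (dv k b x).
Proof.
move=> da db; have daj := (differentiable_rowP a x).1 da.
have dbj := (differentiable_rowP b x).1 db.
rewrite dsE (_ : (fun y => _) = (fun y => \sum_j (a y 0 j * b y 0 j : R^o))); last first.
  by apply/funext => y; rewrite dotE.
rewrite pd_sum => [|j]; last by apply: differentiableM.
rewrite !dotE -big_split; apply: eq_bigr => j _ /=.
by rewrite !dv_row // -dsE (dsM (daj j) (dbj j)).
Qed.

Lemma differentiable_sp (F : 'rV[R]_n.+1 -> 'rV[R]_4) : differentiable F x ->
  differentiable (fun y => sp (F y)) x.
Proof.
move=> dF; apply/differentiable_rowP => j.
rewrite (_ : (fun y => _) = fun y => F y 0 (lift ord0 j)).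
  exact: (differentiable_rowP F x).1.
by apply/funext => y; rewrite mxE.
Qed.

Lemma dv_sp (F : 'rV[R]_n.+1 -> 'rV[R]_4) : differentiable F x ->
  dv k (fun y => sp (F y)) x = sp (dv k F x).
Proof.
move=> dF; apply/rowP => j; rewrite dv_row; last exact: differentiable_sp.
rewrite mxE dv_row //; congr (ds k _ x).
by apply/funext => y; rewrite mxE.
Qed.

End At.

Lemma ds_schwarz (F : 'rV[R]_n.+1 -> R) k l x : A x -> smooth_on A (F : _ -> R^o) ->
  ds k (ds l F) x = ds l (ds k F) x.
Proof. by move=> Ax sF; rewrite !dsE; exact: (smooth_schwarz k l oA Ax sF). Qed.

Lemma dv_schwarz m (F : 'rV[R]_n.+1 -> 'rV[R]_m) k l x : A x -> smooth_on A F ->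
  dv k (dv l F) x = dv l (dv k F) x.
Proof.
move=> Ax sF; apply/rowP => j; have sFj := (smooth_rowP oA F).1 sF j.
have E i i' : dv i (dv i' F) x 0 j = ds i (ds i' (fun y => F y 0 j)) x.
  rewrite dv_row; last exact: (smooth_on_diff (smooth_dv i' sF)).
  apply: ds_eq_on => // y Ay.
  by rewrite dv_row //; exact: (smooth_on_diff sF).
by rewrite (E k l) (E l k) (ds_schwarz k l Ax sFj).
Qed.

End VectorRules.

Lemma sum2 (V : nmodType) (F : 'I_2 -> V) : \sum_(k < 2) F k = F 0 + F 1.
Proof.
by rewrite !big_ord_recl big_ord0 addr0; congr (F _ + F _); apply: val_inj.
Qed.

Lemma ord2P (P : 'I_2 -> Prop) : P 0 -> P 1 -> forall k, P k.
Proof.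
move=> P0 P1 [[|[|m]] hm] //.
- by rewrite (_ : Ordinal hm = 0) //; exact: val_inj.
- by rewrite (_ : Ordinal hm = 1) //; exact: val_inj.
Qed.

Lemma invmx2 (F : realType) (M : 'M[F]_2) :
  let D := M 0 0 * M 1 1 - M 0 1 * M 1 0 in D != 0 ->
  [/\ invmx M 0 0 = M 1 1 / D, invmx M 0 1 = - M 0 1 / D,
      invmx M 1 0 = - M 1 0 / D & invmx M 1 1 = M 0 0 / D].
Proof.
move=> D D0.
pose B : 'M[F]_2 := \matrix_(i, j) (if i == 0 then if j == 0 then M 1 1 / D else - M 0 1 / D
  else if j == 0 then - M 1 0 / D else M 0 0 / D).
have MB : M *m B = 1%:M.
  by apply/matrixP; apply: ord2P; apply: ord2P; rewrite !mxE sum2 !mxE /= /D; field; exact: D0.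
by rewrite (invmx_eq MB) !mxE.
Qed.

(** * Surfaces in a chart and their bitension field *)

(** Turns scalar products and entries into variables, so that [ring] and [field] meet only opaque
    atoms. *)
Ltac gen_scalars := repeat match goal with
  | |- context [dot ?a ?b] => generalize (dot a b); intro
  | |- context [fun_of_matrix ?M ?i ?j] => generalize (fun_of_matrix M i j); intro
  end.

Section LorentzProduct.
Context {R : realType}.
Implicit Types (F : R) (u v w : 'rV[R]_4).

(** The metric depends on the point only through [F = f t]. Freezing this number makes the product a
    bilinear form on one fixed space. *)
Definition ip (F : R) (v w : 'rV[R]_4) : R :=
  locked_with calculus_key
    (fun F v w => - (v 0 0 * w 0 0) + F ^+ 2 * dot (sp v) (sp w)) F v w.

Lemma ipE F v w : ip F v w = - (v 0 0 * w 0 0) + F ^+ 2 * dot (sp v) (sp w).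
Proof. by rewrite /ip locked_withE. Qed.

Lemma inner_ip (f : R -> R) q v w : inner (rw_metric f) q v w = ip (f (q 0 0)) v w.
Proof. by rewrite inner_rw ipE. Qed.

Lemma ipC F v w : ip F v w = ip F w v.
Proof. by rewrite !ipE dotC mulrC. Qed.
Lemma ipDl F u v w : ip F (u + v) w = ip F u w + ip F v w.
Proof. by rewrite !ipE e0D spD dotDl; ring. Qed.
Lemma ipZl F k v w : ip F (k *: v) w = k * ip F v w.
Proof. by rewrite !ipE e0Z spZ dotZl; ring. Qed.
Lemma ipNl F v w : ip F (- v) w = - ip F v w.
Proof. by rewrite -scaleN1r ipZl mulN1r. Qed.
Lemma ipBl F u v w : ip F (u - v) w = ip F u w - ip F v w.
Proof. by rewrite ipDl ipNl. Qed.
Lemma ip0l F v : ip F 0 v = 0.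
Proof. by rewrite -(scale0r 0) ipZl mul0r. Qed.
Lemma ipDr F u v w : ip F w (u + v) = ip F w u + ip F w v.
Proof. by rewrite ipC ipDl !(ipC F w). Qed.
(* The Christoffel correction gam of the Robertson-Walker metric where f = F and
   f' = F1. *)
Definition gm (F F1 : R) v w : 'rV[R]_4 :=
  mk4 (F * F1 * dot (sp v) (sp w)) ((F1 / F) *: (v 0 0 *: sp w + w 0 0 *: sp v)).

Lemma gmC F F1 v w : gm F F1 v w = gm F F1 w v.
Proof. by rewrite /gm dotC addrC. Qed.

(** Compatibility with the metric at the level of Christoffel terms: the right side is the
    derivative along [u] of the factor f(t)^2 times the spatial product. *)
Lemma ip_gm F F1 u v w : F != 0 ->
  ip F (gm F F1 u v) w + ip F v (gm F F1 u w) = 2 * F * F1 * u 0 0 * dot (sp v) (sp w).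
Proof.
move=> F0; rewrite !ipE /gm !mk4_0 !sp_mk4 !(dotDl, dotZl, dotDr, dotZr).
by rewrite (dotC (sp v) (sp u)); gen_scalars; field.
Qed.

End LorentzProduct.

(** The contracted Codazzi equation at one point, as an identity of rational functions. [G] is the
    first form, [B] the second form paired with the tension [tau], [bt] its derivative in direction
    m; [c k l p] stands for the product of the covariant derivative of d_l along d_k with d_p, [t]
    for the components of dt, [N] for the squared norm of tau. The last two premises are the trace
    of [B] and its derivative, N being constant. *)
Lemma bitension_algebra (R : realType) (G B bt : 'I_2 -> 'I_2 -> R)
    (c : 'I_2 -> 'I_2 -> 'I_2 -> R) (t : 'I_2 -> R) (N K : R) m :
  let D := G 0 0 * G 1 1 - G 0 1 * G 1 0 in
  let h l k i := - ((G 1 1 * B l 0 - G 0 1 * B l 1) * c k i 0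
    + (G 0 0 * B l 1 - G 1 0 * B l 0) * c k i 1) / D in
  let b1 k l := - (bt l k + h k m l - h m k l - K * (t k * G m l - t m * G k l))
    - h l k m + ((G 1 1 * c k l 0 - G 0 1 * c k l 1) * B 0 m
                 + (G 0 0 * c k l 1 - G 1 0 * c k l 0) * B 1 m) / D in
  let b2 k l := K * (t m * G k l - t l * G k m) in
  G 0 1 = G 1 0 -> B 0 1 = B 1 0 -> bt 0 1 = bt 1 0 ->
  (forall k l p, c k l p = c l k p) -> D != 0 ->
  N * D = G 1 1 * B 0 0 - G 0 1 * B 0 1 - G 1 0 * B 1 0 + G 0 0 * B 1 1 ->
  N * ((c m 0 0 + c m 0 0) * G 1 1 + G 0 0 * (c m 1 1 + c m 1 1)
    - ((c m 0 1 + c m 1 0) * G 1 0 + G 0 1 * (c m 1 0 + c m 0 1))) =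
  (c m 1 1 + c m 1 1) * B 0 0 + G 1 1 * bt 0 0
  - ((c m 0 1 + c m 1 0) * B 0 1 + G 0 1 * bt 0 1)
  - ((c m 1 0 + c m 0 1) * B 1 0 + G 1 0 * bt 1 0)
  + ((c m 0 0 + c m 0 0) * B 1 1 + G 0 0 * bt 1 1) ->
  (G 1 1 * b1 0 0 - G 0 1 * b1 0 1 - G 1 0 * b1 1 0 + G 0 0 * b1 1 1) / D
  - (G 1 1 * b2 0 0 - G 0 1 * b2 0 1 - G 1 0 * b2 1 0 + G 0 0 * b2 1 1) / D
  = - 2 * K * t m.
Proof.
move=> D h b1 b2 eG eB ebt ec D0 eN.
have -> : N = (G 1 1 * B 0 0 - G 0 1 * B 0 1 - G 1 0 * B 1 0 + G 0 0 * B 1 1) / D.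
  by rewrite -eN mulfK.
move=> {eN}; rewrite /b2 /b1 /h; move: D0; rewrite /D {D h b1 b2} !(ec 1 0) eG eB ebt.
move: m; apply: ord2P; rewrite ?(ec 1 0) ?eG ?eB;
  move: (G 0 0) (G 1 1) (G 1 0) (B 0 0) (B 1 1) (B 1 0) (bt 0 0) (bt 1 1) (bt 1 0) (t 0) (t 1);
  move: (c 0 0 0) (c 0 0 1) (c 0 1 0) (c 0 1 1) (c 1 1 0) (c 1 1 1);
  move=> c000 c001 c010 c011 c110 c111 a d b B0 B1 B2 b0 b1 b2 t0 t1 D0 key.
(* The two sides differ by the differentiated trace identity divided by the determinant. *)
all: match type of key with ?kl = ?kr =>
  apply: subr0_eq; transitivity ((kl - kr) / (a * d - b * b)) end.
all: by [field|rewrite key subrr mul0r].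
Qed.

(** * Covariant derivatives, tangential parts and tension along a chart *)

Section Chart.
Context {R : realType}.
Variables (I : set R) (f : R -> R).
Hypotheses (I_int : open_interval I) (f_smooth : smooth_on1 I f)
  (f_neq0 : forall t, I t -> f t != 0).
Variables (A : set 'rV[R]_2) (X : 'rV[R]_2 -> 'rV[R]_4).
Local Notation g := (rw_metric f).
Local Notation t_ x := (X x 0 0).
Local Notation inn x := (ip (f (t_ x))).
Local Notation G x k l := (inn x (dv k X x) (dv l X x)).
Local Notation D x := (G x 0 0 * G x 1 1 - G x 0 1 * G x 1 0).
Hypotheses (oA : open A) (sX : smooth_on A X) (XI : forall x, A x -> I (t_ x))
  (D_neq0 : forall x, A x -> D x != 0).
Implicit Types (x : 'rV[R]_2) (k l m : 'I_2) (v w z : 'rV[R]_4)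
  (V W : 'rV[R]_2 -> 'rV[R]_4).

Lemma first_formE x k l : first_form g X x k l = G x k l.
Proof. by rewrite mxE inner_ip !dvE. Qed.

Definition cv k W x : 'rV[R]_4 :=
  dv k W x + gm (f (t_ x)) (d1 f (t_ x)) (dv k X x) (W x).

Lemma cov_alongE k W x : A x -> cov_along g X k W x = cv k W x.
Proof.
move=> Ax; rewrite /cov_along (gam_rw f_smooth f_neq0 _ _ (XI Ax)).
by rewrite /cv /gm !dvE d1E.
Qed.

Lemma smooth_f : smooth_on A (fun x => f (t_ x) : R^o).
Proof. exact: (smooth_comp1 oA f_smooth (@XI) (smooth_e0 oA sX)). Qed.

Lemma d1_smooth : smooth_on1 I (d1 f).
Proof. by rewrite d1E; exact: (f'_smooth f_smooth). Qed.

Lemma smooth_d1f : smooth_on A (fun x => d1 f (t_ x) : R^o).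
Proof. exact: (smooth_comp1 oA d1_smooth (@XI) (smooth_e0 oA sX)). Qed.

Lemma smooth_Vf : smooth_on A (fun x => (f (t_ x))^-1 : R^o).
Proof. by apply: smooth_V => // [x Ax|]; [exact/f_neq0/XI|exact: smooth_f]. Qed.

Lemma smooth_cv k W : smooth_on A W -> smooth_on A (cv k W).
Proof.
move=> sW; have sf := smooth_f; have sf' := smooth_d1f; have sV := smooth_Vf.
have sXk := smooth_dv k sX.
apply: smooth_D => //; first exact: smooth_dv.
apply: smooth_mk4 => //.
  apply: smooth_M => //; first exact: smooth_M.
  by apply: smooth_dot => //; apply: smooth_sp.
apply: smooth_Zv => //; first exact: smooth_M.
by apply: smooth_D => //; apply: smooth_Zv => //; try exact: smooth_e0; exact: smooth_sp.
Qed.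

Lemma dX0 x : A x -> differentiable (fun x => t_ x : R^o) x.
Proof. by move=> Ax; exact: (smooth_on_diff (smooth_e0 oA sX) Ax). Qed.

Lemma ds_t k x : A x -> ds k (fun x => t_ x) x = dv k X x 0 0.
Proof. by move=> Ax; rewrite (dv_row k 0 (smooth_on_diff sX Ax)). Qed.

Lemma ds_f k x : A x -> ds k (fun x => f (t_ x)) x = d1 f (t_ x) * dv k X x 0 0.
Proof.
by move=> Ax; rewrite (ds_comp1 k (f_der f_smooth (XI Ax)) (dX0 Ax)) ds_t.
Qed.

Lemma ds_d1f k x : A x ->
  ds k (fun x => d1 f (t_ x)) x = d1 (d1 f) (t_ x) * dv k X x 0 0.
Proof.
by move=> Ax; rewrite (ds_comp1 k (f_der d1_smooth (XI Ax)) (dX0 Ax)) ds_t.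
Qed.

Lemma cv_sym k l x : A x -> cv k (dv l X) x = cv l (dv k X) x.
Proof.
by move=> Ax; rewrite /cv gmC; congr (_ + _); exact: (dv_schwarz oA k l Ax sX).
Qed.

Lemma smooth_inn V W : smooth_on A V -> smooth_on A W ->
  smooth_on A (fun x => inn x (V x) (W x) : R^o).
Proof.
move=> sV sW; apply: (smooth_eq_on oA (F := fun x => - (V x 0 0 * W x 0 0) +
  f (t_ x) ^+ 2 * dot (sp (V x)) (sp (W x)) : R^o)) => [x _|]; first by rewrite ipE.
apply: smooth_D => //.
  by apply: smooth_N => //; apply: smooth_M => //; exact: smooth_e0.
apply: smooth_M => //; first by apply: smooth_X => //; exact: smooth_f.
by apply: smooth_dot => //; exact: smooth_sp.
Qed.

Lemma cv_compat k V W x : A x -> differentiable V x -> differentiable W x ->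
  ds k (fun x => inn x (V x) (W x)) x = inn x (cv k V x) (W x) + inn x (V x) (cv k W x).
Proof.
move=> Ax dV dW; have f0 := f_neq0 (XI Ax).
have df := smooth_on_diff smooth_f Ax.
have dVs := differentiable_sp dV; have dWs := differentiable_sp dW.
have dV0 := (differentiable_rowP V x).1 dV 0.
have dW0 := (differentiable_rowP W x).1 dW 0.
have ddot := differentiable_dot dVs dWs.
have dff : differentiable (fun x => f (t_ x) * f (t_ x) : R^o) x by exact: differentiableM.
have -> : (fun x => inn x (V x) (W x)) = (fun x => - (V x 0 0 * W x 0 0) +
    f (t_ x) * f (t_ x) * dot (sp (V x)) (sp (W x))).
  by apply/funext => y; rewrite ipE expr2.
have dVW : differentiable (fun x => V x 0 0 * W x 0 0 : R^o) x by exact: differentiableM.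
have dfd : differentiable (fun x => f (t_ x) * f (t_ x) * dot (sp (V x)) (sp (W x)) : R^o) x.
  exact: differentiableM.
have dN : differentiable (fun x => - (V x 0 0 * W x 0 0) : R^o) x by exact: differentiableN.
rewrite (dsD k dN dfd) (dsN k dVW) (dsM k dV0 dW0) (dsM k dff ddot) (dsM k df df).
rewrite (ds_dot k dVs dWs) (ds_f k Ax) (dv_sp k dV) (dv_sp k dW).
rewrite -(dv_row k 0 dV) -(dv_row k 0 dW) /cv ipDl ipDr addrACA (ip_gm _ _ _ _ f0).
rewrite !ipE; move: (f _) (d1 f _) => F F1; gen_scalars; ring.
Qed.

Lemma ds_G i k l x : A x -> ds i (fun y => G y k l) x =
  inn x (cv i (dv k X) x) (dv l X x) + inn x (cv i (dv l X) x) (dv k X x).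
Proof.
move=> Ax; have dk m := smooth_on_diff (smooth_dv m sX) Ax.
by rewrite (cv_compat i Ax (dk k) (dk l)) (ipC _ (dv k X x)).
Qed.

Lemma cv_eq_on k V W x : (forall y, A y -> V y = W y) -> A x -> cv k V x = cv k W x.
Proof. by move=> VW Ax; rewrite /cv (dv_eq_on oA k VW Ax) VW. Qed.

(** Ricci identity for a field defined only along the map. Since [W] need not extend to the
    spacetime, the commutator is computed by differentiating the Christoffel term along the surface;
    the result has the shape of [curvature_rw]. *)
Lemma ricci k l W x z : A x -> smooth_on A W ->
  inn x (cv k (cv l W) x - cv l (cv k W) x) z =
  (d1 f (t_ x) / f (t_ x)) ^+ 2 *
    (inn x (dv l X x) (W x) * inn x (dv k X x) z - inn x (dv k X x) (W x) * inn x (dv l X x) z)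
  + (d1 (d1 f) (t_ x) / f (t_ x) - (d1 f (t_ x) / f (t_ x)) ^+ 2) *
    (- z 0 0 * (dv k X x 0 0 * inn x (dv l X x) (W x) - dv l X x 0 0 * inn x (dv k X x) (W x))
     + W x 0 0 * (dv k X x 0 0 * inn x (dv l X x) z - dv l X x 0 0 * inn x (dv k X x) z)).
Proof.
move=> Ax sW; have f0 := f_neq0 (XI Ax).
have df := smooth_on_diff smooth_f Ax; have df' := smooth_on_diff smooth_d1f Ax.
have dX i := smooth_on_diff (smooth_dv i sX) Ax.
have dW := smooth_on_diff sW Ax.
have dWl i := smooth_on_diff (smooth_dv i sW) Ax.
have sV := smooth_Vf; have sf' := smooth_d1f; have sf := smooth_f.
(* [p] and [q] are the two Christoffel coefficients f f' and f'/f along the surface; [a] and [b]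
   below are the time and space parts of the Christoffel term. *)
pose q y := d1 f (t_ y) * (f (t_ y))^-1; pose p y := f (t_ y) * d1 f (t_ y).
have sq : smooth_on A (q : _ -> R^o) by exact: smooth_M.
have sp_ : smooth_on A (p : _ -> R^o) by exact: smooth_M.
have Eq i : ds i q x = (d1 (d1 f) (t_ x) / f (t_ x) - (d1 f (t_ x) / f (t_ x)) ^+ 2) * dv i X x 0 0.
  rewrite (dsM i df' (smooth_on_diff sV Ax)) (dsV i f0 df) (ds_f i Ax) (ds_d1f i Ax).
  by move: f0; move: (f _) (d1 f _) (d1 (d1 f) _) => F F1 F2 F0; gen_scalars; field.
have Ep i : ds i p x = (d1 f (t_ x) ^+ 2 + f (t_ x) * d1 (d1 f) (t_ x)) * dv i X x 0 0.
  rewrite (dsM i df df') (ds_f i Ax) (ds_d1f i Ax).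
  by move: (f _) (d1 f _) (d1 (d1 f) _) => F F1 F2; gen_scalars; ring.
pose a i y := p y * dot (sp (dv i X y)) (sp (W y)).
pose b i y := q y *: (dv i X y 0 0 *: sp (W y) + W y 0 0 *: sp (dv i X y)).
have sXi i : smooth_on A (dv i X) by exact: smooth_dv.
have sd i : smooth_on A (fun y => dot (sp (dv i X y)) (sp (W y)) : R^o).
  by apply: smooth_dot => //; exact: smooth_sp.
have sa i : smooth_on A (a i : _ -> R^o) by exact: smooth_M.
have sb1 i : smooth_on A (fun y => dv i X y 0 0 *: sp (W y)).
  by apply: smooth_Zv => //; [exact: smooth_e0|exact: smooth_sp].
have sb2 i : smooth_on A (fun y => W y 0 0 *: sp (dv i X y)).
  by apply: smooth_Zv => //; [exact: smooth_e0|exact: smooth_sp].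
have sb3 i : smooth_on A (fun y => dv i X y 0 0 *: sp (W y) + W y 0 0 *: sp (dv i X y)).
  exact: smooth_D.
have sb i : smooth_on A (b i) by exact: smooth_Zv.
have sg i : smooth_on A (fun y => mk4 (a i y) (b i y)) by exact: smooth_mk4.
have cvE i : cv i W = fun y => dv i W y + mk4 (a i y) (b i y) by [].
have dg i := smooth_on_diff (sg i) Ax.
have E0 i j : dv i (fun y => mk4 (a j y) (b j y)) x 0 0 =
    (d1 f (t_ x) ^+ 2 + f (t_ x) * d1 (d1 f) (t_ x)) * dv i X x 0 0 * dot (sp (dv j X x)) (sp (W x))
    + p x * (dot (sp (dv i (dv j X) x)) (sp (W x)) + dot (sp (dv j X x)) (sp (dv i W x))).
  rewrite (dv_row i 0 (dg j)) (_ : (fun y => _) = a j); last first.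
    by apply/funext => y; rewrite mk4_0.
  rewrite (dsM i (smooth_on_diff sp_ Ax) (smooth_on_diff (sd j) Ax)) Ep.
  by rewrite (ds_dot i (differentiable_sp (dX j)) (differentiable_sp dW)) (dv_sp i (dX j)) (dv_sp i dW).
have E1 i j : sp (dv i (fun y => mk4 (a j y) (b j y)) x) =
    ((d1 (d1 f) (t_ x) / f (t_ x) - (d1 f (t_ x) / f (t_ x)) ^+ 2) * dv i X x 0 0)
      *: (dv j X x 0 0 *: sp (W x) + W x 0 0 *: sp (dv j X x))
    + q x *: ((dv i (dv j X) x 0 0 *: sp (W x) + dv j X x 0 0 *: sp (dv i W x))
             + (dv i W x 0 0 *: sp (dv j X x) + W x 0 0 *: sp (dv i (dv j X) x))).
  rewrite -(dv_sp i (dg j)) (_ : (fun y => _) = b j); last first.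
    by apply/funext => y; rewrite sp_mk4.
  rewrite (dvZ i (smooth_on_diff sq Ax) (smooth_on_diff (sb3 j) Ax)) Eq.
  rewrite (dvD i (smooth_on_diff (sb1 j) Ax) (smooth_on_diff (sb2 j) Ax)).
  rewrite (dvZ i ((differentiable_rowP _ _).1 (dX j) 0) (differentiable_sp dW)).
  rewrite (dvZ i ((differentiable_rowP _ _).1 dW 0) (differentiable_sp (dX j))).
  by rewrite (dv_sp i (dX j)) (dv_sp i dW) (dv_row i 0 (dX j)) (dv_row i 0 dW).
rewrite {1}/cv [in X in _ - X]/cv.
rewrite [in dv k _ x]cvE [in dv l (cv _ _) x]cvE (dvD k (dWl l) (dg l)) (dvD l (dWl k) (dg k)).
have := E0 k l; have := E0 l k; have := E1 k l; have := E1 l k.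
rewrite -(dv_schwarz oA k l Ax sX) -(dv_schwarz oA k l Ax sW) /p /q.
move: (dv k (fun y => mk4 (a l y) (b l y)) x) (dv l (fun y => mk4 (a k y) (b k y)) x).
move=> P Q; rewrite /cv; move: f0; move: (f (t_ x)) (d1 f (t_ x)) (d1 (d1 f) (t_ x)).
move: (dv k (dv l X) x) (dv k (dv l W) x) (dv k W x) (dv l W x) (dv k X x) (dv l X x) (W x).
move=> ab wkl wk wl u v w F F1 F2 F0 eQ1 eP1 eQ0 eP0.
rewrite !ipE !(e0B, e0D) !(spB, spD) eQ1 eP1 eQ0 eP0 /gm !mk4_0 !sp_mk4.
rewrite !(e0D, mk4_0) !(spD, sp_mk4) !(dotBl, dotDl, dotZl, dotDr, dotZr).
by rewrite (dotC (sp v) (sp u)); gen_scalars; field.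
Qed.

Lemma invmx2_sum (M : 'M[R]_2) (p : 'I_2 -> R) (v : 'I_2 -> 'rV[R]_4) :
  let d := M 0 0 * M 1 1 - M 0 1 * M 1 0 in d != 0 ->
  \sum_k \sum_l (invmx M k l * p l) *: v k =
  ((M 1 1 * p 0 - M 0 1 * p 1) / d) *: v 0 + ((M 0 0 * p 1 - M 1 0 * p 0) / d) *: v 1.
Proof.
move=> d d0; have [e00 e01 e10 e11] := invmx2 d0.
rewrite !sum2 -!scalerDl e00 e01 e10 e11 -/d.
by congr (_ *: _ + _ *: _); move: d0 (p 0) (p 1); move: d => d; gen_scalars; move=> *; field.
Qed.

Let Dff x : A x -> first_form g X x 0 0 * first_form g X x 1 1
  - first_form g X x 0 1 * first_form g X x 1 0 != 0.
Proof. by move=> Ax; rewrite !first_formE; exact: D_neq0. Qed.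

Lemma tangent_partE x w : A x -> tangent_part g X x w =
  ((G x 1 1 * inn x w (dv 0 X x) - G x 0 1 * inn x w (dv 1 X x)) / D x) *: dv 0 X x
  + ((G x 0 0 * inn x w (dv 1 X x) - G x 1 0 * inn x w (dv 0 X x)) / D x) *: dv 1 X x.
Proof.
move=> Ax; have := invmx2_sum (fun l => inn x w (dv l X x)) (fun k => dv k X x) (Dff Ax).
rewrite !first_formE => <-; apply: eq_bigr => k _; apply: eq_bigr => l _.
by rewrite inner_ip !dvE.
Qed.

Lemma inner_tangent x w l : A x -> inn x (tangent_part g X x w) (dv l X x) = inn x w (dv l X x).
Proof.
move=> Ax; have := D_neq0 Ax; rewrite (tangent_partE _ Ax) ipDl !ipZl.
rewrite (ipC _ (dv 1 X x) (dv 0 X x)) => D0.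
have E (a b d p q : R) : a * d - b * b != 0 ->
  (d * p - b * q) / (a * d - b * b) * a + (a * q - b * p) / (a * d - b * b) * b = p.
  by move=> n0; field.
have E' (a b d p q : R) : a * d - b * b != 0 ->
  (d * p - b * q) / (a * d - b * b) * b + (a * q - b * p) / (a * d - b * b) * d = q.
  by move=> n0; field.
by move: l; apply: ord2P; rewrite ?(ipC _ (dv 1 X x) (dv 0 X x)); [exact: E|exact: E'].
Qed.

Lemma tangent_part_eq0 x w : A x ->
  (forall l, inn x w (dv l X x) = 0) -> tangent_part g X x w = 0.
Proof.
move=> Ax w0; rewrite (tangent_partE _ Ax) !w0 !mulr0 subrr mul0r.
by rewrite (scale0r (dv 0 X x)) (scale0r (dv 1 X x)) addr0.
Qed.

Lemma inner_tangent_normal x w z : A x -> (forall l, inn x z (dv l X x) = 0) ->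
  inn x (tangent_part g X x w) z = 0.
Proof.
move=> Ax z0; rewrite (tangent_partE _ Ax) ipDl !ipZl.
by rewrite (ipC _ (dv 0 X x) z) (ipC _ (dv 1 X x) z) !z0 !mulr0 addr0.
Qed.

Lemma inner_normal_part x w z : A x -> (forall l, inn x z (dv l X x) = 0) ->
  inn x (normal_part g X x w) z = inn x w z.
Proof. by move=> Ax z0; rewrite ipBl inner_tangent_normal // subr0. Qed.

Lemma normal_partE x w : normal_part g X x w = 0 -> w = tangent_part g X x w.
Proof. by move=> /eqP; rewrite subr_eq0 => /eqP. Qed.

(** The induced Levi-Civita connection is the tangential part of the ambient one: in Koszul's
    formula all products but one cancel by the symmetry [cv_sym]. *)
Lemma christoffelE x m k l : A x -> christoffel (first_form g X) x m k l =
  \sum_p invmx (first_form g X x) m p * inn x (cv k (dv l X) x) (dv p X x).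
Proof.
move=> Ax; rewrite /christoffel mulr_sumr; apply: eq_bigr => p _.
have E i a b : pd i (fun y => first_form g X y a b : R^o) x =
    inn x (cv i (dv a X) x) (dv b X x) + inn x (cv i (dv b X) x) (dv a X x).
  rewrite -(ds_G i a b Ax) dsE; congr (pd i _ x).
  by apply/funext => y; exact: first_formE.
rewrite !E (cv_sym l k Ax) (cv_sym p k Ax) (cv_sym p l Ax).
move: (ip _ _ _) (ip _ (cv k (dv p X) x) _) (ip _ (cv l (dv p X) x) _) => r1 r2 r3.
by gen_scalars; field.
Qed.

Lemma second_formE x k l : A x ->
  second_form g X x k l = normal_part g X x (cv k (dv l X) x).
Proof. by move=> Ax; rewrite /second_form -dvE cov_alongE. Qed.

(** Gauss formula: by [christoffelE] the subtracted Christoffel terms are exactly the tangential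
    part. *)
Lemma hess_mapE x k l : A x -> hess_map g X x k l = second_form g X x k l.
Proof.
move=> Ax; rewrite /hess_map /second_form /normal_part /tangent_part; congr (_ - _).
apply: eq_bigr => m _; rewrite christoffelE // scaler_suml; apply: eq_bigr => p _.
by rewrite /first_form_inv -!dvE (cov_alongE _ _ Ax) inner_ip.
Qed.

Lemma tensionE x : A x -> tension g X x = 2 *: mean_curv g X x.
Proof.
move=> Ax; rewrite /tension /mean_curv scalerA mulfV ?pnatr_eq0 // scale1r /trace2.
by apply: eq_bigr => k _; apply: eq_bigr => l _; rewrite hess_mapE.
Qed.

Lemma inner_trace2 x (B : 'I_2 -> 'I_2 -> 'rV[R]_4) (b : 'I_2 -> 'I_2 -> R) z : A x ->
  (forall k l, inn x (B k l) z = b k l) ->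
  inn x (trace2 g X x B) z =
  (G x 1 1 * b 0 0 - G x 0 1 * b 0 1 - G x 1 0 * b 1 0 + G x 0 0 * b 1 1) / D x.
Proof.
move=> Ax Eb; have [e00 e01 e10 e11] := invmx2 (Dff Ax).
rewrite /trace2 !sum2 /first_form_inv e00 e01 e10 e11 !first_formE !ipDl !ipZl !Eb.
have E (a c c' d p q r s : R) (n : R) :
  d / n * p + - c / n * q + (- c' / n * r + a / n * s) = (d * p - c * q - c' * r + a * s) / n.
  by ring.
exact: E.
Qed.

Lemma christoffel_lower x (p : 'I_2 -> R) k l : A x ->
  \sum_m christoffel (first_form g X) x m k l * p m =
  ((G x 1 1 * inn x (cv k (dv l X) x) (dv 0 X x)
    - G x 0 1 * inn x (cv k (dv l X) x) (dv 1 X x)) * p 0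
  + (G x 0 0 * inn x (cv k (dv l X) x) (dv 1 X x)
    - G x 1 0 * inn x (cv k (dv l X) x) (dv 0 X x)) * p 1) / D x.
Proof.
move=> Ax; have [e00 e01 e10 e11] := invmx2 (Dff Ax).
rewrite sum2 !christoffelE // !sum2 e00 e01 e10 e11 !first_formE.
have E (a b b' d c0 c1 p0 p1 n : R) : (d / n * c0 + - b / n * c1) * p0 + (- b' / n * c0 + a / n * c1) * p1
   = ((d * c0 - b * c1) * p0 + (a * c1 - b' * c0) * p1) / n by ring.
exact: E.
Qed.

(** * Tangential part of the bitension field for a parallel tension field *)

Section Bitension.
Variable tau : 'rV[R]_2 -> 'rV[R]_4.
Hypotheses (stau : smooth_on A tau) (tauE : forall x, A x -> tension g X x = tau x)
  (tau_normal : forall x l, A x -> inn x (tau x) (dv l X x) = 0)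
  (tau_parallel : forall x k, A x -> normal_part g X x (cv k tau x) = 0).

Let B l m x := inn x (tau x) (cv l (dv m X) x).

Let sB l m : smooth_on A (B l m : _ -> R^o).
Proof. by apply: smooth_inn => //; apply: smooth_cv; exact: smooth_dv. Qed.

Let dtau x : A x -> differentiable tau x.
Proof. exact: smooth_on_diff. Qed.

Let ddX k x : A x -> differentiable (dv k X) x.
Proof. exact/smooth_on_diff/smooth_dv. Qed.

Let B_sym l m x : A x -> B l m x = B m l x.
Proof. by move=> Ax; rewrite /B cv_sym. Qed.

Let H1 l m x : A x -> inn x (cv l tau x) (dv m X x) = - B l m x.
Proof.
move=> Ax; apply/eqP; rewrite -addr_eq0 -(cv_compat l Ax (dtau Ax) (ddX m Ax)).
rewrite (ds_eq_on oA l (G := fun=> 0) _ Ax) ?ds_cst // => y Ay.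
exact: tau_normal.
Qed.

Let H2 k l m x : A x -> inn x (cv k (cv l tau) x) (dv m X x) =
  - ds k (B l m) x - inn x (cv l tau x) (cv k (dv m X) x).
Proof.
move=> Ax; have dcv := smooth_on_diff (smooth_cv l stau) Ax.
have := cv_compat k Ax dcv (ddX m Ax).
rewrite (ds_eq_on oA k (G := fun y => - B l m y) _ Ax); last by move=> y Ay; exact: H1.
rewrite (dsN k (smooth_on_diff (sB l m) Ax)) => ->.
by rewrite addrK.
Qed.

(** Weingarten formula: a parallel normal field has tangential derivatives, and [H1] gives their
    components in terms of [B]. *)
Let H3 l x v : A x -> inn x (cv l tau x) v =
  - ((G x 1 1 * B l 0 x - G x 0 1 * B l 1 x) * inn x (dv 0 X x) v
   + (G x 0 0 * B l 1 x - G x 1 0 * B l 0 x) * inn x (dv 1 X x) v) / D x.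
Proof.
move=> Ax; rewrite (normal_partE (tau_parallel l Ax)) (tangent_partE _ Ax) ipDl !ipZl.
rewrite !(H1 _ _ Ax).
have E (a b b' d B0 B1 r s n : R) : (d * - B0 - b * - B1) / n * r + (a * - B1 - b' * - B0) / n * s
  = - ((d * B0 - b * B1) * r + (a * B1 - b' * B0) * s) / n by ring.
exact: E.
Qed.

Let H3' l x : A x -> inn x (cv l tau x) (tau x) = 0.
Proof.
move=> Ax; rewrite (normal_partE (tau_parallel l Ax)) inner_tangent_normal // => k.
exact: tau_normal.
Qed.

Let kappa x := d1 (d1 f) (t_ x) / f (t_ x) - (d1 f (t_ x) / f (t_ x)) ^+ 2.

(** Codazzi equation. In [ricci], paired with the normal field [tau], every term containing a
    product of [tau] with a tangent vector disappears, and only the [kappa] part is left. *)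
Let H4 k l m x : A x -> ds k (B l m) x = ds m (B l k) x
  + inn x (cv k tau x) (cv m (dv l X) x) - inn x (cv m tau x) (cv k (dv l X) x)
  - kappa x * tau x 0 0 * (dv k X x 0 0 * G x m l - dv m X x 0 0 * G x k l).
Proof.
move=> Ax; have sXl := smooth_dv l sX.
have E i j : ds i (B l j) x = inn x (cv i tau x) (cv j (dv l X) x)
    + inn x (cv i (cv j (dv l X)) x) (tau x).
  rewrite (ds_eq_on oA i (G := fun y => inn y (tau y) (cv j (dv l X) y)) _ Ax); last first.
    by move=> y Ay; rewrite /B (cv_sym l j Ay).
  rewrite (cv_compat i Ax (dtau Ax) (smooth_on_diff (smooth_cv j sXl) Ax)).
  by rewrite (ipC _ (tau x)).
have := ricci k m (tau x) Ax sXl; rewrite ipBl !E.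
rewrite (ipC _ (dv k X x) (tau x)) (ipC _ (dv m X x) (tau x)) !(tau_normal _ Ax) -/(kappa x).
set r1 := inn x (cv k (cv m _) x) _; set r2 := inn x (cv m (cv k _) x) _ => e.
have -> : r1 = (r1 - r2) + r2 by ring.
by rewrite e; ring.
Qed.

Let H5 x : A x -> inn x (tau x) (tau x) * D x =
  G x 1 1 * B 0 0 x - G x 0 1 * B 0 1 x - G x 1 0 * B 1 0 x + G x 0 0 * B 1 1 x.
Proof.
move=> Ax; have E k l : inn x (hess_map g X x k l) (tau x) = B k l x.
  rewrite hess_mapE // second_formE // inner_normal_part ?(ipC _ (cv _ _ x)) // => i.
  exact: tau_normal.
rewrite -[X in inn x X _ * _](tauE Ax) /tension (inner_trace2 Ax E).
by rewrite divfK ?D_neq0.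
Qed.

Let dG i k l x := ds i (fun y => G y k l) x.

(** Derivative of the trace identity [H5]: a parallel normal field has constant length. *)
Let H6 m x : A x -> inn x (tau x) (tau x) * (dG m 0 0 x * G x 1 1 + G x 0 0 * dG m 1 1 x
    - (dG m 0 1 x * G x 1 0 + G x 0 1 * dG m 1 0 x)) =
  dG m 1 1 x * B 0 0 x + G x 1 1 * ds m (B 0 0) x
  - (dG m 0 1 x * B 0 1 x + G x 0 1 * ds m (B 0 1) x)
  - (dG m 1 0 x * B 1 0 x + G x 1 0 * ds m (B 1 0) x)
  + (dG m 0 0 x * B 1 1 x + G x 0 0 * ds m (B 1 1) x).
Proof.
move=> Ax.
have sG k l : smooth_on A (fun y => G y k l : R^o) by apply: smooth_inn => //; exact: smooth_dv.
have dGx k l := smooth_on_diff (sG k l) Ax.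
have dBx k l := smooth_on_diff (sB k l) Ax.
have sT : smooth_on A (fun y => inn y (tau y) (tau y) : R^o) by exact: smooth_inn.
have dT := smooth_on_diff sT Ax.
have dT0 : ds m (fun y => inn y (tau y) (tau y)) x = 0.
  by rewrite (cv_compat m Ax (dtau Ax) (dtau Ax)) (ipC _ (tau x)) !H3' // addr0.
have sM F1 F2 : smooth_on A (F1 : _ -> R^o) -> smooth_on A (F2 : _ -> R^o) ->
    smooth_on A (fun y => F1 y * F2 y : R^o) by exact: smooth_M.
have sGG k l i j := smooth_on_diff (sM _ _ (sG k l) (sG i j)) Ax.
have sGB k l i j := smooth_on_diff (sM _ _ (sG k l) (sB i j)) Ax.
have sD : smooth_on A (fun y => D y : R^o) by apply: smooth_B => //; exact: sM.
have := ds_eq_on oA m (fun y Ay => H5 Ay) Ax.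
rewrite (dsM m dT (smooth_on_diff sD Ax)) dT0 mul0r add0r.
rewrite (dsB m (sGG 0 0 1 1) (sGG 0 1 1 0)).
rewrite (dsM m (dGx 0 0) (dGx 1 1)) (dsM m (dGx 0 1) (dGx 1 0)).
have d1 := differentiableB (sGB 1 1 0 0) (sGB 0 1 0 1).
have d2 := differentiableB d1 (sGB 1 0 1 0).
rewrite (dsD m d2 (sGB 0 0 1 1)) (dsB m d1 (sGB 1 0 1 0)).
rewrite (dsB m (sGB 1 1 0 0) (sGB 0 1 0 1)).
rewrite (dsM m (dGx 1 1) (dBx 0 0)) (dsM m (dGx 0 1) (dBx 0 1)).
by rewrite (dsM m (dGx 1 0) (dBx 1 0)) (dsM m (dGx 0 0) (dBx 1 1)).
Qed.

(** The tangential part of the rough Laplacian is minus the divergence of [B]. Codazzi turns it into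
    the gradient of the trace of [B], which is zero because this trace is the constant squared
    length of [tau], plus a curvature term. The trace of the curvature in the bitension contributes
    the same term once more, whence the factor 2. *)
Lemma bitension_tangent x m : A x ->
  inn x (bitension g X x) (dv m X x) =
  - 2 * (d1 (d1 f) (t_ x) / f (t_ x) - (d1 f (t_ x) / f (t_ x)) ^+ 2)
    * tau x 0 0 * dv m X x 0 0.
Proof.
move=> Ax; rewrite -/(kappa x).
have ER : rough_laplacian g X (tension g X) x = trace2 g X x (fun k l =>
    cv k (cv l tau) x - \sum_m christoffel (first_form g X) x m k l *: cv m tau x).
  rewrite /rough_laplacian; congr trace2; apply/funext => k; apply/funext => l.
  have E i y : A y -> cov_along g X i (tension g X) y = cv i tau y.
    by move=> Ay; rewrite cov_alongE //; exact: cv_eq_on.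
  congr (_ - _); first by rewrite cov_alongE //; apply: cv_eq_on => // y; exact: E.
  by apply: eq_bigr => i _; rewrite E.
have EC k l : inn x (curvature g (X x) (pd k X x) (tension g X x) (pd l X x)) (dv m X x)
    = kappa x * tau x 0 0 * (dv m X x 0 0 * G x k l - dv l X x 0 0 * G x k m).
  rewrite -inner_ip (curvature_rw I_int f_smooth f_neq0 _ _ _ _ (XI Ax)) !inner_ip tauE //.
  rewrite -!dvE !(tau_normal _ Ax) -d1E -d1d1E -/(kappa x).
  by ring.
pose c k l p := inn x (cv k (dv l X) x) (dv p X x).
pose h l k i := - ((G x 1 1 * B l 0 x - G x 0 1 * B l 1 x) * c k i 0
   + (G x 0 0 * B l 1 x - G x 1 0 * B l 0 x) * c k i 1) / D x.
have H3c l k i : inn x (cv l tau x) (cv k (dv i X) x) = h l k i.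
  by rewrite (H3 _ _ Ax) /h /c (ipC _ (dv 0 X x) (cv _ _ _)) (ipC _ (dv 1 X x) (cv _ _ _)).
pose bt l k := ds m (B l k) x.
pose b1 k l := - (bt l k + h k m l - h m k l
    - kappa x * tau x 0 0 * (dv k X x 0 0 * G x m l - dv m X x 0 0 * G x k l))
  - h l k m + ((G x 1 1 * c k l 0 - G x 0 1 * c k l 1) * B 0 m x
               + (G x 0 0 * c k l 1 - G x 1 0 * c k l 0) * B 1 m x) / D x.
have E1 k l : inn x (cv k (cv l tau) x
    - \sum_i christoffel (first_form g X) x i k l *: cv i tau x) (dv m X x) = b1 k l.
  have eS : inn x (\sum_i christoffel (first_form g X) x i k l *: cv i tau x) (dv m X x) =
      - (((G x 1 1 * c k l 0 - G x 0 1 * c k l 1) * B 0 m x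
          + (G x 0 0 * c k l 1 - G x 1 0 * c k l 0) * B 1 m x) / D x).
    rewrite sum2 ipDl !ipZl !H1 // !mulrN -opprD; congr (- _).
    by rewrite -(christoffel_lower (fun i => B i m x) k l Ax) sum2.
  by rewrite ipBl (H2 _ _ _ Ax) (H4 k l m Ax) !H3c eS opprK.
rewrite /bitension ER ipBl (inner_trace2 Ax E1) (inner_trace2 Ax EC).
rewrite -(mulrA (- 2) (kappa x)).
apply: (@bitension_algebra _ (fun k l => G x k l) (fun k l => B k l x) bt c
  (fun k => dv k X x 0 0) (inn x (tau x) (tau x)) (kappa x * tau x 0 0) m).
- exact: ipC.
- exact: B_sym.
- by rewrite /bt; apply: (ds_eq_on oA) => // y Ay; exact: B_sym.
- by move=> k l p; rewrite /c cv_sym.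
- exact: D_neq0.
- exact: H5.
by have := H6 m Ax; rewrite /dG !(ds_G _ _ _ Ax).
Qed.

End Bitension.

End Chart.

(** * Moving frames *)

Section RowEntries.
Context {R : realType} {m : nat}.
Implicit Types u v : 'rV[R]_m.
Lemma rowDE u v i : (u + v) 0 i = u 0 i + v 0 i. Proof. exact: mxE. Qed.
Lemma rowNE u i : (- u) 0 i = - u 0 i. Proof. exact: mxE. Qed.
Lemma rowBE u v i : (u - v) 0 i = u 0 i - v 0 i. Proof. by rewrite rowDE rowNE. Qed.
Lemma rowZE k u i : (k *: u) 0 i = k * u 0 i. Proof. exact: mxE. Qed.
Lemma row0E i : (0 : 'rV[R]_m) 0 i = 0. Proof. exact: mxE. Qed.
Definition rowE_ := (rowDE, rowNE, rowZE, row0E).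
End RowEntries.

Section Cross.
Context {R : realType}.
Implicit Types u v x : 'rV[R]_3.
Local Notation o0 := (ord0 : 'I_3).
Local Notation o1 := (lift ord0 ord0 : 'I_3).
Local Notation o2 := (lift ord0 (lift ord0 ord0) : 'I_3).

Definition row3 (a b c : R) : 'rV[R]_3 :=
  \row_j (if j == ord0 then a else if j == o1 then b else c).

Definition cross u v : 'rV[R]_3 :=
  row3 (u 0 o1 * v 0 o2 - u 0 o2 * v 0 o1) (u 0 o2 * v 0 o0 - u 0 o0 * v 0 o2)
       (u 0 o0 * v 0 o1 - u 0 o1 * v 0 o0).

Lemma row3E a b c : [/\ row3 a b c 0 o0 = a, row3 a b c 0 o1 = b & row3 a b c 0 o2 = c].
Proof. by rewrite !mxE. Qed.

Lemma dot3 u v : dot u v = u 0 o0 * v 0 o0 + u 0 o1 * v 0 o1 + u 0 o2 * v 0 o2.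
Proof. by rewrite dotE !big_ord_recl big_ord0 addr0 addrA. Qed.

Lemma eq_row3 u v : u 0 o0 = v 0 o0 -> u 0 o1 = v 0 o1 -> u 0 o2 = v 0 o2 -> u = v.
Proof.
move=> e0 e1 e2; apply/rowP => j.
case: (unliftP ord0 j) => [i|] -> //; case: (unliftP ord0 i) => [k|] -> //.
by rewrite (ord1 k).
Qed.

Lemma crossE u v : [/\ cross u v 0 o0 = u 0 o1 * v 0 o2 - u 0 o2 * v 0 o1,
  cross u v 0 o1 = u 0 o2 * v 0 o0 - u 0 o0 * v 0 o2 &
  cross u v 0 o2 = u 0 o0 * v 0 o1 - u 0 o1 * v 0 o0].
Proof. exact: row3E. Qed.

Lemma dot_cross_l u v : dot (cross u v) u = 0.
Proof. by have [a b c] := crossE u v; rewrite dot3 a b c; gen_scalars; ring. Qed.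

Lemma dot_cross_r u v : dot (cross u v) v = 0.
Proof. by have [a b c] := crossE u v; rewrite dot3 a b c; gen_scalars; ring. Qed.

Lemma dot_cross u v :
  dot (cross u v) (cross u v) = dot u u * dot v v - dot u v ^+ 2.
Proof. by have [a b c] := crossE u v; rewrite !dot3 a b c; gen_scalars; ring. Qed.

Lemma cross_expand u v x :
  (dot u u * dot v v - dot u v ^+ 2) *: x =
  dot x (cross u v) *: cross u v
  + (dot x u * dot v v - dot x v * dot u v) *: u
  + (dot x v * dot u u - dot x u * dot u v) *: v.
Proof.
have [a b c] := crossE u v.
rewrite !dot3 a b c.
apply: eq_row3; rewrite !rowDE !rowZE ?a ?b ?c {a b c}.
all: move: (u 0 o0) (u 0 o1) (u 0 o2) (v 0 o0) (v 0 o1) (v 0 o2) (x 0 o0) (x 0 o1) (x 0 o2).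
all: by move=> *; ring.
Qed.

Variables (n : nat) (A : set 'rV[R]_n.+1).
Hypothesis oA : open A.

Lemma smooth_cross (F G : 'rV[R]_n.+1 -> 'rV[R]_3) : smooth_on A F -> smooth_on A G ->
  smooth_on A (fun y => cross (F y) (G y)).
Proof.
move=> /(smooth_rowP oA) sF /(smooth_rowP oA) sG; apply/smooth_rowP => // j.
have sFG i k : smooth_on A (fun y => F y 0 i * G y 0 k - F y 0 k * G y 0 i : R^o).
  by apply: smooth_B => //; apply: smooth_M.
case: (unliftP ord0 j) => [i|] ->; last first.
  by apply: (smooth_eq_on oA _ (sFG o1 o2)) => y _; have [-> _ _] := crossE (F y) (G y).
case: (unliftP ord0 i) => [k|] ->; last first.
  by apply: (smooth_eq_on oA _ (sFG o2 o0)) => y _; have [_ -> _] := crossE (F y) (G y).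
rewrite (ord1 k).
by apply: (smooth_eq_on oA _ (sFG o0 o1)) => y _; have [_ _ ->] := crossE (F y) (G y).
Qed.

End Cross.

(* p and q are the components of 1-forms on R^2. *)
Definition wedge {R : realType} (p q : 'I_2 -> R) : R := p 0 * q 1 - p 1 * q 0.

(** The factor of proportionality is explicit, so that it is visibly smooth when the forms vary with
    the point, as in [frame_b] and [frame_tau]. *)
Lemma wedge0_prop {R : realType} (p q : 'I_2 -> R) :
  wedge p q = 0 -> (exists k, q k != 0) ->
  forall k, p k = (p 0 * q 0 + p 1 * q 1) / (q 0 ^+ 2 + q 1 ^+ 2) * q k.
Proof.
rewrite /wedge => /eqP; rewrite subr_eq0 => /eqP e q0.
have n0 : q 0 ^+ 2 + q 1 ^+ 2 != 0.
  rewrite paddr_eq0 ?sqr_ge0 // !sqrf_eq0; apply/negP => /andP[/eqP a /eqP b].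
  case: q0; apply: (ord2P (P := fun k => q k != 0 -> False)); rewrite ?a ?b eqxx //.
have H k : p k * (q 0 ^+ 2 + q 1 ^+ 2) = (p 0 * q 0 + p 1 * q 1) * q k.
  move: k; apply: ord2P.
    by rewrite [RHS]mulrDl -(mulrA (p 1)) (mulrC (q 1)) (mulrA (p 1)) -e; ring.
  by rewrite [RHS]mulrDl (mulrC (p 0)) -(mulrA (q 0)) e; ring.
move=> k; apply: (mulIf n0); rewrite H mulrAC divfK //.
Qed.

(** In dimension two a form proportional to both members of a coframe vanishes. *)
Lemma wedge_basis0 {R : realType} (p q r : 'I_2 -> R) :
  wedge p q = 0 -> wedge p r = 0 -> wedge q r != 0 -> forall k, p k = 0.
Proof.
rewrite /wedge => e1 e2 n0.
have H0 : p 0 * (q 0 * r 1 - q 1 * r 0) = 0.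
  have -> : p 0 * (q 0 * r 1 - q 1 * r 0) = q 0 * (p 0 * r 1 - p 1 * r 0) - r 0 * (p 0 * q 1 - p 1 * q 0).
    by ring.
  by rewrite e1 e2 !mulr0 subrr.
have H1 : p 1 * (q 0 * r 1 - q 1 * r 0) = 0.
  have -> : p 1 * (q 0 * r 1 - q 1 * r 0) = q 1 * (p 0 * r 1 - p 1 * r 0) - r 1 * (p 0 * q 1 - p 1 * q 0).
    by ring.
  by rewrite e1 e2 !mulr0 subrr.
by apply: ord2P; apply/eqP; [move/eqP: H0|move/eqP: H1]; rewrite mulf_eq0 (negPf n0) orbF.
Qed.

(* Moving frame (w, e2, e4) of R^3 along a map Y : R^2 -> R^3 into the level
   sets of t, with coframe (rho, om): Cartan's structure equations. *)
Section Frame.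
Context {R : realType}.
Variables (A : set 'rV[R]_2) (oA : open A) (I : set R) (f : R -> R) (H0 : R).
Hypotheses (f_smooth : smooth_on1 I f) (f_neq0 : forall s, I s -> f s != 0)
  (H0_neq0 : H0 != 0).
Variables (t : 'rV[R]_2 -> R) (Y w e2 e4 : 'rV[R]_2 -> 'rV[R]_3)
  (rho om : 'I_2 -> 'rV[R]_2 -> R).
Hypotheses (tI : forall x, A x -> I (t x)).
Hypotheses (st : smooth_on A (t : _ -> R^o)) (sY : smooth_on A Y)
  (sw : smooth_on A w) (se2 : smooth_on A e2) (se4 : smooth_on A e4)
  (srho : forall k, smooth_on A (rho k : _ -> R^o))
  (som : forall k, smooth_on A (om k : _ -> R^o)).
Hypotheses (ww : forall x, A x -> dot (w x) (w x) = 1)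
  (e22 : forall x, A x -> dot (e2 x) (e2 x) = 1)
  (e44 : forall x, A x -> dot (e4 x) (e4 x) = 1)
  (we2 : forall x, A x -> dot (w x) (e2 x) = 0)
  (we4 : forall x, A x -> dot (w x) (e4 x) = 0)
  (e24 : forall x, A x -> dot (e2 x) (e4 x) = 0)
  (basis : forall x v, A x -> v = dot v (w x) *: w x + dot v (e2 x) *: e2 x + dot v (e4 x) *: e4 x).
Hypotheses
  (dY : forall x k, A x -> dv k Y x = (f (t x))^-1 *: (rho k x *: w x + om k x *: e2 x))
  (de4 : forall x k, A x -> dv k e4 x = (- (2 * H0) * om k x) *: e2 x)
  (t_rho : forall x, A x -> wedge (ds^~ t ^~ x) (rho^~ x) = 0)
  (rho_om : forall x, A x -> wedge (rho^~ x) (om^~ x) != 0).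

Lemma rho_neq0 x : A x -> exists k, rho k x != 0.
Proof.
move=> /rho_om; have [r0|r0] := eqVneq (rho 0 x) 0; last by exists 0.
have [r1|r1] := eqVneq (rho 1 x) 0; last by exists 1.
by rewrite /wedge r0 r1 !mul0r subrr eqxx.
Qed.

Lemma om_neq0 x : A x -> exists k, om k x != 0.
Proof.
move=> /rho_om; have [r0|r0] := eqVneq (om 0 x) 0; last by exists 0.
have [r1|r1] := eqVneq (om 1 x) 0; last by exists 1.
by rewrite /wedge r0 r1 !mulr0 subrr eqxx.
Qed.

Let dw x : A x -> differentiable w x. Proof. exact: smooth_on_diff. Qed.
Let de2_ x : A x -> differentiable e2 x. Proof. exact: smooth_on_diff. Qed.
Let de4_ x : A x -> differentiable e4 x. Proof. exact: smooth_on_diff. Qed.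

Let ds_const (c : R) (P : 'rV[R]_2 -> R) k x : A x -> (forall y, A y -> P y = c) -> ds k P x = 0.
Proof. by move=> Ax Pc; rewrite (ds_eq_on oA k (G := fun=> c) Pc Ax) ds_cst. Qed.

(** The connection form between [w] and [e2]; the remaining connection forms are prescribed by
    [de4]. *)
Let alpha k x := dot (dv k w x) (e2 x).

Lemma dv_w_alpha k x : A x -> dv k w x = alpha k x *: e2 x.
Proof.
move=> Ax; rewrite {1}(basis (dv k w x) Ax).
have h1 := ds_const k Ax ww; have h2 := ds_const k Ax we4.
move: h1; rewrite (ds_dot k (dw Ax) (dw Ax)) (dotC (w x)) => h1.
move: h2; rewrite (ds_dot k (dw Ax) (de4_ Ax)) de4 // dotZr we2 // mulr0 addr0 => h2.
have -> : dot (dv k w x) (w x) = 0 by lra.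
by rewrite h2 !scale0r add0r addr0.
Qed.

Lemma dv_e2_alpha k x : A x ->
  dv k e2 x = (- alpha k x) *: w x + (2 * H0 * om k x) *: e4 x.
Proof.
move=> Ax; rewrite {1}(basis (dv k e2 x) Ax).
have h1 := ds_const k Ax e22; have h2 := ds_const k Ax we2; have h3 := ds_const k Ax e24.
move: h1; rewrite (ds_dot k (de2_ Ax) (de2_ Ax)) (dotC (e2 x)) => h1.
move: h2; rewrite (ds_dot k (dw Ax) (de2_ Ax)) (dotC (w x)) -/(alpha k x) => h2.
move: h3; rewrite (ds_dot k (de2_ Ax) (de4_ Ax)) de4 // dotZr e22 // mulr1 => h3.
have -> : dot (dv k e2 x) (e2 x) = 0 by lra.
have -> : dot (dv k e2 x) (w x) = - alpha k x by lra.
have -> : dot (dv k e2 x) (e4 x) = 2 * H0 * om k x by lra.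
by rewrite scale0r addr0.
Qed.

(* d (d Z) = 0 split along the frame. *)
Lemma closed_combination (Z : 'rV[R]_2 -> 'rV[R]_3) (p q : 'I_2 -> 'rV[R]_2 -> R) x :
  A x -> smooth_on A Z ->
  (forall k, smooth_on A (p k : _ -> R^o)) -> (forall k, smooth_on A (q k : _ -> R^o)) ->
  (forall k y, A y -> dv k Z y = p k y *: w y + q k y *: e2 y) ->
  [/\ ds 0 (p 1) x - ds 1 (p 0) x + wedge (q^~ x) (alpha^~ x) = 0,
      ds 0 (q 1) x - ds 1 (q 0) x + wedge (alpha^~ x) (p^~ x) = 0 &
      wedge (om^~ x) (q^~ x) = 0].
Proof.
move=> Ax sZ sp sq dZ.
have E j k : dv j (dv k Z) x = (ds j (p k) x - q k x * alpha j x) *: w x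
   + (ds j (q k) x + p k x * alpha j x) *: e2 x + (2 * H0 * (q k x * om j x)) *: e4 x.
  rewrite (dv_eq_on oA j (dZ k) Ax).
  have s1 := smooth_Zv oA (sp k) sw; have s2 := smooth_Zv oA (sq k) se2.
  rewrite (dvD j (smooth_on_diff s1 Ax) (smooth_on_diff s2 Ax)).
  rewrite (dvZ j (smooth_on_diff (sp k) Ax) (dw Ax)) (dvZ j (smooth_on_diff (sq k) Ax) (de2_ Ax)).
  rewrite dv_w_alpha // dv_e2_alpha //.
  move: (ds j (p k) x) (ds j (q k) x) (p k x) (q k x) (alpha j x) (om j x) (w x) (e2 x) (e4 x).
  move=> p1 q1 p2 q2 a o W E2 E4; apply/rowP => i; rewrite !rowE_.
  move: (W 0 i) (E2 0 i) (E4 0 i) => r1 r2 r3.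
  ring.
have := dv_schwarz oA 0 1 Ax sZ; rewrite !E => e.
split.
- have := congr1 (fun v => dot v (w x)) e.
  rewrite !(dotDl, dotZl) ww // (dotC (e2 x)) we2 // (dotC (e4 x)) we4 // !(mulr0, mulr1, addr0).
  by rewrite /wedge; lra.
- have := congr1 (fun v => dot v (e2 x)) e.
  rewrite !(dotDl, dotZl) we2 // e22 // (dotC (e4 x)) e24 // !(mulr0, mulr1, addr0, add0r).
  by rewrite /wedge; lra.
have := congr1 (fun v => dot v (e4 x)) e.
rewrite !(dotDl, dotZl) we4 // e24 // e44 // !(mulr0, mulr1, add0r) => /mulfI.
rewrite mulf_eq0 pnatr_eq0 /= (negPf H0_neq0) => /(_ isT).
by rewrite /wedge; lra.
Qed.

Let ds_lin (c : R) (P : 'rV[R]_2 -> R) k x : A x -> smooth_on A (P : _ -> R^o) ->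
  ds k (fun y => c * P y) x = c * ds k P x.
Proof.
move=> Ax sP; have sc : smooth_on A (fun _ : 'rV[R]_2 => c : R^o) by exact: smooth_cst.
by rewrite (dsM k (smooth_on_diff sc Ax) (smooth_on_diff sP Ax)) ds_cst mul0r add0r.
Qed.

Let salpha k : smooth_on A (alpha k : _ -> R^o).
Proof. by apply: smooth_dot => //; exact: smooth_dv. Qed.

Let s0 : smooth_on A (fun _ : 'rV[R]_2 => 0 : R^o).
Proof. exact: smooth_cst. Qed.

(** The w and e2 components of d d e4 = 0, divided by 2 H0: the connection form is proportional to
    [om], and [om] is closed. *)
Lemma frame_e4 x : A x ->
  wedge (alpha^~ x) (om^~ x) = 0 /\ ds 0 (om 1) x = ds 1 (om 0) x.
Proof.
move=> Ax.
have sq k : smooth_on A (fun y => - (2 * H0) * om k y : R^o).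
  by apply: smooth_M => //; exact: smooth_cst.
have [|e1 e2' _] := closed_combination Ax se4 (fun=> s0) sq.
  by move=> k y Ay; rewrite de4 // scale0r add0r.
have H20 : - (2 * H0) != 0 by rewrite oppr_eq0 mulf_neq0 ?pnatr_eq0.
move: e1 e2'; rewrite !ds_cst !ds_lin // /wedge => e1 e2'; split; apply: (mulfI H20).
  by rewrite mulr0; move: e1; lra.
by move: e2'; lra.
Qed.

(** The factor in alpha = b om. *)
Definition frame_b x := (alpha 0 x * om 0 x + alpha 1 x * om 1 x) / (om 0 x ^+ 2 + om 1 x ^+ 2).

Let b := frame_b.

Let alpha_b k x : A x -> alpha k x = b x * om k x.
Proof.
move=> Ax; apply: (wedge0_prop (p := alpha^~ x) (q := om^~ x)); last exact: om_neq0.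
exact: (frame_e4 Ax).1.
Qed.

Lemma sum_sqr_neq0 (p : 'I_2 -> R) : (exists k, p k != 0) -> p 0 ^+ 2 + p 1 ^+ 2 != 0.
Proof.
move=> p0; rewrite paddr_eq0 ?sqr_ge0 // !sqrf_eq0; apply/negP => /andP[/eqP a /eqP c].
by case: p0; apply: (ord2P (P := fun k => p k != 0 -> False)); rewrite ?a ?c eqxx.
Qed.

Lemma smooth_frame_b : smooth_on A (b : _ -> R^o).
Proof.
apply: smooth_M => //; first by apply: smooth_D => //; exact: smooth_M.
apply: smooth_V => //.
  by move=> x Ax; apply: (sum_sqr_neq0 (p := om^~ x)); exact: om_neq0.
by apply: smooth_D => //; exact: smooth_X.
Qed.

Lemma dv_w k x : A x -> dv k w x = (b x * om k x) *: e2 x.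
Proof. by move=> Ax; rewrite dv_w_alpha // alpha_b. Qed.

Lemma dv_e2 k x : A x -> dv k e2 x = (- om k x) *: (b x *: w x - (2 * H0) *: e4 x).
Proof.
move=> Ax; rewrite dv_e2_alpha // alpha_b //.
move: (b x) (om k x) (w x) (e4 x) => c o W E; apply/rowP => i; rewrite !rowE_.
by move: (W 0 i) (E 0 i) => r1 r2; ring.
Qed.

(** The e2 component of d d w = 0, where dw = b om e2 and [om] is closed. *)
Lemma frame_db_om x : A x -> wedge (ds^~ b ^~ x) (om^~ x) = 0.
Proof.
move=> Ax; have [_ eo] := frame_e4 Ax.
have sq k : smooth_on A (fun y => b y * om k y : R^o).
  by apply: smooth_M => //; exact: smooth_frame_b.
have [|_ e _] := closed_combination Ax sw (fun=> s0) sq.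
  by move=> k y Ay; rewrite dv_w // scale0r add0r.
have E j k : ds j (fun y => b y * om k y) x = ds j b x * om k x + b x * ds j (om k) x.
  exact: (dsM j (smooth_on_diff smooth_frame_b Ax) (smooth_on_diff (som k) Ax)).
by move: e; rewrite !E eo /wedge; lra.
Qed.

Let sF : smooth_on A (fun x => f (t x) : R^o).
Proof. exact: (smooth_comp1 oA f_smooth tI st). Qed.

Let sVF : smooth_on A (fun x => (f (t x))^-1 : R^o).
Proof. by apply: smooth_V => // x Ax; exact/f_neq0/tI. Qed.

Let dsF k x : A x -> ds k (fun x => f (t x)) x = d1 f (t x) * ds k t x.
Proof.
by move=> Ax; rewrite (ds_comp1 k (f_der f_smooth (tI Ax)) (smooth_on_diff st Ax)).
Qed.

Let dsVF k (P : 'rV[R]_2 -> R) x : A x -> smooth_on A (P : _ -> R^o) ->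
  ds k (fun x => (f (t x))^-1 * P x) x =
  (f (t x))^-1 * ds k P x - d1 f (t x) / f (t x) ^+ 2 * (ds k t x * P x).
Proof.
move=> Ax sP; have F0 := f_neq0 (tI Ax).
rewrite (dsM k (smooth_on_diff sVF Ax) (smooth_on_diff sP Ax)).
rewrite (dsV k F0 (smooth_on_diff sF Ax)) dsF //.
move: F0; move: (f (t x)) (d1 f (t x)) (ds k t x) (ds k P x) (P x) => F F1 a c d F0.
by field.
Qed.

(** Both statements come from d d Y = 0. In the w component the derivative of 1/f drops out because
    dt is proportional to [rho], and alpha is proportional to [om]; hence [rho] is closed. The e2
    component gives the second equation since [om] is closed. *)
Lemma frame_Y x : A x -> ds 0 (rho 1) x = ds 1 (rho 0) x /\
  d1 f (t x) / f (t x) * wedge (ds^~ t ^~ x) (om^~ x) + b x * wedge (rho^~ x) (om^~ x) = 0.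
Proof.
move=> Ax; have F0 := f_neq0 (tI Ax); have [_ eo] := frame_e4 Ax.
have sp k : smooth_on A (fun y => (f (t y))^-1 * rho k y : R^o) by exact: smooth_M.
have sq k : smooth_on A (fun y => (f (t y))^-1 * om k y : R^o) by exact: smooth_M.
have [|e1 e2' _] := closed_combination Ax sY sp sq.
  by move=> k y Ay; rewrite dY // scalerDr !scalerA.
have tr := t_rho Ax.
move: e1 e2'; rewrite !dsVF // /wedge !alpha_b // eo.
move: tr; rewrite /wedge.
move: F0; move: (f (t x)) (d1 f (t x)) (ds 0 t x) (ds 1 t x) (b x) => F F1 t0 t1 c F0.
move: (rho 0 x) (rho 1 x) (om 0 x) (om 1 x) (ds 0 (rho 1) x) (ds 1 (rho 0) x) (ds 1 (om 0) x).
move=> r0 r1 o0 o1 r01 r10 o10 tr e1 e2'; split.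
  apply/eqP; rewrite -subr_eq0; apply/eqP.
  have -> : r01 - r10 = F * (F^-1 * r01 - F1 / F ^+ 2 * (t0 * r1)
      - (F^-1 * r10 - F1 / F ^+ 2 * (t1 * r0))
      + (F^-1 * o0 * (c * o1) - F^-1 * o1 * (c * o0))) + F1 / F * (t0 * r1 - t1 * r0).
    by field.
  by rewrite e1 tr !mulr0 addr0.
have -> : F1 / F * (t0 * o1 - t1 * o0) + c * (r0 * o1 - r1 * o0) =
   - F * (F^-1 * o10 - F1 / F ^+ 2 * (t0 * o1) - (F^-1 * o10 - F1 / F ^+ 2 * (t1 * o0))
      + (c * o0 * (F^-1 * r1) - c * o1 * (F^-1 * r0))).
  by field.
by rewrite e2' mulr0.
Qed.

(** The factor in dt = - tau rho; the sign is chosen so that b = tau f'/f in [frame_bE]. *)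
Definition frame_tau x :=
  - ((ds 0 t x * rho 0 x + ds 1 t x * rho 1 x) / (rho 0 x ^+ 2 + rho 1 x ^+ 2)).

Let tau := frame_tau.

Lemma ds_t_tau k x : A x -> ds k t x = - (tau x * rho k x).
Proof.
move=> Ax; rewrite -mulNr opprK.
apply: (wedge0_prop (p := ds^~ t ^~ x) (q := rho^~ x)); last exact: rho_neq0.
exact: t_rho.
Qed.

Lemma smooth_frame_tau : smooth_on A (tau : _ -> R^o).
Proof.
apply: smooth_N => //; apply: smooth_M => //.
  by apply: smooth_D => //; apply: smooth_M => //; exact: smooth_ds.
apply: smooth_V => //.
  by move=> x Ax; apply: (sum_sqr_neq0 (p := rho^~ x)); exact: rho_neq0.
by apply: smooth_D => //; exact: smooth_X.
Qed.

Lemma frame_bE x : A x -> b x = tau x * (d1 f (t x) / f (t x)).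
Proof.
move=> Ax; have [_ e] := frame_Y Ax; have w0 := rho_om Ax.
apply: (mulIf w0); move: e; rewrite /wedge !ds_t_tau //.
by move: (d1 _ _ / _) => r; lra.
Qed.

(** d d t = 0, with [rho] closed. *)
Lemma frame_dtau x : A x -> wedge (ds^~ tau ^~ x) (rho^~ x) = 0.
Proof.
move=> Ax; have [er _] := frame_Y Ax.
have st' : smooth_on A (t : _ -> R^o) by [].
have := ds_schwarz oA 0 1 Ax st'.
have E j k : ds j (ds k t) x = - (ds j tau x * rho k x + tau x * ds j (rho k) x).
  have sP : smooth_on A (fun y => tau y * rho k y : R^o).
    by apply: smooth_M => //; exact: smooth_frame_tau.
  rewrite (ds_eq_on oA j (G := fun y => - (tau y * rho k y)) _ Ax); last first.
    by move=> y Ay; exact: ds_t_tau.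
  rewrite (dsN j (smooth_on_diff sP Ax)).
  by rewrite (dsM j (smooth_on_diff smooth_frame_tau Ax) (smooth_on_diff (srho k) Ax)).
by rewrite !E er /wedge; lra.
Qed.

Lemma ds_frame_b k x : A x -> ds k b x = ds k tau x * (d1 f (t x) / f (t x))
  + tau x * ((d1 (d1 f) (t x) / f (t x) - (d1 f (t x) / f (t x)) ^+ 2) * ds k t x).
Proof.
move=> Ax; have F0 := f_neq0 (tI Ax).
have sf1 : smooth_on1 I (d1 f) by rewrite d1E; exact: (f'_smooth f_smooth).
have s1 : smooth_on A (fun x => d1 f (t x) : R^o) by exact: (smooth_comp1 oA sf1 tI st).
have sq : smooth_on A (fun x => (f (t x))^-1 * d1 f (t x) : R^o) by exact: smooth_M.
rewrite (ds_eq_on oA k (G := fun y => tau y * ((f (t y))^-1 * d1 f (t y))) _ Ax); last first.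
  by move=> y Ay; rewrite frame_bE // (mulrC (d1 _ _)).
rewrite (dsM k (smooth_on_diff smooth_frame_tau Ax) (smooth_on_diff sq Ax)) dsVF //.
rewrite (ds_comp1 k (f_der sf1 (tI Ax)) (smooth_on_diff st Ax)).
move: F0; move: (f (t x)) (d1 f (t x)) (d1 (d1 f) (t x)) (tau x) => F F1 F2 c F0.
by move: (ds k tau x) (ds k t x) => p q; field.
Qed.

(** [b] is a function of [tau] and [t], whose differentials are proportional to [rho], and db is
    also proportional to [om] by [frame_db_om]; but [rho] and [om] are independent. *)
Lemma frame_db k x : A x -> ds k b x = 0.
Proof.
move=> Ax; have w0 := rho_om Ax.
apply: (wedge_basis0 (p := ds^~ b ^~ x) _ (frame_db_om Ax) w0).
have e1 := frame_dtau Ax; have e2' := t_rho Ax.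
move: e1 e2'; rewrite /wedge !ds_frame_b //.
move: (d1 f (t x) / f (t x)) (_ - _ ^+ 2) => q K.
move: (ds 0 tau x) (ds 1 tau x) (ds 0 t x) (ds 1 t x) (rho 0 x) (rho 1 x) (tau x).
move=> a0 a1 t0 t1 r0 r1 c e1 e2'.
have -> : (a0 * q + c * (K * t0)) * r1 - (a1 * q + c * (K * t1)) * r0 =
  q * (a0 * r1 - a1 * r0) + c * K * (t0 * r1 - t1 * r0) by ring.
by rewrite e1 e2' !mulr0 addr0.
Qed.

End Frame.

(** * The frame of a biconservative PMCV surface *)

Lemma gmZr (R : realType) (F F1 c : R) (v w : 'rV[R]_4) :
  gm F F1 v (c *: w) = c *: gm F F1 v w.
Proof.
rewrite /gm; apply: eq_row4; rewrite ?spZ ?mk4_0 ?sp_mk4 e0Z ?dotZr ?mk4_0 ?sp_mk4.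
  by move: (dot _ _) => d; rewrite mulrCA.
apply/rowP => j; rewrite !rowE_.
by move: (sp w 0 j) (sp v 0 j) (v 0 0) (w 0 0) => *; ring.
Qed.

(* The orthonormal frame of R^3 attached to X = (t, y): e4 is f times the spatial
   part of H / H0, e2 is tangent to the level curves of t, and om is the
   e2-component of f dy, whose w-component is a multiple of dt. *)
Record adapted_frame (R : realType) (f : R -> R) (H0 : R) (A : set 'rV[R]_2)
    (X : 'rV[R]_2 -> 'rV[R]_4) := AdaptedFrame {
  af_w : 'rV[R]_2 -> 'rV[R]_3;
  af_e2 : 'rV[R]_2 -> 'rV[R]_3;
  af_e4 : 'rV[R]_2 -> 'rV[R]_3;
  af_om : 'I_2 -> 'rV[R]_2 -> R;
  af_b : 'rV[R]_2 -> R;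
  af_sw : smooth_on A af_w;
  af_se2 : smooth_on A af_e2;
  af_se4 : smooth_on A af_e4;
  af_sb : smooth_on A (af_b : _ -> R^o);
  af_ww : forall x, A x -> dot (af_w x) (af_w x) = 1;
  af_e22 : forall x, A x -> dot (af_e2 x) (af_e2 x) = 1;
  af_e44 : forall x, A x -> dot (af_e4 x) (af_e4 x) = 1;
  af_we2 : forall x, A x -> dot (af_w x) (af_e2 x) = 0;
  af_we4 : forall x, A x -> dot (af_w x) (af_e4 x) = 0;
  af_e24 : forall x, A x -> dot (af_e2 x) (af_e4 x) = 0;
  af_dw : forall k x, A x -> dv k af_w x = (af_b x * af_om k x) *: af_e2 x;
  af_de2 : forall k x, A x ->
    dv k af_e2 x = (- af_om k x) *: (af_b x *: af_w x - (2 * H0) *: af_e4 x);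
  af_de4 : forall k x, A x -> dv k af_e4 x = (- (2 * H0) * af_om k x) *: af_e2 x;
  af_b_neq0 : forall x, A x -> af_b x != 0;
  af_db : forall k x, A x -> ds k af_b x = 0;
  af_dY : forall k x, A x -> dv k (fun y => sp (X y)) x =
    (- (d1 f (X x 0 0) * dv k X x 0 0 / (f (X x 0 0) ^+ 2 * af_b x))) *: af_w x
    + (af_om k x / f (X x 0 0)) *: af_e2 x;
  af_t_om : forall x, A x -> wedge (fun k => dv k X x 0 0) (af_om^~ x) != 0;
  af_ode : forall x, A x ->
    af_b x ^+ 2 * f (X x 0 0) ^+ 3 * d1 (d1 f) (X x 0 0)
    - (d1 f (X x 0 0) ^+ 2 - af_b x ^+ 2 * f (X x 0 0) ^+ 2) ^+ 2
    - d1 f (X x 0 0) ^+ 4 = 0;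
  af_lt : forall x, A x -> af_b x ^+ 2 * f (X x 0 0) ^+ 2 < d1 f (X x 0 0) ^+ 2
}.

Lemma dv_scale (R : realType) (n m : nat) (k : 'I_n.+1) (c : R)
    (G : 'rV[R]_n.+1 -> 'rV[R]_m) x : differentiable G x ->
  dv k (fun y => c *: G y) x = c *: dv k G x.
Proof.
move=> dG; have dc : differentiable (fun _ : 'rV[R]_n.+1 => c : R^o) x by exact: differentiable_cst.
by rewrite (dvZ k dc dG) ds_cst scale0r add0r.
Qed.

Lemma cv_scale (R : realType) (f : R -> R) (X : 'rV[R]_2 -> 'rV[R]_4) (k : 'I_2) (c : R)
    (W : 'rV[R]_2 -> 'rV[R]_4) x : differentiable W x ->
  cv f X k (fun y => c *: W y) x = c *: cv f X k W x.
Proof. by move=> dW; rewrite /cv gmZr scalerDr (dv_scale k c dW). Qed.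

Lemma cross_basis (R : realType) (u v x : 'rV[R]_3) :
  dot u u = 1 -> dot v v = 1 -> dot u v = 0 ->
  x = dot x (cross u v) *: cross u v + dot x u *: u + dot x v *: v.
Proof.
move=> uu vv uv; have := cross_expand u v x.
by rewrite uu vv uv !(mulr1, mulr0, expr0n, subr0) scale1r.
Qed.

Section TangentLinear.
Context {R : realType}.
Variables (f : R -> R) (A : set 'rV[R]_2) (X : 'rV[R]_2 -> 'rV[R]_4).
Local Notation g := (rw_metric f).
Local Notation inn x := (ip (f (X x 0 0))).
Local Notation G x k l := (inn x (dv k X x) (dv l X x)).
Hypothesis D_neq0 : forall x, A x -> G x 0 0 * G x 1 1 - G x 0 1 * G x 1 0 != 0.

Lemma tangent_part_lin x p u q v : A x ->
  tangent_part g X x (p *: u + q *: v) = p *: tangent_part g X x u + q *: tangent_part g X x v.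
Proof.
move=> Ax; rewrite !(tangent_partE D_neq0 _ Ax) !ipDl !ipZl.
move: (G x 0 0 * _ - _) => d.
move: (inn x u (dv 0 X x)) (inn x v (dv 0 X x)) (inn x u (dv 1 X x)) (inn x v (dv 1 X x)).
move: (G x 0 0) (G x 0 1) (G x 1 0) (G x 1 1) (dv 0 X x) (dv 1 X x) => g0 g1 g2 g3 X0 X1 a b c e.
by apply/rowP => j; rewrite !rowE_; move: (X0 0 j) (X1 0 j) => *; ring.
Qed.

Lemma normal_part_lin x p u q v : A x ->
  normal_part g X x (p *: u + q *: v) = p *: normal_part g X x u + q *: normal_part g X x v.
Proof.
move=> Ax; rewrite /normal_part (tangent_part_lin _ _ _ _ Ax).
move: (tangent_part _ _ _ u) (tangent_part _ _ _ v) => U V.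
by apply/rowP => j; rewrite !rowE_; move: (u 0 j) (v 0 j) (U 0 j) (V 0 j) => *; ring.
Qed.

Lemma normal_part_dv x k : A x -> normal_part g X x (dv k X x) = 0.
Proof.
move=> Ax; have := D_neq0 Ax; rewrite /normal_part (tangent_partE D_neq0 _ Ax).
rewrite (ipC _ (dv 1 X x) (dv 0 X x)); move: k; apply: ord2P;
  rewrite ?(ipC _ (dv 1 X x) (dv 0 X x));
  move: (G x 0 0) (G x 0 1) (G x 1 1) (dv 0 X x) (dv 1 X x) => g0 g1 g3 X0 X1 d0;
  by apply/rowP => j; rewrite !rowE_; move: (X0 0 j) (X1 0 j) => *; field.
Qed.

Lemma normal_part_normal x v : A x -> (forall l, inn x v (dv l X x) = 0) ->
  normal_part g X x v = v.
Proof. by move=> Ax vn; rewrite /normal_part (tangent_part_eq0 D_neq0 Ax vn) subr0. Qed.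

Lemma trace2_diag x B : A x -> G x 0 1 = 0 -> G x 1 1 = 1 ->
  trace2 g X x B = (G x 0 0)^-1 *: B 0 0 + 1 *: B 1 1.
Proof.
move=> Ax g01 g11; have := D_neq0 Ax; rewrite g01 g11 mul0r mulr1 subr0 => g00.
have ff0 : first_form g X x 0 0 * first_form g X x 1 1
    - first_form g X x 0 1 * first_form g X x 1 0 != 0.
  by rewrite !first_formE g01 g11 mul0r mulr1 subr0.
have [i00 i01 i10 i11] := invmx2 ff0.
rewrite /trace2 !sum2 /first_form_inv i00 i01 i10 i11 !first_formE.
rewrite (ipC _ (dv 1 X x) (dv 0 X x)) g01 g11 mul0r mulr1 subr0 oppr0 !mul0r.
by rewrite !scale0r addr0 add0r mul1r (divff g00).
Qed.

End TangentLinear.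

(* The Gram matrix G = - t t + r r + o o of a Lorentzian coframe. *)
Section Gram.
Context {R : realType}.
Variables t r o : 'I_2 -> R.
Let G k l := - (t k * t l) + r k * r l + o k * o l.

Lemma gram_det : G 0 0 * G 1 1 - G 0 1 * G 1 0 =
  wedge r o ^+ 2 - wedge t r ^+ 2 - wedge t o ^+ 2.
Proof. by rewrite /G /wedge; move: (t 0) (t 1) (r 0) (r 1) (o 0) (o 1) => *; ring. Qed.

(** The left side is the determinant of G times the G-trace of o o. When t and r are proportional it
    equals the determinant, that is, o has norm 1. *)
Lemma gram_adj_o : G 1 1 * (o 0 * o 0) - G 0 1 * (o 0 * o 1) - G 1 0 * (o 1 * o 0)
  + G 0 0 * (o 1 * o 1) = wedge r o ^+ 2 - wedge t o ^+ 2.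
Proof. by rewrite /G /wedge; move: (t 0) (t 1) (r 0) (r 1) (o 0) (o 1) => *; ring. Qed.

Lemma gram_adj_r : G 1 1 * (r 0 * r 0) - G 0 1 * (r 0 * r 1) - G 1 0 * (r 1 * r 0)
  + G 0 0 * (r 1 * r 1) = wedge r o ^+ 2 - wedge t r ^+ 2.
Proof. by rewrite /G /wedge; move: (t 0) (t 1) (r 0) (r 1) (o 0) (o 1) => *; ring. Qed.

End Gram.

(** * Construction of the adapted frame in a chart *)

Section Local.
Context {R : realType}.
Variables (I : set R) (f : R -> R) (H0 : R).
Hypotheses (I_int : open_interval I) (f_smooth : smooth_on1 I f)
  (f_neq0 : forall t, I t -> f t != 0) (H0_neq0 : H0 != 0)
  (f_standing : forall t, I t -> d1 (d1 f) t / f t - (d1 f t / f t) ^+ 2 != 0).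
Variables (A : set 'rV[R]_2) (X e : 'rV[R]_2 -> 'rV[R]_4).
Local Notation g := (rw_metric f).
Local Notation t_ x := (X x 0 0).
Local Notation inn x := (ip (f (t_ x))).
Local Notation G x k l := (inn x (dv k X x) (dv l X x)).
Local Notation D x := (G x 0 0 * G x 1 1 - G x 0 1 * G x 1 0).
Hypotheses (oA : open A) (sX : smooth_on A X) (XI : forall x, A x -> I (t_ x))
  (G_pos : forall x, A x -> forall p q : R, (p != 0) || (q != 0) ->
     0 < p * p * G x 0 0 + 2 * (p * q) * G x 0 1 + q * q * G x 1 1)
  (se : smooth_on A e)
  (e_unit : forall x, A x -> `|inn x (e x) (e x)| = 1)
  (e_normal : forall x k, A x -> inn x (e x) (dv k X x) = 0)
  (HE : forall x, A x -> mean_curv g X x = H0 *: e x)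
  (H_parallel : forall x k, A x -> normal_cov g X k (mean_curv g X) x = 0)
  (bicons : forall x, A x -> tangent_part g X x (bitension g X x) = 0)
  (dt_tangent : forall x, A x -> tangent_part g X x (dt_field R) != 0).

Lemma D_gt0 x : A x -> 0 < D x.
Proof.
(* At (0, 1) the quadratic form gives G11 > 0, and at (G11, - G01) its value is G11 times the
   determinant. *)
move=> Ax; have g1 := G_pos Ax (p := 0) (q := 1); have g2 := G_pos Ax (p := G x 1 1) (q := - G x 0 1).
have : 0 < G x 1 1 by have := g1; rewrite oner_eq0 orbT => /(_ isT); rewrite !mul0r mulr0 !mul0r !add0r !mul1r.
move=> G11; have := g2; rewrite gt_eqF // => /(_ isT).
have -> : G x 1 1 * G x 1 1 * G x 0 0 + 2 * (G x 1 1 * - G x 0 1) * G x 0 1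
   + - G x 0 1 * - G x 0 1 * G x 1 1 = G x 1 1 * D x.
  by rewrite (ipC _ (dv 1 X x) (dv 0 X x)); move: (ip _ _ _) (ip _ _ (dv 1 X x)) (ip _ (dv 1 X x) _) => *; ring.
by rewrite pmulr_rgt0.
Qed.

Let D_neq0 x : A x -> D x != 0.
Proof. by move=> Ax; rewrite gt_eqF // D_gt0. Qed.

Lemma t_neq0 x : A x -> exists k, dv k X x 0 0 != 0.
Proof.
move=> Ax; have [t0|] := eqVneq (dv 0 X x 0 0) 0; last by exists 0.
have [t1|] := eqVneq (dv 1 X x 0 0) 0; last by exists 1.
have /eqP[] := dt_tangent Ax.
apply: (tangent_part_eq0 D_neq0 Ax) => l.
have -> : dt_field R = mk4 1 0.
  apply: eq_row4; rewrite ?mk4_0 ?sp_mk4 /dt_field ?mxE //.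
  by apply/rowP => j; rewrite !mxE.
rewrite ipE mk4_0 sp_mk4 dot0l mulr0 addr0 mul1r.
by apply/eqP; rewrite oppr_eq0; apply/eqP; move: l; apply: ord2P.
Qed.

Let sXk k : smooth_on A (dv k X). Proof. exact: smooth_dv. Qed.
Let ddX k x : A x -> differentiable (dv k X) x. Proof. exact: smooth_on_diff. Qed.
Let de_ x : A x -> differentiable e x. Proof. exact: smooth_on_diff. Qed.

Let cvZ c W k x : A x -> differentiable W x ->
  cv f X k (fun y => c *: W y) x = c *: cv f X k W x.
Proof. by move=> _; exact: cv_scale. Qed.

Let normal_partZ (c : R) v x : A x -> normal_part g X x (c *: v) = c *: normal_part g X x v.
Proof.
by move=> Ax; have := normal_part_lin D_neq0 c v 0 0 Ax; rewrite !scale0r !addr0.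
Qed.

Lemma e_parallel x k : A x -> normal_part g X x (cv f X k e x) = 0.
Proof.
move=> Ax; have := H_parallel k Ax.
rewrite /normal_cov (cov_alongE f_smooth f_neq0 XI) //.
rewrite (cv_eq_on f X oA k HE Ax) cvZ //; last exact: de_.
rewrite normal_partZ // => /eqP; rewrite scaler_eq0 (negPf H0_neq0) /= => /eqP //.
Qed.

Let tau x : 'rV[R]_4 := (2 * H0) *: e x.

Let tauE x : A x -> tension g X x = tau x.
Proof.
by move=> Ax; rewrite (tensionE f_smooth f_neq0 oA sX XI Ax) HE // scalerA.
Qed.

Lemma e_spatial x : A x -> e x 0 0 = 0.
Proof.
move=> Ax; have stau : smooth_on A tau.
  by apply: smooth_Zv => //; exact: smooth_cst.
have tau_n y l : A y -> inn y (tau y) (dv l X y) = 0.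
  by move=> Ay; rewrite ipZl e_normal // mulr0.
have tau_p y k : A y -> normal_part g X y (cv f X k tau y) = 0.
  by move=> Ay; rewrite cvZ //; [rewrite normal_partZ // e_parallel // scaler0|exact: de_].
have [m tm] := t_neq0 Ax.
have := bitension_tangent I_int f_smooth f_neq0 oA sX XI D_neq0 stau tauE tau_n tau_p m Ax.
rewrite -(inner_tangent D_neq0 _ m Ax) bicons // ip0l => /esym/eqP.
rewrite !mulf_eq0 (negPf tm) (negPf (f_standing (XI Ax))) oppr_eq0 pnatr_eq0 /= orbF e0Z.
by rewrite !mulf_eq0 pnatr_eq0 (negPf H0_neq0) /= => /eqP.
Qed.

Let t x := t_ x.
Let F x := f (t x).
Let y_ k x := sp (dv k X x).
Let e4 x := F x *: sp (e x).
(* dt(z) = 0: z spans the spatial projection of the kernel of dt on the tangent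
   plane. *)
Let z x := (- dv 1 X x 0 0) *: y_ 0 x + dv 0 X x 0 0 *: y_ 1 x.
Let zeta x := Num.sqrt (dot (z x) (z x)).
Let e2 x := (zeta x)^-1 *: z x.
Let w x := cross (e2 x) (e4 x).
Let rho k x := F x * dot (w x) (y_ k x).
Let om k x := F x * dot (e2 x) (y_ k x).

Let F0 x : A x -> F x != 0. Proof. by move=> Ax; exact/f_neq0/XI. Qed.

(** f^2 |z|^2 is the first form at the vector (- d_1 t, d_0 t): dt vanishes on it, so its time part
    is zero. *)
Lemma z_gt0 x : A x -> 0 < dot (z x) (z x).
Proof.
move=> Ax; have := G_pos Ax (p := - dv 1 X x 0 0) (q := dv 0 X x 0 0).
have -> : (- dv 1 X x 0 0 != 0) || (dv 0 X x 0 0 != 0).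
  have [k] := t_neq0 Ax; move: k; apply: ord2P => h; first by rewrite h orbT.
  by rewrite oppr_eq0 h.
move=> /(_ isT); rewrite !ipE /z !(dotDl, dotDr, dotZl, dotZr) -/(y_ 0 x) -/(y_ 1 x) -/(F x).
rewrite (dotC (y_ 1 x) (y_ 0 x)).
move: (dot (y_ 0 x) (y_ 0 x)) (dot (y_ 0 x) (y_ 1 x)) (dot (y_ 1 x) (y_ 1 x)) => a b c.
move: (dv 0 X x 0 0) (dv 1 X x 0 0) => t0 t1.
have -> : - t1 * - t1 * (- (t0 * t0) + F x ^+ 2 * a) + 2 * (- t1 * t0) * (- (t0 * t1) + F x ^+ 2 * b)
   + t0 * t0 * (- (t1 * t1) + F x ^+ 2 * c) =
   F x ^+ 2 * (- t1 * (- t1 * a) + - t1 * (t0 * b) + (t0 * (- t1 * b) + t0 * (t0 * c))).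
  by ring.
rewrite pmulr_rgt0 ?exprn_even_gt0 ?F0 // => h.
by have -> : - t1 * (- t1 * a) + t0 * (- t1 * b) + t0 * (- t1 * b + t0 * c) =
  - t1 * (- t1 * a) + - t1 * (t0 * b) + (t0 * (- t1 * b) + t0 * (t0 * c)) by ring.
Qed.

Let zeta0 x : A x -> zeta x != 0.
Proof. by move=> Ax; rewrite gt_eqF // sqrtr_gt0 z_gt0. Qed.

Let sF : smooth_on A (F : _ -> R^o).
Proof. exact: (smooth_f f_smooth oA sX XI). Qed.
Let sy k : smooth_on A (y_ k). Proof. exact: smooth_sp. Qed.
Let st : smooth_on A (t : _ -> R^o). Proof. exact: smooth_e0. Qed.
Let se4 : smooth_on A e4. Proof. by apply: smooth_Zv => //; exact: smooth_sp. Qed.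
Let sz : smooth_on A z.
Proof.
by apply: smooth_D => //; apply: smooth_Zv => //; [apply: smooth_N => //|]; exact: smooth_e0.
Qed.
Let se2 : smooth_on A e2.
Proof.
apply: (smooth_Zv oA _ sz); apply: (smooth_V oA zeta0).
exact: (smooth_sqrt oA z_gt0 (smooth_dot oA sz sz)).
Qed.
Let sw : smooth_on A w. Proof. exact: (smooth_cross oA se2 se4). Qed.
Let srho k : smooth_on A (rho k : _ -> R^o).
Proof. exact: (smooth_M oA sF (smooth_dot oA sw (sy k))). Qed.
Let som k : smooth_on A (om k : _ -> R^o).
Proof. exact: (smooth_M oA sF (smooth_dot oA se2 (sy k))). Qed.

Let e44 x : A x -> dot (e4 x) (e4 x) = 1.
Proof.
move=> Ax; have := e_unit Ax; rewrite ipE e_spatial // mul0r oppr0 add0r -/(t x) -/(F x).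
have -> : F x ^+ 2 * dot (sp (e x)) (sp (e x)) = dot (e4 x) (e4 x).
  by rewrite dotZl dotZr; ring.
by rewrite ger0_norm // dot_ge0.
Qed.

Let spe_y k x : A x -> dot (sp (e x)) (y_ k x) = 0.
Proof.
move=> Ax; have := e_normal k Ax; rewrite ipE e_spatial // mul0r oppr0 add0r => /eqP.
by rewrite mulf_eq0 expf_eq0 /= (negPf (F0 Ax)) => /eqP.
Qed.

Let e4_y k x : A x -> dot (e4 x) (y_ k x) = 0.
Proof. by move=> Ax; rewrite dotZl spe_y // mulr0. Qed.

Let e22 x : A x -> dot (e2 x) (e2 x) = 1.
Proof.
move=> Ax; rewrite dotZl dotZr mulrA -expr2 exprVn sqr_sqrtr ?dot_ge0 // mulVf //.
by rewrite gt_eqF // z_gt0.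
Qed.

Let e24 x : A x -> dot (e2 x) (e4 x) = 0.
Proof.
move=> Ax; rewrite dotZl dotC /z dotDr !dotZr !e4_y // !mulr0 addr0 mulr0 //.
Qed.

Let ww x : A x -> dot (w x) (w x) = 1.
Proof. by move=> Ax; rewrite dot_cross e22 // e44 // e24 // mulr1 expr0n subr0. Qed.
Let we2 x : A x -> dot (w x) (e2 x) = 0. Proof. by move=> _; exact: dot_cross_l. Qed.
Let we4 x : A x -> dot (w x) (e4 x) = 0. Proof. by move=> _; exact: dot_cross_r. Qed.
Let basis x v : A x ->
  v = dot v (w x) *: w x + dot v (e2 x) *: e2 x + dot v (e4 x) *: e4 x.
Proof. by move=> Ax; apply: cross_basis; [exact: e22|exact: e44|exact: e24]. Qed.

Let y_frame k x : A x -> y_ k x = (F x)^-1 *: (rho k x *: w x + om k x *: e2 x).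
Proof.
move=> Ax; rewrite {1}(basis (y_ k x) Ax) (dotC _ (e4 x)) e4_y // scale0r addr0.
rewrite scalerDr !scalerA /rho /om !mulKf ?F0 //.
by rewrite (dotC (y_ k x) (w x)) (dotC (y_ k x) (e2 x)).
Qed.

Let ds_tE k x : A x -> ds k t x = dv k X x 0 0.
Proof. by move=> Ax; rewrite (ds_t sX k Ax). Qed.

Let t_rho x : A x -> wedge (ds^~ t ^~ x) (rho^~ x) = 0.
Proof.
move=> Ax; rewrite /wedge !ds_tE // /rho.
have : dot (w x) (z x) = 0.
  have -> : z x = zeta x *: e2 x by rewrite scalerA mulfV ?zeta0 // scale1r.
  by rewrite dotZr we2 // mulr0.
rewrite dotDr !dotZr.
move: (dv 0 X x 0 0) (dv 1 X x 0 0) (dot _ (y_ 0 x)) (dot _ (y_ 1 x)) => t0 t1 a b h.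
have -> : t0 * (F x * b) - t1 * (F x * a) = F x * (- t1 * a + t0 * b) by ring.
by rewrite h mulr0.
Qed.

Let GE k l x : A x -> G x k l = - (ds k t x * ds l t x) + rho k x * rho l x + om k x * om l x.
Proof.
move=> Ax; rewrite ipE !ds_tE // -addrA; congr (_ + _).
rewrite -/(y_ k x) -/(y_ l x) -/(t x) -/(F x) (y_frame k Ax) (y_frame l Ax).
move: (F0 Ax) (ww Ax) (e22 Ax) (we2 Ax).
move: (F x) (rho k x) (rho l x) (om k x) (om l x) (w x) (e2 x) => F' r1 r2 o1 o2 W E F'0 WW EE WE.
rewrite !(dotZl, dotZr, dotDl, dotDr) (dotC E W) WW EE WE.
by field.
Qed.

Let D_wedge x : A x -> D x = wedge (rho^~ x) (om^~ x) ^+ 2 - wedge (ds^~ t ^~ x) (om^~ x) ^+ 2.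
Proof.
move=> Ax; rewrite !GE // (gram_det (ds^~ t ^~ x) (rho^~ x) (om^~ x)) t_rho //.
by rewrite expr0n subr0.
Qed.

(** By [D_wedge] the positive determinant is the square of this wedge minus another square. *)
Let rho_om x : A x -> wedge (rho^~ x) (om^~ x) != 0.
Proof.
move=> Ax; have := D_gt0 Ax; rewrite D_wedge //; apply: contraTneq => ->.
by rewrite expr0n sub0r oppr_gt0 -leNgt sqr_ge0.
Qed.

Let dv_e4 k x : A x -> dv k e4 x = F x *: sp (cv f X k e x).
Proof.
move=> Ax; have dF := smooth_on_diff sF Ax.
rewrite (dvZ k dF (differentiable_sp (de_ Ax))) (dv_sp k (de_ Ax)).
rewrite (ds_f f_smooth oA sX XI k Ax) /cv spD sp_mk4 e_spatial // scale0r addr0 -/(t x) -/(F x).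
move: (F0 Ax); move: (F x) (d1 f (t x)) (dv k X x 0 0) (sp (e x)) (sp (dv k e x)) => F' F1 tk u v n0.
apply/rowP => j; rewrite !rowE_; move: (u 0 j) (v 0 j) => a b; by field.
Qed.

Let cv_e_0 k x : A x -> cv f X k e x 0 0 = 0.
Proof.
move=> Ax; rewrite /cv e0D mk4_0 (dotC _ (sp (e x))) spe_y // mulr0 addr0.
rewrite (dv_row k 0 (de_ Ax)) (ds_eq_on oA k (G := fun=> 0) _ Ax) ?ds_cst //.
exact: e_spatial.
Qed.

Let psi k x := dot (dv k e4 x) (e2 x).

(** [e] is parallel, so its covariant derivative is tangent; its time component is zero, so it lies
    in the kernel of dt, whose spatial projection is spanned by [z]. *)
Let dv_e4_psi k x : A x -> dv k e4 x = psi k x *: e2 x.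
Proof.
move=> Ax; suff [c ec] : exists c, dv k e4 x = c *: e2 x.
  by rewrite /psi ec dotZl e22 // mulr1.
have ek := normal_partE (e_parallel k Ax).
rewrite (tangent_partE D_neq0 _ Ax) in ek.
move: ek; set c0 := _ / D x; set c1 := _ / D x => ek.
have := cv_e_0 k Ax; rewrite ek e0D !e0Z => ct.
have t0 := t_neq0 Ax.
(* [q] spans the kernel of dt in the tangent plane, and its spatial image is [z]. *)
pose q (i : 'I_2) : R := if i == 0 then - dv 1 X x 0 0 else dv 0 X x 0 0.
pose p (i : 'I_2) : R := if i == 0 then c0 else c1.
have pq : wedge p q = 0 by rewrite /wedge /p /q /=; move: ct; lra.
have q0 : exists i, q i != 0.
  have [i] := t0; move: i; apply: ord2P => h; first by exists 1.
  by exists 0; rewrite /q /= oppr_eq0.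
have pE := wedge0_prop pq q0.
move: (_ / _) pE => m pE.
exists (F x * m * zeta x); rewrite dv_e4 // ek spD !spZ -/(y_ 0 x) -/(y_ 1 x).
have := pE 0; have := pE 1; rewrite /p /q /= => -> ->.
rewrite -(scalerA (F x * m)) [zeta x *: _]scalerA mulfV ?zeta0 // scale1r /z.
move: (y_ 0 x) (y_ 1 x) (dv 0 X x 0 0) (dv 1 X x 0 0) (F x) => u v a b F'.
by apply/rowP => j; rewrite !rowE_; move: (u 0 j) (v 0 j) => *; ring.
Qed.

Let psi_om k l x : A x -> dot (y_ l x) (dv k e4 x) = (F x)^-1 * (psi k x * om l x).
Proof.
move=> Ax; rewrite dv_e4_psi // dotZr (dotC (y_ l x)) /om.
by move: (F0 Ax); move: (F x) (psi k x) (dot _ _) => F' p d n0; field.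
Qed.

(** Differentiating the orthogonality of [e4] and [y_ l] turns [psi k * om l], up to a common
    factor, into a second derivative of the map, which is symmetric. *)
Let psi_sym x : A x -> wedge (psi^~ x) (om^~ x) = 0.
Proof.
move=> Ax.
have E k l : dot (dv k (y_ l) x) (e4 x) + dot (y_ l x) (dv k e4 x) = 0.
  rewrite -(ds_dot k (smooth_on_diff (sy l) Ax) (smooth_on_diff se4 Ax)).
  rewrite (ds_eq_on oA k (G := fun=> 0) _ Ax) ?ds_cst // => v Av.
  by rewrite dotC e4_y.
have ey : dv 0 (y_ 1) x = dv 1 (y_ 0) x.
  by rewrite (dv_sp 0 (ddX 1 Ax)) (dv_sp 1 (ddX 0 Ax)) (dv_schwarz oA 0 1 Ax sX).
have := E 0 1; have := E 1 0; rewrite ey !psi_om // => h1 h2.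
have Fi : (F x)^-1 != 0 by rewrite invr_eq0 F0.
by apply: (mulfI Fi); rewrite mulr0 /wedge; lra.
Qed.

(** 2 H = tr h paired with a normal vector. It is used twice: with [e] it fixes the constant in
    [de4], with [Nv] it yields the equation for the derivative of [T]. *)
Lemma inner_tension v x (b : 'I_2 -> 'I_2 -> R) : A x ->
  (forall l, inn x v (dv l X x) = 0) ->
  (forall k l, inn x (cv f X k (dv l X) x) v = b k l) ->
  2 * H0 * inn x (e x) v * D x =
  G x 1 1 * b 0 0 - G x 0 1 * b 0 1 - G x 1 0 * b 1 0 + G x 0 0 * b 1 1.
Proof.
move=> Ax vn vb; have := tauE Ax.
have Eh k l : inn x (hess_map g X x k l) v = b k l.
  rewrite (hess_mapE f_smooth f_neq0 oA sX XI k l Ax).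
  rewrite (second_formE f_smooth f_neq0 XI k l Ax).
  by rewrite (inner_normal_part D_neq0 _ Ax vn).
move=> /(congr1 (fun u => inn x u v)).
rewrite /tension (inner_trace2 D_neq0 Ax Eh) ipZl => <-.
by rewrite divfK ?D_neq0.
Qed.

Let inn_cv v k l x : A x -> smooth_on A v -> (forall y, A y -> inn y (v y) (dv l X y) = 0) ->
  inn x (cv f X k (dv l X) x) (v x) = - inn x (dv l X x) (cv f X k v x).
Proof.
move=> Ax sv vn; have := cv_compat f_smooth f_neq0 oA sX XI k Ax (ddX l Ax) (smooth_on_diff sv Ax).
rewrite (ds_eq_on oA k (G := fun=> 0) _ Ax) ?ds_cst; last first.
  by move=> u Au; rewrite ipC vn.
by move=> /esym/eqP; rewrite addr_eq0 => /eqP.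
Qed.

(** By [psi_sym] the form psi is c om. The second form in direction [e] is then - c om om, whose
    trace is - c by [gram_adj_o]; it must be 2 H0. *)
Let de4 x k : A x -> dv k e4 x = (- (2 * H0) * om k x) *: e2 x.
Proof.
move=> Ax; have om0 := om_neq0 rho_om Ax.
have pE := wedge0_prop (psi_sym Ax) om0.
move: (_ / _) pE => c pE.
have eb i l : inn x (cv f X i (dv l X) x) (e x) = - (c * (om i x * om l x)).
  rewrite inn_cv //; last by move=> u Au; exact: e_normal.
  rewrite ipE cv_e_0 // mulr0 oppr0 add0r -/(t x) -/(F x) -/(y_ l x).
  have := psi_om i l Ax; rewrite dv_e4 // dotZr pE.
  move: (F0 Ax); move: (F x) (dot _ _) (om i x) (om l x) => F' d o1 o2 n0 h.
  have -> : F' ^+ 2 * d = F' * (F' * d) by ring.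
  by rewrite h; field.
have e1 : inn x (e x) (e x) = 1.
  have := e44 Ax; rewrite ipE e_spatial // mul0r oppr0 add0r dotZl dotZr -/(t x) -/(F x).
  by move=> <-; ring.
have := inner_tension Ax (fun l => e_normal l Ax) eb.
rewrite e1 mulr1 D_wedge // !GE // => h.
have := gram_adj_o (ds^~ t ^~ x) (rho^~ x) (om^~ x).
have n0 : D x != 0 by exact: D_neq0.
rewrite D_wedge // in n0; move: n0 h.
set W := _ - _ => n0 h h2.
have : (2 * H0 + c) * W = 0.
  rewrite mulrDl h -h2.
  set g00 := - _ + _ + _; set g01 := - _ + _ + _; set g10 := - _ + _ + _; set g11 := - _ + _ + _.
  by move: (om 0 x) (om 1 x) g00 g01 g10 g11 => *; ring.
move=> /eqP; rewrite mulf_eq0 (negPf n0) orbF addr_eq0 => /eqP ec.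
by rewrite dv_e4_psi // pE ec; congr (_ *: _); ring.
Qed.

Let Y x := sp (X x).
Let sY : smooth_on A Y. Proof. exact: smooth_sp. Qed.
Let tI x : A x -> I (t x). Proof. exact: XI. Qed.

Let dY x k : A x -> dv k Y x = (f (t x))^-1 *: (rho k x *: w x + om k x *: e2 x).
Proof.
by move=> Ax; rewrite (dv_sp k (smooth_on_diff sX Ax)) -(y_frame k Ax).
Qed.

Let b := frame_b w e2 om.
Let T := frame_tau t rho.
Let q x := d1 f (t x) / F x.
Let kappa x := d1 (d1 f) (t x) / f (t x) - (d1 f (t x) / f (t x)) ^+ 2.

Let bE x : A x -> b x = T x * q x.
Proof.
exact: (frame_bE oA f_smooth f_neq0 H0_neq0 tI st sY sw se2 se4 srho som
  ww e22 e44 we2 we4 e24 basis dY de4 t_rho rho_om).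
Qed.

Let db k x : A x -> ds k b x = 0.
Proof.
exact: (frame_db oA f_smooth f_neq0 H0_neq0 tI st sY sw se2 se4 srho som
  ww e22 e44 we2 we4 e24 basis dY de4 t_rho rho_om).
Qed.

Let dbE k x : A x -> ds k b x = ds k T x * q x + T x * (kappa x * ds k t x).
Proof.
exact: (ds_frame_b oA f_smooth f_neq0 H0_neq0 tI st sY sw se2 se4 srho som
  ww e22 e44 we2 we4 e24 basis dY de4 t_rho rho_om).
Qed.

Let dT x : A x -> wedge (ds^~ T ^~ x) (rho^~ x) = 0.
Proof.
exact: (frame_dtau oA f_smooth f_neq0 H0_neq0 tI st sY sw se2 se4 srho som
  ww e22 e44 we2 we4 e24 basis dY de4 t_rho rho_om).
Qed.

Let dt_T k x : A x -> ds k t x = - (T x * rho k x).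
Proof. exact: (ds_t_tau t_rho rho_om). Qed.

Let sT : smooth_on A (T : _ -> R^o).
Proof. exact: (smooth_frame_tau oA st srho rho_om). Qed.

Let dw k x : A x -> dv k w x = (b x * om k x) *: e2 x.
Proof. exact: (dv_w oA H0_neq0 sw se2 se4 som ww e22 e44 we2 we4 e24 basis de4 rho_om). Qed.

Let de2 k x : A x -> dv k e2 x = (- om k x) *: (b x *: w x - (2 * H0) *: e4 x).
Proof. exact: (dv_e2 oA H0_neq0 sw se2 se4 som ww e22 e44 we2 we4 e24 basis de4 rho_om). Qed.

(* The normal field orthogonal to H: <tr h, Nv> = 0 is the equation for f. *)
Let c x := - (T x / F x).
Let Nv x : 'rV[R]_4 := mk4 1 (c x *: w x).

Let sc : smooth_on A (c : _ -> R^o).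
Proof. exact: (smooth_N oA (smooth_M oA sT (smooth_V oA F0 sF))). Qed.

Let sN : smooth_on A Nv.
Proof. by apply: (smooth_mk4 oA _ (smooth_Zv oA sc sw)); exact: smooth_cst. Qed.

Let N_normal x l : A x -> inn x (Nv x) (dv l X x) = 0.
Proof.
move=> Ax; rewrite ipE mk4_0 sp_mk4 dotZl -/(y_ l x) -/(t x) -/(F x) -(ds_tE l Ax) dt_T // /rho /c.
move: (F0 Ax); move: (F x) (T x) (dot _ _) => F' T' d n0; by field.
Qed.

Let N_e x : A x -> inn x (e x) (Nv x) = 0.
Proof.
move=> Ax; rewrite ipE e_spatial // sp_mk4 dotZr mul0r oppr0 add0r.
have : dot (w x) (e4 x) = 0 by exact: we4.
rewrite dotZr => /eqP; rewrite mulf_eq0 (negPf (F0 Ax)) /= => /eqP h.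
by rewrite dotC h !mulr0.
Qed.

Let dot_yw k x : A x -> dot (y_ k x) (w x) = rho k x / F x.
Proof. by move=> Ax; rewrite dotC /rho mulrAC divff ?mul1r // F0. Qed.
Let dot_ye2 k x : A x -> dot (y_ k x) (e2 x) = om k x / F x.
Proof. by move=> Ax; rewrite dotC /om mulrAC divff ?mul1r // F0. Qed.
Let dot_yy k l x : A x -> dot (y_ k x) (y_ l x) = (rho k x * rho l x + om k x * om l x) / F x ^+ 2.
Proof.
move=> Ax; have := GE k l Ax; rewrite ipE !ds_tE // -/(y_ k x) -/(y_ l x) -/(t x) -/(F x).
move=> h; have n0 := F0 Ax; apply: (mulfI (x := F x ^+ 2)); first by rewrite expf_neq0.
rewrite [RHS]mulrC divfK ?expf_neq0 //.
by move: h; set u := F x ^+ 2 * _; lra.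
Qed.

Let dc k x : A x -> ds k c x = - (ds k T x / F x) + T x * d1 f (t x) * ds k t x / F x ^+ 2.
Proof.
move=> Ax; have sV := smooth_V oA F0 sF.
rewrite (dsN k (smooth_on_diff (smooth_M oA sT sV) Ax)).
rewrite (dsM k (smooth_on_diff sT Ax) (smooth_on_diff sV Ax)).
rewrite (dsV k (F0 Ax) (smooth_on_diff sF Ax)) (ds_f f_smooth oA sX XI k Ax) -ds_tE //.
move: (F0 Ax); rewrite -/(t x).
by move: (F x) (T x) (d1 f (t x)) (ds k t x) (ds k T x) => F' T' d u v n0; field.
Qed.

(** Minus the second form in direction [Nv]. The relations b = T q and dt = - T rho bring the
    coefficients of rho rho and om om to the same value q (1 - T^2). *)
Let cvN k l x : A x -> inn x (dv l X x) (cv f X k Nv x) =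
  q x * (1 - T x ^+ 2) * (rho k x * rho l x) + q x * (1 - T x ^+ 2) * (om k x * om l x)
  - ds k T x * rho l x.
Proof.
move=> Ax; have dN := smooth_on_diff sN Ax.
have dN0 : dv k Nv x 0 0 = 0.
  rewrite (dv_row k 0 dN) (ds_eq_on oA k (G := fun=> 1) _ Ax) ?ds_cst // => y _.
  exact: mk4_0.
have dNs : sp (dv k Nv x) = ds k c x *: w x + c x *: ((b x * om k x) *: e2 x).
  rewrite -(dv_sp k dN) (dv_eq_on oA k (G := fun y => c y *: w y) _ Ax); last first.
    by move=> y _; exact: sp_mk4.
  by rewrite (dvZ k (smooth_on_diff sc Ax) (smooth_on_diff sw Ax)) dw.
rewrite ipE /cv e0D spD dN0 dNs mk4_0 sp_mk4 -/(t x) -/(F x) -/(y_ l x) -/(y_ k x).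
rewrite /gm !mk4_0 !sp_mk4 -!ds_tE // bE // dc // !dt_T // -/(y_ k x) /c /q.
move: (F0 Ax) (dot_yw k Ax) (dot_yw l Ax) (dot_ye2 l Ax) (dot_yy l k Ax).
move: (F x) (d1 f (t x)) (ds k T x) (T x) (rho k x) (rho l x) (om k x) (om l x).
move: (y_ k x) (y_ l x) (w x) (e2 x).
move=> yk yl W E F' F1 Tk T' rk rl ok ol n0 h1 h2 h3 h4.
rewrite !(dotDr, dotZr) h1 h2 h3 h4; by field.
Qed.

Let T_lt x : A x -> T x ^+ 2 < 1.
Proof.
move=> Ax; have := D_gt0 Ax; rewrite D_wedge //.
have -> : wedge (ds^~ t ^~ x) (om^~ x) = - T x * wedge (rho^~ x) (om^~ x).
  by rewrite /wedge !dt_T //; move: (T x) (rho _ x) (rho _ x) (om _ x) (om _ x) => *; ring.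
have : 0 < wedge (rho^~ x) (om^~ x) ^+ 2 by rewrite exprn_even_gt0 //= rho_om.
move: (wedge _ _) => W W0.
have -> : W ^+ 2 - (- T x * W) ^+ 2 = W ^+ 2 * (1 - T x ^+ 2) by ring.
by rewrite pmulr_rgt0 // subr_gt0.
Qed.

Let T_kappa x : A x -> q x ^+ 2 * (1 - T x ^+ 2) * (2 - T x ^+ 2) = T x ^+ 2 * kappa x.
Proof.
move=> Ax; have [m rm] := rho_neq0 rho_om Ax.
have TS := wedge0_prop (dT Ax) (rho_neq0 rho_om Ax).
move: (_ / _) TS => S TS.
have tr : wedge (ds^~ t ^~ x) (rho^~ x) = 0 by exact: t_rho.
have to : wedge (ds^~ t ^~ x) (om^~ x) = - T x * wedge (rho^~ x) (om^~ x).
  by rewrite /wedge !dt_T //; move: (T x) (rho _ x) (rho _ x) (om _ x) (om _ x) => *; ring.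
have eb k l : inn x (cv f X k (dv l X) x) (Nv x) =
    (S - q x * (1 - T x ^+ 2)) * (rho k x * rho l x) - q x * (1 - T x ^+ 2) * (om k x * om l x).
  rewrite inn_cv //; last by move=> u Au; exact: N_normal.
  by rewrite cvN // TS; move: (q x) (T x) (rho _ x) (rho _ x) (om _ x) (om _ x) => *; ring.
have := inner_tension Ax (fun l => N_normal l Ax) eb.
rewrite N_e // mulr0 mul0r !GE //.
have := gram_adj_o (ds^~ t ^~ x) (rho^~ x) (om^~ x).
have := gram_adj_r (ds^~ t ^~ x) (rho^~ x) (om^~ x).
rewrite tr to expr0n subr0.
set g00 := - _ + _ + _; set g01 := - _ + _ + _; set g10 := - _ + _ + _; set g11 := - _ + _ + _.
have W0 := rho_om Ax.
move: (wedge _ _) W0 g00 g01 g10 g11 => W W0 g00 g01 g10 g11 hr ho h.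
(* [S] is the factor in dT = S rho. Multiplied by the determinant, the traces of rho rho and om om
   are W^2 and W^2 (1 - T^2); the trace of the second form in direction [Nv] vanishes, as [Nv] is
   orthogonal to [e]. *)
have hS : (S - q x * (1 - T x ^+ 2) - q x * (1 - T x ^+ 2) * (1 - T x ^+ 2)) * W ^+ 2 = 0.
  have -> : (S - q x * (1 - T x ^+ 2) - q x * (1 - T x ^+ 2) * (1 - T x ^+ 2)) * W ^+ 2
    = (S - q x * (1 - T x ^+ 2)) * W ^+ 2
      - q x * (1 - T x ^+ 2) * (W ^+ 2 - (- T x * W) ^+ 2) by ring.
  rewrite -ho -hr [RHS]h.
  by move: (q x) (T x) (rho _ x) (rho _ x) (om _ x) (om _ x) => *; ring.
move/eqP: hS; rewrite mulf_eq0 expf_eq0 /= (negPf W0) orbF => /eqP hS.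
have := dbE m Ax; rewrite db // dt_T // TS => h2.
apply: (mulIf rm); move: hS h2; move: (rho m x) (q x) (T x) (kappa x) => r Q T' K hS h2.
have -> : T' ^+ 2 * K * r = S * Q * r.
  apply/eqP; rewrite -subr_eq0; apply/eqP.
  have -> : T' ^+ 2 * K * r - S * Q * r = - (S * r * Q + T' * (K * - (T' * r))) by ring.
  by rewrite -h2 oppr0.
have -> : S = Q * (1 - T' ^+ 2) * (2 - T' ^+ 2).
  by apply/eqP; rewrite -subr_eq0; apply/eqP; rewrite -hS; ring.
by ring.
Qed.

Let T_neq0 x : A x -> T x != 0.
Proof.
move=> Ax; have [k] := t_neq0 Ax; apply: contraNneq => T0.
by rewrite -(ds_tE k Ax) dt_T // T0 mul0r oppr0.
Qed.

(** A zero of f' would give T^2 kappa = 0 in [T_kappa], against the standing assumption and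
    [T_neq0]. *)
Let q_neq0 x : A x -> q x != 0.
Proof.
move=> Ax; have := T_kappa Ax; apply: contra_eqN => /eqP ->.
rewrite expr0n !mul0r eq_sym mulf_neq0 ?expf_neq0 ?T_neq0 //.
exact/f_standing/XI.
Qed.

Let b_neq0 x : A x -> b x != 0.
Proof. by move=> Ax; rewrite bE // mulf_neq0 ?T_neq0 ?q_neq0. Qed.

Definition local_frame : adapted_frame f H0 A X.
Proof.
refine (@AdaptedFrame _ f H0 A X w e2 e4 om b sw se2 se4 (smooth_frame_b oA sw se2 som rho_om)
  ww e22 e44 we2 we4 e24 dw de2 (fun k x => @de4 x k) b_neq0 db _ _ _ _).
- move=> k x Ax; rewrite dY // [LHS]scalerDr -(ds_tE k Ax) dt_T // bE //.
  congr (_ + _); rewrite [LHS]scalerA; congr (_ *: _); last by rewrite mulrC.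
  have := q_neq0 Ax; rewrite /q mulf_eq0 negb_or => /andP[d0 _].
  move: (F0 Ax) d0 (T_neq0 Ax); rewrite -/(t x) -/(F x).
  by move: (F x) (d1 f (t x)) (rho k x) (T x) => F' F1 r T' n0 n1 n2; field; rewrite n0 n1 n2.
- move=> x Ax.
  have -> : wedge (fun k => dv k X x 0 0) (om^~ x) = - T x * wedge (rho^~ x) (om^~ x).
    rewrite /wedge -!ds_tE // !dt_T //.
    by move: (T x) (rho _ x) (rho _ x) (om _ x) (om _ x) => *; ring.
  apply: mulf_neq0; last exact: rho_om.
  by rewrite oppr_eq0 T_neq0.
- move=> x Ax; have := T_kappa Ax; rewrite bE // /q /kappa -/(t x) -/(F x).
  move: (F0 Ax); move: (F x) (d1 f (t x)) (d1 (d1 f) (t x)) (T x) => F' F1 F2 T' n0 h.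
  (* In these variables b = T Q, and the left side of the differential equation is F^4 Q^2 times the
     difference of the two sides of [T_kappa]. *)
  pose Q := F1 / F'; pose K := F2 / F' - Q ^+ 2.
  have eF1 : F1 = Q * F' by rewrite divfK.
  have eF2 : F2 = K * F' + Q ^+ 2 * F' by rewrite mulrBl divfK // subrK.
  rewrite -/Q -/K in h *; move: Q K eF1 eF2 h => Q K -> -> h.
  have -> : (T' * Q) ^+ 2 * F' ^+ 3 * (K * F' + Q ^+ 2 * F')
     - ((Q * F') ^+ 2 - (T' * Q) ^+ 2 * F' ^+ 2) ^+ 2 - (Q * F') ^+ 4 =
     F' ^+ 4 * Q ^+ 2 * (T' ^+ 2 * K - Q ^+ 2 * (1 - T' ^+ 2) * (2 - T' ^+ 2)) by ring.
  by rewrite h subrr mulr0.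
move=> x Ax; rewrite bE // /q -/(t x) -/(F x).
have := q_neq0 Ax; rewrite /q mulf_eq0 negb_or => /andP[d0 _].
rewrite exprMn -mulrA -exprMn divfK ?F0 //.
by rewrite gtr_pMl ?T_lt // exprn_even_gt0.
Defined.

End Local.

(** * The equation for the warping function *)

Section SurfaceFrame.
Context {R : realType}.
Variables (I : set R) (f : R -> R) (H0 : R).
Hypotheses (I_int : open_interval I) (f_smooth : smooth_on1 I f)
  (f_neq0 : forall t, I t -> f t != 0) (H0_neq0 : H0 != 0)
  (f_standing : forall t, I t ->
     derive1n 2 f t / f t - derive1 f t ^+ 2 / f t ^+ 2 != 0).
Variables (M : surface R) (phi : M -> 'rV[R]_4).
Local Notation g := (rw_metric f).

Lemma inner2E (h : 'rV[R]_2 -> 'M[R]_2) x v : inner h x v v =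
  v 0 0 * v 0 0 * h x 0 0 + v 0 0 * v 0 1 * h x 0 1
  + (v 0 0 * v 0 1 * h x 1 0 + v 0 1 * v 0 1 * h x 1 1).
Proof.
rewrite /inner mxE sum2 !mxE !sum2.
by move: (h x 0 0) (h x 0 1) (h x 1 0) (h x 1 1) (v 0 0) (v 0 1) => *; ring.
Qed.

Lemma surface_frame (i : cidx M) : bicons_pmcv_surface I f phi H0 ->
  inhabited (adapted_frame f H0 (crange i) (phi \o param i)).
Proof.
case=> -[sphi phiI pos] dtn par bic [e4 se4 he4].
have oA : open (crange i) by exact: crange_open.
set X := phi \o param i.
have G_pos x : crange i x -> forall p q : R, (p != 0) || (q != 0) ->
    0 < p * p * ip (f (X x 0 0)) (dv 0 X x) (dv 0 X x)
      + 2 * (p * q) * ip (f (X x 0 0)) (dv 0 X x) (dv 1 X x)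
      + q * q * ip (f (X x 0 0)) (dv 1 X x) (dv 1 X x).
  move=> Ax p q pq; have := pos i x Ax (\row_j if j == 0 then p else q).
  rewrite inner2E !first_formE !mxE /= (ipC _ (dv 1 _ x) (dv 0 _ x)).
  have -> : (\row_j (if j == 0 then p else q) : 'rV[R]_2) != 0.
    apply: contraTneq pq => v0; have := congr1 (fun v : 'rV_2 => v 0 0) v0.
    have := congr1 (fun v : 'rV_2 => v 0 1) v0; rewrite !mxE /= => -> ->.
    by rewrite eqxx.
  move=> /(_ isT); congr (0 < _); rewrite -/X.
  by move: (ip _ _ _) (ip _ (dv 0 X x) _) (ip _ _ _) => *; ring.
have D0 x : crange i x -> _ := fun Ax => lt0r_neq0 (D_gt0 G_pos Ax).
constructor; apply: (@local_frame R I f H0 I_int f_smooth f_neq0 H0_neq0 _ _ X (e4 \o param i) oA).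
- by move=> t It; rewrite d1d1E d1E expr_div_n; exact: f_standing.
- exact: sphi.
- by move=> x _; exact: phiI.
- exact: G_pos.
- exact: se4.
- by move=> x Ax; have [h _ _] := he4 i x Ax; rewrite -inner_ip.
- move=> x k Ax; have [_ h _] := he4 i x Ax.
  by rewrite -(inner_tangent D0 _ k Ax) h ip0l.
- by move=> x Ax; have [_ _ h] := he4 i x Ax.
- by move=> x k Ax; exact: par.
- by move=> x Ax; exact: bic.
by move=> x Ax; exact: dtn.
Qed.

End SurfaceFrame.

Section OdeRoots.
Context {R : realType}.

(* The equation is quadratic in beta = a^2 - 4 H0^2; this is Vieta's formula. *)
Lemma ode_roots_product (F F1 F2 b1 b2 : R) : F != 0 -> b1 != b2 ->
  b1 * F ^+ 3 * F2 - (F1 ^+ 2 - b1 * F ^+ 2) ^+ 2 - F1 ^+ 4 = 0 ->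
  b2 * F ^+ 3 * F2 - (F1 ^+ 2 - b2 * F ^+ 2) ^+ 2 - F1 ^+ 4 = 0 ->
  b1 * b2 * F ^+ 4 = 2 * F1 ^+ 4.
Proof.
move=> F0 b12 e1 e2; apply: (mulfI (x := b2 - b1)); first by rewrite subr_eq0 eq_sym.
apply/eqP; rewrite -subr_eq0; apply/eqP.
have -> : (b2 - b1) * (b1 * b2 * F ^+ 4) - (b2 - b1) * (2 * F1 ^+ 4) =
  b2 * (b1 * F ^+ 3 * F2 - (F1 ^+ 2 - b1 * F ^+ 2) ^+ 2 - F1 ^+ 4)
  - b1 * (b2 * F ^+ 3 * F2 - (F1 ^+ 2 - b2 * F ^+ 2) ^+ 2 - F1 ^+ 4) by ring.
by rewrite e1 e2 !mulr0 subrr.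
Qed.

(** Two different roots would have the product 2 (f'/f)^4, whereas both are smaller than
    (f'/f)^2. *)
Lemma ode_root_unique (F F1 F2 b1 b2 : R) : F != 0 -> 0 < b1 -> 0 < b2 ->
  b1 * F ^+ 2 < F1 ^+ 2 -> b2 * F ^+ 2 < F1 ^+ 2 ->
  b1 * F ^+ 3 * F2 - (F1 ^+ 2 - b1 * F ^+ 2) ^+ 2 - F1 ^+ 4 = 0 ->
  b2 * F ^+ 3 * F2 - (F1 ^+ 2 - b2 * F ^+ 2) ^+ 2 - F1 ^+ 4 = 0 -> b1 = b2.
Proof.
move=> F0 b1p b2p l1 l2 e1 e2; apply/eqP/negPn/negP => b12.
have e := ode_roots_product F0 b12 e1 e2.
have Fp : 0 < F ^+ 2 by rewrite exprn_even_gt0.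
have : b1 * F ^+ 2 * (b2 * F ^+ 2) < F1 ^+ 2 * F1 ^+ 2.
  by rewrite ltr_pM // mulr_ge0 // ltW.
have -> : b1 * F ^+ 2 * (b2 * F ^+ 2) = b1 * b2 * F ^+ 4 by ring.
rewrite e; have := sqr_ge0 (F1 ^+ 2).
have -> : F1 ^+ 4 = F1 ^+ 2 * F1 ^+ 2 by ring.
by rewrite expr2; set u := _ * _; lra.
Qed.

End OdeRoots.

Section FrameFacts.
Context {R : realType}.
Variables (I : set R) (f : R -> R) (H0 : R).
Hypotheses (f_smooth : smooth_on1 I f) (f_neq0 : forall t, I t -> f t != 0)
  (f_standing : forall t, I t -> d1 (d1 f) t / f t - (d1 f t / f t) ^+ 2 != 0).
Variables (A : set 'rV[R]_2) (X : 'rV[R]_2 -> 'rV[R]_4).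
Hypotheses (oA : open A) (sX : smooth_on A X) (XI : forall x, A x -> I (X x 0 0)).
Variable fr : adapted_frame f H0 A X.

Lemma open_ball_sub x0 : A x0 -> exists2 r : R, 0 < r & ball x0 r `<=` A.
Proof.
move=> Ax; have /nbhs_ballP[r r0 h] : nbhs x0 A by exact: open_nbhs_nbhs.
by exists r.
Qed.

Lemma frame_b_const x0 r : ball x0 r `<=` A -> forall y, ball x0 r y -> af_b fr y = af_b fr x0.
Proof.
move=> rA; apply: (@const_on_ball _ _ (af_b fr : _ -> R^o)).
  by move=> y /rA Ay; exact: (smooth_on_diff (af_sb fr)).
by move=> k y /rA Ay; have := af_db fr k Ay; rewrite dsE.
Qed.

(** In the congruence statement [a] is given by the differential equation alone, without the
    space-like inequality, so [ode_root_unique] does not apply. Instead, a second constant root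
    makes q = f'/f constant along a ball, while t is not constant there and dq is [kappa] times
    dt. *)
Lemma frame_beta_unique x0 beta : A x0 ->
  (forall x, A x -> beta * f (X x 0 0) ^+ 3 * d1 (d1 f) (X x 0 0)
     - (d1 f (X x 0 0) ^+ 2 - beta * f (X x 0 0) ^+ 2) ^+ 2 - d1 f (X x 0 0) ^+ 4 = 0) ->
  beta = af_b fr x0 ^+ 2.
Proof.
move=> Ax0 ode; apply/eqP/negPn/negP => ne.
have [r r0 rA] := open_ball_sub Ax0.
pose q x := d1 f (X x 0 0) / f (X x 0 0).
have E x : ball x0 r x -> q x ^+ 4 = beta * af_b fr x0 ^+ 2 / 2.
  move=> bx; have Ax := rA _ bx; have F0 := f_neq0 (XI Ax).
  have := ode_roots_product F0 _ (ode x Ax) (af_ode fr Ax).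
  rewrite (frame_b_const rA bx) => /(_ ne) e.
  rewrite /q expr_div_n; apply: (mulIf (x := 2 * f (X x 0 0) ^+ 4)).
    by rewrite mulf_neq0 ?pnatr_eq0 ?expf_neq0.
  move: F0 e; move: (f _) (d1 f _) (af_b fr x0) => F F1 b F0 e.
  have -> : F1 ^+ 4 / F ^+ 4 * (2 * F ^+ 4) = 2 * F1 ^+ 4 by field.
  by rewrite -e; field.
have oB : open (ball x0 r) by exact: ball_open.
have sXB : smooth_on (ball x0 r) X by exact: smooth_on_sub sX.
have XIB x : ball x0 r x -> I (X x 0 0) by move=> /rA; exact: XI.
have sF : smooth_on (ball x0 r) (fun x => f (X x 0 0) : R^o) by exact: (smooth_f f_smooth oB sXB XIB).
have sF1 : smooth_on (ball x0 r) (fun x => d1 f (X x 0 0) : R^o) by exact: (smooth_d1f f_smooth oB sXB XIB).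
have F0 x : ball x0 r x -> f (X x 0 0) != 0 by move=> /XIB; exact: f_neq0.
have sV := smooth_V oB F0 sF.
have sq : smooth_on (ball x0 r) (q : _ -> R^o) by exact: (smooth_M oB sF1 sV).
have bx0 : ball x0 r x0 by exact: ballxx.
have sq2 : smooth_on (ball x0 r) (fun x => q x * q x : R^o) by exact: (smooth_M oB sq sq).
have dq k : ds k q x0 =
    (d1 (d1 f) (X x0 0 0) / f (X x0 0 0) - q x0 ^+ 2) * dv k X x0 0 0.
  rewrite (dsM k (smooth_on_diff sF1 bx0) (smooth_on_diff sV bx0)).
  rewrite (dsV k (F0 _ bx0) (smooth_on_diff sF bx0)).
  rewrite (ds_d1f f_smooth oB sXB XIB k bx0) (ds_f f_smooth oB sXB XIB k bx0) /q.
  move: (F0 _ bx0); move: (f _) (d1 f _) (d1 (d1 f) _) (dv k X x0 0 0) => F F1 F2 tk n0.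
  by field.
(* Derivative of the constant function q^4, written with products only. *)
have dq4 k : 4 * q x0 ^+ 3 * ds k q x0 = 0.
  have E4 y : ball x0 r y -> q y * q y * (q y * q y) = beta * af_b fr x0 ^+ 2 / 2.
    by move=> by_; rewrite -(E y by_); move: (q y) => u; ring.
  have := ds_eq_on oB k (F := fun x => q x * q x * (q x * q x)) (G := fun=> _) E4 bx0.
  rewrite ds_cst.
  have /= -> := dsM k (smooth_on_diff sq2 bx0) (smooth_on_diff sq2 bx0).
  rewrite (dsM k (smooth_on_diff sq bx0) (smooth_on_diff sq bx0)) => <-.
  by move: (q x0) (ds k q x0) => u v; ring.
have q0 : q x0 != 0.
  have := af_lt fr Ax0; rewrite mulf_eq0 invr_eq0 (negPf (F0 _ bx0)) orbF.
  by apply: contraTneq => ->; rewrite expr0n -leNgt -exprMn sqr_ge0.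
have K0 := f_standing (XI Ax0).
have t0 k : dv k X x0 0 0 = 0.
  have : 4 * q x0 ^+ 3 * (d1 (d1 f) (X x0 0 0) / f (X x0 0 0) - q x0 ^+ 2) != 0.
    by apply: mulf_neq0 => //; apply: mulf_neq0; [rewrite pnatr_eq0|rewrite expf_neq0].
  by move=> n0; apply: (mulfI n0); rewrite mulr0 -[RHS](dq4 k) dq mulrA.
by have := af_t_om fr Ax0; rewrite /wedge !t0 !mul0r subrr eqxx.
Qed.

End FrameFacts.

Section Forward.
Context {R : realType}.
Variables (I : set R) (f : R -> R) (H0 : R).
Hypotheses (I_int : open_interval I) (f_smooth : smooth_on1 I f)
  (f_neq0 : forall t, I t -> f t != 0) (H0_neq0 : H0 != 0)
  (f_standing : forall t, I t ->
     derive1n 2 f t / f t - derive1 f t ^+ 2 / f t ^+ 2 != 0).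
Variables (M : surface R) (phi : M -> 'rV[R]_4) (J : set R).
Hypotheses (bic : bicons_pmcv_surface I f phi H0) (rng : time_range phi = J).

(** A condition that involves the surface only through the value of t, hence can be compared between
    charts. *)
Definition is_beta (beta t : R) : Prop :=
  [/\ 0 < beta, beta * f t ^+ 2 < d1 f t ^+ 2 &
  beta * f t ^+ 3 * d1 (d1 f) t - (d1 f t ^+ 2 - beta * f t ^+ 2) ^+ 2 - d1 f t ^+ 4 = 0].

Lemma chart_beta (i : cidx M) (fr : adapted_frame f H0 (crange i) (phi \o param i)) p :
  cdom i p -> is_beta (af_b fr (chart i p) ^+ 2) (phi p 0 0).
Proof.
move=> ip; have Ax : crange i (chart i p) by exists p.
have eX : (phi \o param i) (chart i p) = phi p by rewrite /= chartK.
split; first by rewrite exprn_even_gt0 //= (af_b_neq0 fr Ax).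
  by have := af_lt fr Ax; rewrite eX.
by have := af_ode fr Ax; rewrite eX.
Qed.

Lemma beta_unique p b1 b2 : is_beta b1 (phi p 0 0) -> is_beta b2 (phi p 0 0) -> b1 = b2.
Proof.
move=> [p1 l1 e1] [p2 l2 e2]; apply: (ode_root_unique _ p1 p2 l1 l2 e1 e2).
by apply: f_neq0; case: bic => -[_ h _] _ _ _ _; exact: h.
Qed.

(** At [p] the root is b^2 of a frame by [beta_unique], and b is constant on a ball of the chart. *)
Lemma beta_locally_constant p beta : is_beta beta (phi p 0 0) ->
  \forall q \near p, is_beta beta (phi q 0 0).
Proof.
move=> pb; have [i ip] := cdom_cover p.
have [fr] := surface_frame I_int f_smooth f_neq0 H0_neq0 f_standing i bic.
have Ax : crange i (chart i p) by exists p.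
have [r r0 rA] := open_ball_sub (@crange_open _ _ i) Ax.
have := chart_continuous ip; move=> /(_ (ball (chart i p) r) (nbhsx_ballx _ _ r0)) near_ball.
have near_dom : nbhs p (cdom i) by apply: open_nbhs_nbhs; split => //; exact: cdom_open.
near=> q.
have iq : cdom i q by near: q.
have bq : ball (chart i p) r (chart i q) by near: q.
rewrite (beta_unique pb (chart_beta fr ip)) -(frame_b_const fr rA bq).
exact: chart_beta.
Unshelve. all: by end_near.
Qed.

Lemma beta_exists p : exists beta, is_beta beta (phi p 0 0).
Proof.
have [i ip] := cdom_cover p.
have [fr] := surface_frame I_int f_smooth f_neq0 H0_neq0 f_standing i bic.
by eexists; exact: (chart_beta fr ip).
Qed.

Lemma ode_of_surface : exists a : R,
  [/\ 0 < a ^+ 2 - 4 * H0 ^+ 2, rw_ode f H0 a J & rot_spacelike f H0 a J].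
Proof.
have [p0 _] := surface_nonempty M; have [beta bp0] := beta_exists p0.
(* This set is closed too: at a point outside it some other root holds, and that root also holds
   nearby, which excludes beta there by uniqueness. *)
pose B := [set p : M | is_beta beta (phi p 0 0)].
have opB : open B by rewrite openE => p Bp; exact: beta_locally_constant.
have clB : closed B.
  rewrite -openC openE => p nB; have [b2 bp] := beta_exists p.
  have := beta_locally_constant bp; apply: filterS => q bq Bq; apply: nB.
  by rewrite /B /= (beta_unique Bq bq).
have BT : B = setT.
  by apply: (surface_connected (s := M)); [exists p0|exists B; rewrite ?setTI|exists B; rewrite ?setTI].
have HJ t : J t -> is_beta beta t.
  by rewrite -rng => -[p _ <-]; have : setT p by []; rewrite -BT.
have [b0 _ _] := bp0.
have aE : Num.sqrt (beta + 4 * H0 ^+ 2) ^+ 2 - 4 * H0 ^+ 2 = beta.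
  rewrite sqr_sqrtr ?addrK //; apply: addr_ge0; first exact: ltW.
  by rewrite mulr_ge0 ?sqr_ge0.
exists (Num.sqrt (beta + 4 * H0 ^+ 2)); rewrite /rw_ode /rot_spacelike aE; split => //.
- by move=> t /HJ[_ _]; rewrite d1d1E d1E.
- by move=> t /HJ[_ ]; rewrite d1E.
Qed.

End Forward.

(** * Local congruence *)

Section SmoothAtan.
Context {R : realType} {n : nat}.
Variable A : set 'rV[R]_n.+1.
Hypothesis oA : open A.

(** Serves for atan: its derivative is rational, so smoothness reduces to rules already
    available. *)
Lemma smooth_of_ds (F : 'rV[R]_n.+1 -> R^o) : (forall x, A x -> differentiable F x) ->
  (forall k, smooth_on A (ds k F : _ -> R^o)) -> smooth_on A F.
Proof.
move=> dF sF s; case/lastP: s => [|s k] x Ax; first exact: dF.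
by rewrite foldr_rcons; have := sF k s x Ax; rewrite dsE.
Qed.

Lemma ds_atan (F : 'rV[R]_n.+1 -> R^o) k x : differentiable F x ->
  ds k (fun y => atan (F y)) x = (1 + F x ^+ 2)^-1 * ds k F x.
Proof. by move=> dF; rewrite (ds_comp1 k (@derivable_atan R (F x)) dF) d1E derive1_atan. Qed.

Lemma smooth_atan (F : 'rV[R]_n.+1 -> R^o) : smooth_on A F ->
  smooth_on A (fun x => atan (F x) : R^o).
Proof.
move=> sF; apply: smooth_of_ds.
  by move=> x Ax; exact: (differentiable_comp1 (@derivable_atan R (F x)) (smooth_on_diff sF Ax)).
move=> k; apply: (smooth_eq_on oA (F := fun x => (1 + F x ^+ 2)^-1 * ds k F x : R^o)).
  by move=> x Ax; apply/esym; exact: (ds_atan k (smooth_on_diff sF Ax)).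
apply: (smooth_M oA); last exact: smooth_ds.
apply: (smooth_V oA).
  by move=> x _; rewrite gt_eqF // ltr_pwDl // sqr_ge0.
by apply: (smooth_D oA); [exact: smooth_cst|exact: (smooth_X oA)].
Qed.

End SmoothAtan.

Lemma const_on_ball_row (R : realType) (n m : nat) (F : 'rV[R]_n.+1 -> 'rV[R]_m) x0 (r : R) :
  smooth_on (ball x0 r) F -> (forall k x, ball x0 r x -> dv k F x = 0) ->
  forall x, ball x0 r x -> F x = F x0.
Proof.
move=> sF dF x bx; apply/rowP => j.
apply: (@const_on_ball _ _ (fun y => F y 0 j : R^o) _ _ _ _ _ bx).
  by move=> y by_; exact: ((differentiable_rowP _ _).1 (smooth_on_diff sF by_)).
move=> k y by_; rewrite -dsE -(dv_row k j (smooth_on_diff sF by_)) dF //.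
exact: mxE.
Qed.

(** * Isometries of the spacetime induced by rigid motions of E^3 *)

Section Motion.
Context {R : realType}.
Variables (I : set R) (f : R -> R) (Q : 'M[R]_3) (c : 'rV[R]_3).
Hypothesis QQ : Q *m Q^T = 1%:M.

Definition motion (q : 'rV[R]_4) : 'rV[R]_4 := mk4 (q 0 0) ((sp q - c) *m Q).

Lemma dot_mx (u v : 'rV[R]_3) : dot u v = (u *m v^T) 0 0.
Proof. by rewrite dotE mxE; apply: eq_bigr => j _; rewrite mxE. Qed.

Lemma dot_orthogonal u v : dot (u *m Q) (v *m Q) = dot u v.
Proof. by rewrite !dot_mx trmx_mul mulmxA -(mulmxA u) QQ mulmx1. Qed.

(** The map is affine, so its difference quotients are constant. *)
Lemma derive_motion v q : 'D_v motion q = mk4 (v 0 0) (sp v *m Q).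
Proof.
rewrite /derive; apply: lim_near_cst => //.
near=> h; have h0 : h != 0 by near: h; exact: nbhs_dnbhs_neq.
apply: (scalerI h0); rewrite scalerA mulfV // scale1r.
rewrite /= /motion; apply: eq_row4; rewrite ?e0B ?e0Z ?spB ?spZ ?mk4_0 ?sp_mk4.
  by rewrite e0D e0Z addrK.
by rewrite spD spZ -mulmxBl opprB addrA subrK addrK -scalemxAl.
Unshelve. all: by end_near.
Qed.

Lemma smooth_motion (B : set 'rV[R]_4) : open B -> smooth_on B motion.
Proof.
move=> oB.
have sid : smooth_on B (fun q : 'rV[R]_4 => q).
  by apply/(smooth_rowP oB) => j; exact: smooth_coord.
apply: (smooth_mk4 oB); first exact: smooth_coord.
have ssp : smooth_on B (fun q : 'rV[R]_4 => sp q - c).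
  apply/(smooth_rowP oB) => j.
  apply: (smooth_eq_on oB (F := fun q => sp q 0 j - c 0 j : R^o)).
    by move=> q _; rewrite rowBE.
  apply: (smooth_B oB); last exact: smooth_cst.
  by have /(smooth_rowP oB) := smooth_sp oB sid; exact.
apply/(smooth_rowP oB) => j.
apply: (smooth_eq_on oB (F := fun q => dot (sp q - c) (row j Q^T) : R^o)).
  by move=> q _; rewrite mxE dotE; apply: eq_bigr => i _; rewrite !mxE.
by apply: (smooth_dot oB ssp); exact: smooth_cst.
Qed.

Lemma rw_isometry_motion : open I -> rw_isometry I f motion.
Proof.
move=> oI; split.
- split.
  + by move=> q Iq; rewrite /rw_space /= mk4_0.
  + move=> p q _ _ e; apply: eq_row4.
      by have := congr1 (fun u : 'rV_4 => u 0 0) e; rewrite !mk4_0.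
    have := congr1 (fun u => sp u *m Q^T) e.
    by rewrite !sp_mk4 -!mulmxA QQ !mulmx1 => /addIr.
  + move=> q Iq; exists (mk4 (q 0 0) (sp q *m Q^T + c)); first by rewrite /rw_space /= mk4_0.
    rewrite /motion mk4_0 sp_mk4 addrK -mulmxA (mulmx1C QQ) mulmx1.
    by apply: eq_row4; rewrite ?mk4_0 ?sp_mk4.
- apply: smooth_motion.
  apply: (@open_comp _ _ (fun q : 'rV[R]_4 => q 0 0) I) => // q _.
  exact: coord_continuous.
move=> q Iq v w; rewrite !derive_motion !inner_ip !ipE !mk4_0 !sp_mk4.
by rewrite dot_orthogonal.
Qed.

End Motion.

Lemma ord3P (P : 'I_3 -> Prop) :
  P ord0 -> P (lift ord0 ord0) -> P (lift ord0 (lift ord0 ord0)) -> forall i, P i.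
Proof.
move=> P0 P1 P2 i; case: (unliftP ord0 i) => [j|] -> //.
by case: (unliftP ord0 j) => [k|] -> //; rewrite (ord1 k).
Qed.

Lemma orthonormal_mx (R : realType) (u v w : 'rV[R]_3) :
  dot u u = 1 -> dot v v = 1 -> dot w w = 1 -> dot u v = 0 -> dot u w = 0 -> dot v w = 0 ->
  exists2 Q : 'M[R]_3, Q *m Q^T = 1%:M &
    forall x, x *m Q = row3 (dot x u) (dot x v) (dot x w).
Proof.
move=> uu vv ww uv uw vw.
pose E (j : 'I_3) := if j == ord0 then u else if j == lift ord0 ord0 then v else w.
exists (\matrix_(i, j) E j 0 i).
  apply: mulmx1C; apply/matrixP => i j; rewrite !mxE.
  have -> : \sum_k (\matrix_(i, j) E j 0 i)^T i k * (\matrix_(i, j) E j 0 i) k j = dot (E i) (E j).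
    by rewrite dotE; apply: eq_bigr => k _; rewrite !mxE.
  move: i j; apply: ord3P; apply: ord3P; rewrite /E /= ?(dotC v u) ?(dotC w u) ?(dotC w v) //.
move=> x; have xE j : (x *m (\matrix_(i, j) E j 0 i)) 0 j = dot x (E j).
  by rewrite mxE dotE; apply: eq_bigr => k _; rewrite !mxE.
have [r0 r1 r2] := row3E (dot x u) (dot x v) (dot x w).
by apply: eq_row3; rewrite xE ?r0 ?r1 ?r2.
Qed.

Lemma unitmx2 (R : realType) (M : 'M[R]_2) :
  M 0 0 * M 1 1 - M 0 1 * M 1 0 != 0 -> M \in unitmx.
Proof.
move=> d0; have [e00 e01 e10 e11] := invmx2 d0.
have MB : M *m invmx M = 1%:M.
  by apply/matrixP; apply: ord2P; apply: ord2P; rewrite !mxE sum2 ?e00 ?e01 ?e10 ?e11 /=; field.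
exact: (mulmx1_unit MB).1.
Qed.

Lemma dotZD (R : realType) (p q : R) (u v x : 'rV[R]_3) :
  dot (p *: u + q *: v) x = p * dot u x + q * dot v x.
Proof. by rewrite dotDl !dotZl. Qed.

Lemma sin_atan_ratio (R : realType) (p q : R) : 0 < q -> p ^+ 2 + q ^+ 2 = 1 ->
  sin (atan (p / q)) = p /\ cos (atan (p / q)) = q.
Proof.
move=> q0 pq; have ec : cos (atan (p / q)) = q.
  rewrite cos_atan expr_div_n.
  have -> : 1 + p ^+ 2 / q ^+ 2 = (q ^-1) ^+ 2.
    have q2 : q ^+ 2 != 0 by rewrite expf_neq0 // gt_eqF.
    by rewrite exprVn; apply: (mulIf q2); rewrite mulrDl divfK // mulVf // mul1r addrC.
  by rewrite sqrtr_sqr ger0_norm ?invr_ge0 ?ltW // invrK.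
split=> //; have := atanK (p / q); rewrite /tan ec => h.
by apply: (mulIf (x := q^-1)); rewrite ?invr_eq0 ?gt_eqF.
Qed.

Lemma rot_surfaceE (R : realType) (f : R -> R) (H0 a c : R) (x : 'rV[R]_2) :
  rot_surface f H0 a c x = mk4 (x 0 0) (row3 (1 / (a * f (x 0 0)) * sin (a * x 0 1))
    (1 / (a * f (x 0 0)) * cos (a * x 0 1)) (2 * H0 / (a ^+ 2 * c * f (x 0 0)))).
Proof.
have [r0 r1 r2] := row3E (1 / (a * f (x 0 0)) * sin (a * x 0 1))
    (1 / (a * f (x 0 0)) * cos (a * x 0 1)) (2 * H0 / (a ^+ 2 * c * f (x 0 0))).
by apply: eq_row4; rewrite ?mk4_0 ?sp_mk4; [rewrite mxE|apply: eq_row3; rewrite ?r0 ?r1 ?r2 !mxE].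
Qed.

(** * Congruence with the rotational surface near one point *)

Section Congruence.
Context {R : realType}.
Variables (I : set R) (f : R -> R) (H0 : R).
Hypotheses (I_int : open_interval I) (f_smooth : smooth_on1 I f)
  (f_neq0 : forall t, I t -> f t != 0).
Variables (A : set 'rV[R]_2) (X : 'rV[R]_2 -> 'rV[R]_4).
Hypotheses (oA : open A) (sX : smooth_on A X) (XI : forall x, A x -> I (X x 0 0)).
Variable fr : adapted_frame f H0 A X.
Variables (x0 : 'rV[R]_2) (r : R) (a c : R).
Hypotheses (r_gt0 : 0 < r) (rA : ball x0 r `<=` A) (a_neq0 : a != 0)
  (c_neq0 : c != 0) (ac : 4 * H0 ^+ 2 + c ^+ 2 = a ^+ 2) (bc : af_b fr x0 ^+ 2 = c ^+ 2).

Local Notation B := (ball x0 r).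
Let oB : open B. Proof. exact: ball_open. Qed.
Let Bx0 : B x0. Proof. exact: ballxx. Qed.
Let s := af_b fr x0 / c.
Let e2 := af_e2 fr.
Let e4 := af_e4 fr.
Let om := af_om fr.
(* The sign s makes c, rather than the function b of the frame, the curvature
   of w. *)
Let w x := s *: af_w fr x.
(** [e2], [n] and K / a are orthonormal. Since [K] is constant, [e2] and [n] turn in a fixed plane,
    at the rate a om; [K] is the direction of the axis of rotation and [C] a point on it. *)
Let K x := (2 * H0) *: w x + c *: e4 x.
Let n x := a^-1 *: (c *: w x - (2 * H0) *: e4 x).
Let F x := f (X x 0 0).
Let Y x := sp (X x).
Let C x := Y x - (c * F x)^-1 *: w x.

Let ss : s * s = 1.
Proof. by rewrite -expr2 expr_div_n bc divff // expf_neq0. Qed.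

Let s_neq0 : s != 0.
Proof. by apply: contra_eq_neq ss => ->; rewrite mul0r eq_sym oner_neq0. Qed.

Let bE x : B x -> af_b fr x = s * c.
Proof. by move=> Bx; rewrite (frame_b_const fr rA Bx) /s divfK. Qed.

Let sw : smooth_on B w.
Proof.
apply: (smooth_Zv oB); first exact: smooth_cst.
exact: (smooth_on_sub rA (af_sw fr)).
Qed.
Let se2 : smooth_on B e2. Proof. exact: (smooth_on_sub rA (af_se2 fr)). Qed.
Let se4 : smooth_on B e4. Proof. exact: (smooth_on_sub rA (af_se4 fr)). Qed.
Let sXB : smooth_on B X. Proof. exact: (smooth_on_sub rA sX). Qed.
Let XIB x : B x -> I (X x 0 0). Proof. by move=> /rA; exact: XI. Qed.
Let F0 x : B x -> F x != 0. Proof. by move=> /XIB; exact: f_neq0. Qed.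
Let sF : smooth_on B (F : _ -> R^o). Proof. exact: (smooth_f f_smooth oB sXB XIB). Qed.

Let ww x : B x -> dot (w x) (w x) = 1.
Proof. by move=> Bx; rewrite dotZl dotZr mulrA ss mul1r (af_ww fr (rA Bx)). Qed.
Let e22 x : B x -> dot (e2 x) (e2 x) = 1.
Proof. by move=> Bx; exact: (af_e22 fr (rA Bx)). Qed.
Let e44 x : B x -> dot (e4 x) (e4 x) = 1.
Proof. by move=> Bx; exact: (af_e44 fr (rA Bx)). Qed.
Let we2 x : B x -> dot (w x) (e2 x) = 0.
Proof. by move=> Bx; rewrite dotZl (af_we2 fr (rA Bx)) mulr0. Qed.
Let we4 x : B x -> dot (w x) (e4 x) = 0.
Proof. by move=> Bx; rewrite dotZl (af_we4 fr (rA Bx)) mulr0. Qed.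
Let e24 x : B x -> dot (e2 x) (e4 x) = 0.
Proof. by move=> Bx; exact: (af_e24 fr (rA Bx)). Qed.

Let sZ m (d : R) (G : 'rV[R]_2 -> 'rV[R]_m) : smooth_on B G -> smooth_on B (fun y => d *: G y).
Proof. by move=> sG; apply: (smooth_Zv oB _ sG); exact: smooth_cst. Qed.

Let dw k x : B x -> dv k w x = (c * om k x) *: e2 x.
Proof.
move=> Bx; rewrite dv_scale; last exact: (smooth_on_diff (af_sw fr) (rA Bx)).
by rewrite (af_dw fr k (rA Bx)) bE // [LHS]scalerA -(mulrA s) mulrA -mulrA mulrA ss mul1r.
Qed.

Let de4 k x : B x -> dv k e4 x = (- (2 * H0) * om k x) *: e2 x.
Proof. by move=> Bx; exact: (af_de4 fr k (rA Bx)). Qed.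

Let de2 k x : B x -> dv k e2 x = (- (a * om k x)) *: n x.
Proof.
move=> Bx; rewrite (af_de2 fr k (rA Bx)) bE // /n /w scalerA (mulrC s).
rewrite scalerA; congr (_ *: _); first by rewrite mulNr mulrAC divff ?mul1r.
Qed.

Let sn : smooth_on B n.
Proof.
by apply: sZ; apply: (smooth_Bv oB); exact: sZ.
Qed.

Let dn k x : B x -> dv k n x = (a * om k x) *: e2 x.
Proof.
move=> Bx; have d1 := smooth_on_diff (sZ c sw) Bx; have d2 := smooth_on_diff (sZ (2 * H0) se4) Bx.
rewrite dv_scale; last exact: differentiableB.
rewrite (dvB k d1 d2) (dv_scale k _ (smooth_on_diff sw Bx)) (dv_scale k _ (smooth_on_diff se4 Bx)).
rewrite dw // de4 //; move: (e2 x) (om k x) => E o; apply/rowP => j; rewrite !rowE_.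
move: (E 0 j) => E'.
have -> : a * o * E' = a^-1 * (a ^+ 2 * o * E') by rewrite expr2 -!mulrA mulKf.
by rewrite -ac; ring.
Qed.

Let K_const x : B x -> K x = K x0.
Proof.
have s1 := sZ (2 * H0) sw; have s2 := sZ c se4.
apply: const_on_ball_row; first exact: (smooth_D oB s1 s2).
move=> k y By; rewrite (dvD k (smooth_on_diff s1 By) (smooth_on_diff s2 By)).
rewrite (dv_scale k _ (smooth_on_diff sw By)) (dv_scale k _ (smooth_on_diff se4 By)) dw // de4 //.
move: (e2 y) (om k y) => E o; apply/rowP => j; rewrite !rowE_.
by move: (E 0 j) => E'; ring.
Qed.

Let C_const x : B x -> C x = C x0.
Proof.
have scF : smooth_on B (fun x => c * F x : R^o).
  by apply: (smooth_M oB _ sF); exact: smooth_cst.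
have cF0 y : B y -> c * F y != 0 by move=> By; rewrite mulf_neq0 ?F0.
have sV := smooth_V oB cF0 scF.
have sVw := smooth_Zv oB sV sw; have sY : smooth_on B Y by exact: smooth_sp.
apply: const_on_ball_row; first exact: (smooth_Bv oB sY sVw).
move=> k y By; rewrite (dvB k (smooth_on_diff sY By) (smooth_on_diff sVw By)).
rewrite (af_dY fr k (rA By)) bE // (dvZ k (smooth_on_diff sV By) (smooth_on_diff sw By)) dw //.
rewrite (dsV k (cF0 y By) (smooth_on_diff scF By)).
have dc : differentiable (fun _ : 'rV[R]_2 => c : R^o) y by exact: differentiable_cst.
rewrite (dsM k dc (smooth_on_diff sF By)) ds_cst mul0r add0r.
rewrite (ds_f f_smooth oB sXB XIB k By) /w -/(F y) -/(om k y) -/(e2 y).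
move: (F0 By) c_neq0 s_neq0 ss; move: (F y) (d1 f _) (dv k X y 0 0) (om k y) (e2 y) (af_w fr y) s.
move=> F' F1 tk o E W s' n0 n1 n2 ss'; apply/rowP => j; rewrite !rowE_.
move: (E 0 j) (W 0 j) => E' W'.
have e1 : F1 * tk / (F' ^+ 2 * (s' * c)) = F1 * tk / (F' ^+ 2 * c) * s'.
  have -> : F1 * tk / (F' ^+ 2 * (s' * c)) = (s' * s') * (F1 * tk) / (F' ^+ 2 * (s' * c)).
    by rewrite ss' mul1r.
  by field; rewrite n0 n1 n2.
by rewrite e1; field; rewrite n0 n1.
Qed.

Let om_n x : B x -> dot (e2 x) (n x) = 0.
Proof.
move=> Bx; move: (we2 Bx) (e24 Bx); rewrite /n; move: (w x) (e2 x) (e4 x) => W V E h1 h2.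
by rewrite dotZr dotBr !dotZr (dotC V W) h1 h2 !mulr0 subrr mulr0.
Qed.

Let nn x : B x -> dot (n x) (n x) = 1.
Proof.
move=> Bx; move: (ww Bx) (e44 Bx) (we4 Bx); rewrite /n; move: (w x) (e4 x) => W E h1 h2 h3.
rewrite dotZl dotZr dotBl !dotBr !dotZl !dotZr (dotC E W) h1 h2 h3.
have a2 : a ^+ 2 != 0 by rewrite expf_neq0.
by apply: (mulfI a2); rewrite mulr1 -{2}ac; field; exact: a_neq0.
Qed.

Let nK x : B x -> dot (n x) (K x) = 0.
Proof.
move=> Bx; move: (ww Bx) (e44 Bx) (we4 Bx); rewrite /n /K; move: (w x) (e4 x) => W E h1 h2 h3.
rewrite dotZl dotBl !dotDr !dotZl !dotZr (dotC E W) h1 h2 h3.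
by ring.
Qed.

Let e2K x : B x -> dot (e2 x) (K x) = 0.
Proof.
move=> Bx; move: (we2 Bx) (e24 Bx); rewrite /K; move: (w x) (e2 x) (e4 x) => W V E h1 h2.
by rewrite dotDr !dotZr (dotC V W) h1 h2 !mulr0 addr0.
Qed.

Let KK x : B x -> dot (K x) (K x) = a ^+ 2.
Proof.
move=> Bx; move: (ww Bx) (e44 Bx) (we4 Bx); rewrite /K; move: (w x) (e4 x) => W E h1 h2 h3.
rewrite dotDl !dotDr !dotZl !dotZr (dotC E W) h1 h2 h3.
by rewrite -ac; ring.
Qed.

(** Solving the definitions of [n] and [K] for [w] gives a w = c n + (2 H0 / a) K; the resulting
    coefficients are the radius and the height of the rotational surface. *)
Let YE x : B x -> Y x - C x0 = (1 / (a * F x)) *: n x + (2 * H0 / (a ^+ 2 * c * F x)) *: K x0.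
Proof.
move=> Bx; rewrite -(C_const Bx) -(K_const Bx) /C opprB addrC subrK /n /K.
move: (F0 Bx) a_neq0 c_neq0; move: (F x) (w x) (e4 x) => F' W E n0 n1 n2.
have e : (c * F')^-1 = (4 * H0 ^+ 2 + c ^+ 2) / (a ^+ 2 * c * F').
  by rewrite ac; field; rewrite n0 n1 n2.
rewrite e; apply/rowP => j; rewrite !rowE_; move: (W 0 j) (E 0 j) => *.
by field; rewrite n0 n1 n2.
Qed.

Let E1 := e2 x0.
Let E2 := n x0.
Let E3 := a^-1 *: K x0.
Let G1 x := dot (n x) E1.
Let G2 x := dot (n x) E2.
(** a v is the angle from [E2] to [n]. Since [G2] is 1 at [x0], it stays positive nearby, and there
    atan recovers the angle. *)
Let v x := a^-1 * atan (G1 x / G2 x).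
Let th x : 'rV[R]_2 := \row_j (if j == 0 then X x 0 0 else v x).

Let sG1 : smooth_on B (G1 : _ -> R^o).
Proof. by apply: (smooth_dot oB sn); exact: smooth_cst. Qed.
Let sG2 : smooth_on B (G2 : _ -> R^o).
Proof. by apply: (smooth_dot oB sn); exact: smooth_cst. Qed.

Let G2_x0 : G2 x0 = 1. Proof. exact: nn. Qed.
Let G1_x0 : G1 x0 = 0. Proof. by rewrite /G1 dotC; exact: om_n. Qed.

Let G2_near : exists2 r' : R, 0 < r' & forall x, ball x0 r' x -> B x /\ 0 < G2 x.
Proof.
have cG := differentiable_continuous (smooth_on_diff sG2 Bx0).
have n1 : \forall x \near x0, 0 < G2 x by apply: (cvgr_gt _ cG); rewrite G2_x0.
have n2 : nbhs x0 B by exact: nbhsx_ballx.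
have /nbhs_ballP[r' r'0 h] : nbhs x0 [set x | B x /\ 0 < G2 x] by exact: filterI.
by exists r'.
Qed.

Lemma local_congruence : exists (r' : R) (theta : 'rV[R]_2 -> 'rV[R]_2)
    (Psi : 'rV[R]_4 -> 'rV[R]_4),
  [/\ 0 < r' /\ ball x0 r' `<=` A, diffeo_on (ball x0 r') theta,
      forall x, theta x 0 0 = X x 0 0, rw_isometry I f Psi &
      forall x, ball x0 r' x -> Psi (X x) = rot_surface f H0 a (c / a) (theta x)].
Proof.
have [_ oI _] := I_int; have [r1 r10 hr1] := G2_near.
have oU : open (ball x0 r1) by exact: ball_open.
have UB : ball x0 r1 `<=` B by move=> x /hr1[].
have G20 x : ball x0 r1 x -> G2 x != 0 by move=> /hr1[_]; move/lt0r_neq0.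
have sR : smooth_on (ball x0 r1) (fun x => G1 x / G2 x : R^o).
  apply: (smooth_M oU (smooth_on_sub UB sG1)).
  exact: (smooth_V oU G20 (smooth_on_sub UB sG2)).
have sA := smooth_atan oU sR.
have sv : smooth_on (ball x0 r1) (v : _ -> R^o).
  by apply: (smooth_M oU _ sA); exact: smooth_cst.
have st : smooth_on (ball x0 r1) (fun x => X x 0 0 : R^o).
  exact: (smooth_e0 oU (smooth_on_sub UB sXB)).
have sth : smooth_on (ball x0 r1) th.
  apply/(smooth_rowP oU); apply: ord2P.
    by apply: (smooth_eq_on oU _ st) => x _; rewrite mxE.
  by apply: (smooth_eq_on oU _ sv) => x _; rewrite mxE.
have Ux0 : ball x0 r1 x0 by exact: ballxx.
have dth := smooth_on_diff sth Ux0.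
(* As dv = om at [x0], the Jacobian determinant of [th] there is the wedge of dt and [om], non-zero
   by [af_t_om]. *)
have dv_k k : ds k v x0 = om k x0.
  have dc : differentiable (fun _ : 'rV[R]_2 => a^-1 : R^o) x0 by exact: differentiable_cst.
  rewrite (dsM k dc (smooth_on_diff sA Ux0)) ds_cst mul0r add0r.
  rewrite (ds_atan k (smooth_on_diff sR Ux0)).
  have dV := smooth_on_diff (smooth_V oU G20 (smooth_on_sub UB sG2)) Ux0.
  rewrite (dsM k (smooth_on_diff sG1 Bx0) dV) G1_x0 G2_x0 mul0r expr0n addr0 invr1 mul1r.
  have dE : differentiable (fun _ : 'rV[R]_2 => E1) x0 by exact: differentiable_cst.
  rewrite (ds_dot k (smooth_on_diff sn Bx0) dE) dn // dotZl e22 //.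
  have -> : dv k (fun _ : 'rV[R]_2 => E1) x0 = 0.
    by apply/rowP => j; rewrite (dv_row k j dE) ds_cst mxE.
  rewrite (dotC (n x0)) dot0l mul0r !addr0 !mulr1.
  by rewrite mulKf.
have uJ : jacobian th x0 \in unitmx.
  apply: unitmx2; rewrite -!(pd_jacobian _ _ dth) -!dvE !(dv_row _ _ dth).
  have e0 : (fun y => th y 0 0) = (fun y => X y 0 0) by apply/funext => y; rewrite mxE.
  have e1 : (fun y => th y 0 1) = v by apply/funext => y; rewrite mxE.
  rewrite e0 e1 !dv_k !(ds_t sX _ (rA Bx0)).
  have := af_t_om fr (rA Bx0); rewrite /wedge -/om.
  by move: (dv 0 X x0 0 0) (dv 1 X x0 0 0) => t0 t1; rewrite (mulrC t1).
have [r' r'0 [r'U dif]] := inverse_function oU Ux0 sth uJ.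
(* The components of [n] along [E1] and [E2] are the sine and the cosine of the angle, in the order
   of [rot_surface]; [E3] becomes the axis. *)
have [||||||Q QQ QE] := @orthonormal_mx R E1 E2 E3.
- exact: e22.
- exact: nn.
- by rewrite dotZl dotZr KK // expr2 mulKf // mulVf.
- exact: om_n.
- by rewrite dotZr e2K // mulr0.
- by rewrite dotZr nK // mulr0.
exists r', th, (motion Q (C x0)); split => //.
- by split => // x /r'U /UB /rA.
- by move=> x; rewrite mxE.
- exact: rw_isometry_motion.
move=> x /r'U Ux; have Bx := UB _ Ux; have [_ Gp] := hr1 x Ux.
have nE3 : dot (n x) E3 = 0 by rewrite dotZr -(K_const Bx) nK // mulr0.
have GG : G1 x ^+ 2 + G2 x ^+ 2 = 1.
  have := nn Bx; rewrite -(dot_orthogonal QQ) QE dot3.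
  have [-> -> ->] := row3E (dot (n x) E1) (dot (n x) E2) (dot (n x) E3).
  by rewrite nE3 mul0r addr0.
have [es ec] := sin_atan_ratio Gp GG.
have KE3 : K x0 = a *: E3 by rewrite scalerA divff // scale1r.
rewrite /motion rot_surfaceE -/(Y x) (YE Bx) !mxE /= /v mulVKf // es ec -/(F x).
congr mk4; rewrite QE; congr row3.
- rewrite dotZD -/(G1 x) (dotC (K x0)) e2K //.
  by rewrite mulr0 addr0.
- rewrite dotZD -/(G2 x) (dotC (K x0)) nK //.
  by rewrite mulr0 addr0.
rewrite dotZD nE3 mulr0 add0r {1}KE3 dotZl.
have -> : dot E3 E3 = 1 by rewrite dotZl dotZr KK // expr2 mulKf // mulVf.
by move: (F0 Bx) a_neq0 c_neq0; move: (F x) => F' n0 n1 n2; field; rewrite n0 n1 n2.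
Qed.

End Congruence.

Section LocalCongruence.
Context {R : realType}.
Variables (I : set R) (f : R -> R) (H0 : R).
Hypotheses (I_int : open_interval I) (f_smooth : smooth_on1 I f)
  (f_neq0 : forall t, I t -> f t != 0) (H0_neq0 : H0 != 0)
  (f_standing : forall t, I t ->
     derive1n 2 f t / f t - derive1 f t ^+ 2 / f t ^+ 2 != 0).
Variables (M : surface R) (phi : M -> 'rV[R]_4) (J : set R).
Hypotheses (bic : bicons_pmcv_surface I f phi H0) (rng : time_range phi = J).

Lemma surface_locally_congruent (a : R) : 0 < a ^+ 2 - 4 * H0 ^+ 2 -> rw_ode f H0 a J ->
  exists c2 : R,
    [/\ 0 < c2, 4 * H0 ^+ 2 + c2 ^+ 2 * a ^+ 2 = a ^+ 2 &
        locally_congruent I f phi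
          [set x : 'rV[R]_2 | I (x 0 0)] (rot_surface f H0 a c2)].
Proof.
set beta := a ^+ 2 - 4 * H0 ^+ 2 => b0 ode.
have a0 : a != 0.
  apply: contraTneq b0 => a0; rewrite /beta a0 expr0n sub0r oppr_gt0 -leNgt.
  by rewrite mulr_ge0 // sqr_ge0.
(* [a] may be negative: the absolute value makes [c2] positive, and later only the square of c2 a,
   which is beta, matters. *)
pose c2 := Num.sqrt beta / `|a|.
have c20 : 0 < c2 by rewrite divr_gt0 ?sqrtr_gt0 ?normr_gt0.
have c2E : c2 ^+ 2 * a ^+ 2 = beta.
  rewrite /c2 expr_div_n sqr_sqrtr ?ltW // real_normK ?num_real // divfK //.
  by rewrite expf_neq0.
exists c2; split=> //; first by rewrite c2E /beta addrC subrK.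
move=> p; have [i ip] := cdom_cover p.
have [fr] := surface_frame I_int f_smooth f_neq0 H0_neq0 f_standing i bic.
have oA : open (crange i) by exact: crange_open.
have [[sphi phiI _] _ _ _ _] := bic.
have XI x : crange i x -> I ((phi \o param i) x 0 0) by move=> _; exact: phiI.
have Ax : crange i (chart i p) by exists p.
have [r r0 rA] := open_ball_sub oA Ax.
have ks t : I t -> d1 (d1 f) t / f t - (d1 f t / f t) ^+ 2 != 0.
  by move=> It; rewrite d1d1E d1E expr_div_n; exact: f_standing.
have bE : beta = af_b fr (chart i p) ^+ 2.
  apply: (frame_beta_unique f_smooth f_neq0 ks oA (sphi i) XI fr Ax) => x _.
  by rewrite d1d1E d1E; apply: ode; rewrite -rng; exists (param i x).
have ca : c2 * a != 0 by rewrite mulf_neq0 // gt_eqF.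
have bc : af_b fr (chart i p) ^+ 2 = (c2 * a) ^+ 2 by rewrite -bE exprMn c2E.
have ac : 4 * H0 ^+ 2 + (c2 * a) ^+ 2 = a ^+ 2 by rewrite exprMn c2E /beta addrC subrK.
have [r' [th [Psi [[r'0 r'A] dif th0 iso eq]]]] :=
  local_congruence I_int f_smooth f_neq0 (sphi i) XI r0 rA a0 ca ac bc.
exists i, (ball (chart i p) r'), th, Psi; split => //.
- by split=> //; exact: ballxx.
- by split=> // _ [x xr <-]; rewrite /= th0; apply: XI; exact: r'A.
by move=> x xr; have := eq x xr; rewrite mulfK.
Qed.

End LocalCongruence.

(** * Rotational surfaces *)

Section RotGeometry.
Context {R : realType}.
Variables (I : set R) (f : R -> R) (H0 c : R).
Hypotheses (I_int : open_interval I) (f_smooth : smooth_on1 I f)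
  (f_neq0 : forall t, I t -> f t != 0) (c_neq0 : c != 0).
Variables (A : set 'rV[R]_2) (X : 'rV[R]_2 -> 'rV[R]_4) (w T W : 'rV[R]_2 -> 'rV[R]_3).
Local Notation g := (rw_metric f).
Local Notation inn x := (ip (f (X x 0 0))).
Local Notation G x k l := (inn x (dv k X x) (dv l X x)).
Local Notation D x := (G x 0 0 * G x 1 1 - G x 0 1 * G x 1 0).
Local Notation F x := (f (x 0 0)).
Local Notation F1 x := (d1 f (x 0 0)).
Local Notation F2 x := (d1 (d1 f) (x 0 0)).
Hypotheses (oA : open A) (AI : forall x, A x -> I (x 0 0))
  (sw : smooth_on A w) (sT : smooth_on A T) (sW : smooth_on A W)
  (ww : forall x, A x -> dot (w x) (w x) = 1) (TT : forall x, A x -> dot (T x) (T x) = 1)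
  (WW : forall x, A x -> dot (W x) (W x) = 1) (wT : forall x, A x -> dot (w x) (T x) = 0)
  (wW : forall x, A x -> dot (w x) (W x) = 0) (TW : forall x, A x -> dot (T x) (W x) = 0)
  (dw : forall k x, A x -> dv k w x = (c * (k == 1)%:R) *: T x)
  (dT : forall k x, A x -> dv k T x = (- (k == 1)%:R) *: (c *: w x - (2 * H0) *: W x))
  (dW : forall k x, A x -> dv k W x = (- (2 * H0) * (k == 1)%:R) *: T x)
  (XE : forall x, A x -> X x = mk4 (x 0 0) ((c * F x)^-1 *: w x))
  (ode : forall x, A x -> c ^+ 2 * F x ^+ 3 * F2 x - (F1 x ^+ 2 - c ^+ 2 * F x ^+ 2) ^+ 2
     - F1 x ^+ 4 = 0)
  (spacelike : forall x, A x -> c ^+ 2 * F x ^+ 2 < F1 x ^+ 2).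

(** The direction of H. The factor 1/f makes it a unit vector, and its time component is zero as
    biconservativity requires. *)
Definition rot_normal (x : 'rV[R]_2) : 'rV[R]_4 := mk4 0 ((F x)^-1 *: W x).
Local Notation e := rot_normal.

Let su : smooth_on A (fun x : 'rV[R]_2 => x 0 0 : R^o).
Proof. exact: smooth_coord. Qed.
Let F0 x : A x -> F x != 0. Proof. by move=> /AI; exact: f_neq0. Qed.
Let sF : smooth_on A (fun x => F x : R^o). Proof. exact: (smooth_comp1 oA f_smooth AI su). Qed.
Let sVF : smooth_on A (fun x => (F x)^-1 : R^o). Proof. exact: (smooth_V oA F0 sF). Qed.
Let f1_smooth : smooth_on1 I (d1 f). Proof. by rewrite d1E; exact: (f'_smooth f_smooth). Qed.
Let sF1 : smooth_on A (fun x => F1 x : R^o). Proof. exact: (smooth_comp1 oA f1_smooth AI su). Qed.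

Let dF k x : A x -> ds k (fun x => F x) x = F1 x * (k == 0)%:R.
Proof.
move=> Ax; rewrite (ds_comp1 k (f_der f_smooth (AI Ax)) (smooth_on_diff su Ax)).
by rewrite ds_coord.
Qed.
Let dF1 k x : A x -> ds k (fun x => F1 x) x = F2 x * (k == 0)%:R.
Proof.
move=> Ax; rewrite (ds_comp1 k (f_der f1_smooth (AI Ax)) (smooth_on_diff su Ax)).
by rewrite ds_coord.
Qed.
Let dVF k x : A x -> ds k (fun x => (F x)^-1) x = - (F1 x / F x ^+ 2) * (k == 0)%:R.
Proof.
move=> Ax; rewrite (dsV k (F0 Ax) (smooth_on_diff sF Ax)) dF //.
by move: (F0 Ax); move: (F x) (F1 x) (k == 0)%:R => a b d n0; field.
Qed.

Let XE' x : A x -> X x = mk4 (x 0 0) (c^-1 *: ((F x)^-1 *: w x)).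
Proof. by move=> Ax; rewrite XE // invfM scalerA. Qed.

Let sVw : smooth_on A (fun x => (F x)^-1 *: w x). Proof. exact: (smooth_Zv oA sVF sw). Qed.

Lemma smooth_rot : smooth_on A X.
Proof.
apply: (smooth_eq_on oA (F := fun x => mk4 (x 0 0) (c^-1 *: ((F x)^-1 *: w x)))).
  by move=> x Ax; rewrite XE'.
by apply: (smooth_mk4 oA su); apply: (smooth_Zv oA _ sVw); exact: smooth_cst.
Qed.
Let sX := smooth_rot.

Lemma smooth_rot_normal : smooth_on A e.
Proof.
by apply: (smooth_mk4 oA _ (smooth_Zv oA sVF sW)); exact: smooth_cst.
Qed.
Let se := smooth_rot_normal.

Let X0 x : A x -> X x 0 0 = x 0 0. Proof. by move=> Ax; rewrite XE // mk4_0. Qed.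
Let XI x : A x -> I (X x 0 0). Proof. by move=> Ax; rewrite X0 //; exact: AI. Qed.

Let dv_mk4 k (p : 'rV[R]_2 -> R) (a : 'rV[R]_2 -> 'rV[R]_3) x : A x ->
  smooth_on A (p : _ -> R^o) -> smooth_on A a ->
  dv k (fun y => mk4 (p y) (a y)) x = mk4 (ds k p x) (dv k a x).
Proof.
move=> Ax sp sa; have d := smooth_on_diff (smooth_mk4 oA sp sa) Ax.
apply: eq_row4; rewrite ?mk4_0 ?sp_mk4.
  by rewrite (dv_row k 0 d); apply: (ds_eq_on oA k _ Ax) => y _; exact: mk4_0.
by rewrite -(dv_sp k d); apply: (dv_eq_on oA k _ Ax) => y _; exact: sp_mk4.
Qed.

Let dX k x : A x -> dv k X x = mk4 (k == 0)%:R
  ((- (F1 x / (c * F x ^+ 2)) * (k == 0)%:R) *: w x + ((k == 1)%:R / F x) *: T x).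
Proof.
move=> Ax; rewrite (dv_eq_on oA k XE' Ax).
have sc : smooth_on A (fun _ : 'rV[R]_2 => c^-1 : R^o) by exact: smooth_cst.
rewrite (dv_mk4 k Ax su (smooth_Zv oA sc sVw)) ds_coord; congr mk4.
rewrite (dv_scale k _ (smooth_on_diff sVw Ax)).
rewrite (dvZ k (smooth_on_diff sVF Ax) (smooth_on_diff sw Ax)) dVF // dw //.
move: (F0 Ax) c_neq0; move: (F x) (F1 x) (w x) (T x) (k == 0)%:R (k == 1)%:R => a b u v p q n0 n1.
by apply/rowP => j; rewrite !rowE_; move: (u 0 j) (v 0 j) => *; field; rewrite n0 n1.
Qed.

Let dX_0 x : A x -> dv 0 X x = mk4 1 ((- (F1 x / (c * F x ^+ 2))) *: w x).
Proof. by move=> Ax; rewrite dX //= mulr1 mul0r scale0r addr0. Qed.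
Let dX_1 x : A x -> dv 1 X x = mk4 0 ((F x)^-1 *: T x).
Proof. by move=> Ax; rewrite dX //= mulr0 scale0r add0r mul1r. Qed.

Let G00 (x : 'rV[R]_2) := F1 x ^+ 2 / (c ^+ 2 * F x ^+ 2) - 1.

Let EG x : A x -> [/\ G x 0 0 = G00 x, G x 0 1 = 0, G x 1 0 = 0 & G x 1 1 = 1].
Proof.
move=> Ax; rewrite dX_0 // dX_1 // X0 // !ipE !mk4_0 !sp_mk4 !dotZl !dotZr (dotC (T x)).
rewrite ww // TT // wT // /G00; move: (F0 Ax) c_neq0; move: (F x) (F1 x) => a b n0 n1.
by split; [field; rewrite n0 n1|ring|ring|field].
Qed.

Let G00_gt0 x : A x -> 0 < G00 x.
Proof.
move=> Ax; rewrite subr_gt0 ltr_pdivlMr ?mul1r ?spacelike //.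
by rewrite mulr_gt0 // exprn_even_gt0 //= F0.
Qed.

Let DE x : A x -> D x = G00 x.
Proof. by move=> Ax; have [-> -> -> ->] := EG Ax; rewrite mulr1 mulr0 subr0. Qed.

Let D_neq0 x : A x -> D x != 0.
Proof. by move=> Ax; rewrite DE // gt_eqF // G00_gt0. Qed.

Let inn_e x k : A x -> inn x (e x) (dv k X x) = 0.
Proof.
move=> Ax; move: k; apply: ord2P; rewrite ?dX_0 ?dX_1 // X0 // ipE !mk4_0 !sp_mk4.
  by rewrite !dotZl !dotZr (dotC (W x)) wW // !mulr0 mul0r oppr0 addr0.
by rewrite !dotZl !dotZr (dotC (W x)) TW // !mulr0 oppr0 addr0.
Qed.

Lemma rot_spacelike_immersion x v : A x -> v != 0 -> 0 < inner (first_form g X) x v v.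
Proof.
move=> Ax v0; rewrite inner2E !first_formE; have [-> -> -> ->] := EG Ax.
rewrite !mulr0 addr0 add0r mulr1 -!expr2; have Gp := G00_gt0 Ax.
have [v00|v00] := eqVneq (v 0 0) 0; last first.
  by rewrite ltr_wpDr ?sqr_ge0 // mulr_gt0 // exprn_even_gt0.
rewrite v00 expr0n mul0r add0r exprn_even_gt0 //=.
apply: contraNneq v0 => v01; apply/eqP/rowP; apply: ord2P; rewrite ?v00 ?v01 mxE //.
Qed.

Lemma rot_dt x : A x -> tangent_part g X x (dt_field R) != 0.
Proof.
move=> Ax; apply/eqP => h; have := inner_tangent D_neq0 (dt_field R) 0 Ax.
rewrite h ip0l dX_0 // ipE mk4_0 sp_mk4.
have -> : dt_field R 0 0 = 1 by rewrite mxE.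
have -> : sp (dt_field R) = 0 by apply/rowP => j; rewrite !mxE.
by rewrite dot0l mulr0 addr0 mulr1 => /eqP; rewrite eq_sym oppr_eq0 oner_eq0.
Qed.

Let cv_e k x : A x -> cv f X k e x = (- (2 * H0) * (k == 1)%:R) *: dv 1 X x.
Proof.
move=> Ax; rewrite /cv (dv_mk4 k Ax _ (smooth_Zv oA sVF sW)); last exact: smooth_cst.
rewrite ds_cst (dvZ k (smooth_on_diff sVF Ax) (smooth_on_diff sW Ax)) dVF // dW // dX_1 // X0 //.
have hw := wW Ax; have hT := TW Ax.
apply: eq_row4; rewrite ?e0D ?e0Z ?spD ?spZ ?mk4_0 ?sp_mk4 /gm ?mk4_0 ?sp_mk4.
  rewrite dX // sp_mk4 dotZr dotDl !dotZl hw hT.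
  by rewrite !mulr0 addr0 !mulr0 addr0.
rewrite dX // !mk4_0 !sp_mk4.
move: (F0 Ax) c_neq0; move: (F x) (F1 x) (W x) (T x) (w x) (k == 0)%:R (k == 1)%:R => a b u v v' p q n0 n1.
by apply/rowP => j; rewrite !rowE_; move: (u 0 j) (v 0 j) (v' 0 j) => *; field; rewrite n0 n1.
Qed.

Let sdX k : smooth_on A (dv k X). Proof. exact: smooth_dv. Qed.

Let cv00 x : A x -> cv f X 0 (dv 0 X) x =
  mk4 (F1 x ^+ 3 / (F x ^+ 3 * c ^+ 2)) ((- (F2 x / (F x ^+ 2 * c))) *: w x).
Proof.
move=> Ax; rewrite /cv.
pose q (x : 'rV[R]_2) := (- (c^-1)) * (F1 x * ((F x)^-1 * (F x)^-1)).
have E x' : A x' -> dv 0 X x' = mk4 1 (q x' *: w x').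
  move=> Ax'; rewrite dX_0 // /q; congr mk4; congr (_ *: _).
  by move: (F0 Ax') c_neq0; move: (F x') (F1 x') => a b n0 n1; field; rewrite n0 n1.
have sVV : smooth_on A (fun x => (F x)^-1 * (F x)^-1 : R^o) by exact: (smooth_M oA).
have sFV : smooth_on A (fun x => F1 x * ((F x)^-1 * (F x)^-1) : R^o) by exact: (smooth_M oA).
have sc : smooth_on A (fun _ : 'rV[R]_2 => - (c^-1) : R^o) by exact: smooth_cst.
have sq : smooth_on A (q : _ -> R^o) by exact: (smooth_M oA).
have s1 : smooth_on A (fun _ : 'rV[R]_2 => 1 : R^o) by exact: smooth_cst.
rewrite (dv_eq_on oA 0 E Ax) (dv_mk4 0 Ax s1 (smooth_Zv oA sq sw)) ds_cst.
rewrite (dvZ 0 (smooth_on_diff sq Ax) (smooth_on_diff sw Ax)) dw //.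
rewrite (dsM 0 (smooth_on_diff sc Ax) (smooth_on_diff sFV Ax)) ds_cst.
rewrite (dsM 0 (smooth_on_diff sF1 Ax) (smooth_on_diff sVV Ax)) dF1 //.
rewrite (dsM 0 (smooth_on_diff sVF Ax) (smooth_on_diff sVF Ax)) dVF //= X0 //.
rewrite E // /q; have hw := ww Ax.
apply: eq_row4; rewrite ?e0D ?spD ?mk4_0 ?sp_mk4 /gm ?mk4_0 ?sp_mk4.
  rewrite dotZl dotZr hw; move: (F0 Ax) c_neq0; move: (F x) (F1 x) => a b n0 n1.
  by field; rewrite n0 n1.
move: (F0 Ax) c_neq0; move: (F x) (F1 x) (F2 x) (w x) (T x) => a b b' u v n0 n1.
by apply/rowP => j; rewrite !rowE_; move: (u 0 j) (v 0 j) => *; field; rewrite n0 n1.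
Qed.

Let cv11 x : A x -> cv f X 1 (dv 1 X) x =
  mk4 (F1 x / F x) ((- (c / F x)) *: w x) + (2 * H0) *: e x.
Proof.
move=> Ax; rewrite /cv.
rewrite (dv_eq_on oA 1 dX_1 Ax) (dv_mk4 1 Ax _ (smooth_Zv oA sVF sT)); last exact: smooth_cst.
rewrite ds_cst (dvZ 1 (smooth_on_diff sVF Ax) (smooth_on_diff sT Ax)) dVF // dT //= X0 //.
rewrite dX_1 // /rot_normal; have hT := TT Ax.
apply: eq_row4; rewrite ?e0D ?e0Z ?spD ?spZ ?mk4_0 ?sp_mk4 /gm ?mk4_0 ?sp_mk4.
  rewrite dotZl dotZr hT; move: (F0 Ax); move: (F x) (F1 x) => a b n0.
  by field.
move: (F0 Ax) c_neq0; move: (F x) (F1 x) (W x) (w x) (T x) => a b u v v' n0 n1.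
by apply/rowP => j; rewrite !rowE_; move: (u 0 j) (v 0 j) (v' 0 j) => *; field.
Qed.

(** Twice the mean curvature vector before projection to the normal plane. The part without [e] lies
    in the plane of d/dt and [w]; the differential equation makes it a multiple of the tangent
    vector [dv 0 X]. *)
Let cv_sum x : A x -> exists l, (G00 x)^-1 *: cv f X 0 (dv 0 X) x + 1 *: cv f X 1 (dv 1 X) x =
  l *: dv 0 X x + (2 * H0) *: e x.
Proof.
(* The factor is read off the time components, since [dv 0 X] has time component 1. *)
move=> Ax; exists (F1 x ^+ 3 / (F x ^+ 3 * c ^+ 2) / G00 x + F1 x / F x).
rewrite cv00 // cv11 // scale1r addrA; congr (_ + _); rewrite dX_0 //.
have Gn : G00 x != 0 by rewrite gt_eqF // G00_gt0.
apply: eq_row4; rewrite ?e0D ?e0Z ?spD ?spZ ?mk4_0 ?sp_mk4; first by rewrite mulr1 mulrC.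
move: (F0 Ax) c_neq0 Gn (ode Ax); rewrite /G00.
move: (F x) (F1 x) (F2 x) (w x) => a b b' v n0 n1 Gn h.
rewrite !scalerA -scalerDl; congr (_ *: _).
have n2 : b ^+ 2 - c ^+ 2 * a ^+ 2 != 0.
  apply: contraNneq Gn => h'; rewrite subr_eq0; apply/eqP.
  apply: (mulIf (x := c ^+ 2 * a ^+ 2)); first by rewrite mulf_neq0 // expf_neq0.
  by rewrite divfK ?mul1r; [apply/eqP; rewrite -subr_eq0 h'|rewrite mulf_neq0 // expf_neq0].
have e1 : (b ^+ 2 / (c ^+ 2 * a ^+ 2) - 1)^-1 = c ^+ 2 * a ^+ 2 / (b ^+ 2 - c ^+ 2 * a ^+ 2).
  have -> : b ^+ 2 / (c ^+ 2 * a ^+ 2) - 1 = (b ^+ 2 - c ^+ 2 * a ^+ 2) / (c ^+ 2 * a ^+ 2).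
    by field; rewrite n0 n1.
  by rewrite invf_div.
rewrite e1; apply/eqP; rewrite -subr_eq0; apply/eqP.
(* The difference of the two coefficients of [w] is this multiple of the left side of the
   differential equation. *)
rewrite -[RHS](mulr0 (- (c * a ^+ 3 * (b ^+ 2 - c ^+ 2 * a ^+ 2))^-1)) -h.
field; rewrite n0 n1 /= ?andbT; apply: contraNN n2 => /eqP n3; apply/eqP; rewrite -n3; ring.
Qed.

Lemma rot_mean_curv x : A x -> mean_curv g X x = H0 *: e x.
Proof.
move=> Ax; have [l hl] := cv_sum Ax.
have [g00 g01 _ g11] := EG Ax.
rewrite /mean_curv (trace2_diag D_neq0 _ Ax g01 g11) g00.
rewrite !(second_formE f_smooth f_neq0 XI _ _ Ax).
rewrite -(normal_part_lin D_neq0 _ _ _ _ Ax) hl (normal_part_lin D_neq0 _ _ _ _ Ax).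
rewrite (normal_part_dv D_neq0 0 Ax) (normal_part_normal D_neq0 Ax (fun k => inn_e k Ax)).
by rewrite scaler0 add0r scalerA mulrA mulVf ?pnatr_eq0 // mul1r.
Qed.

Lemma rot_normal_unit x : A x -> inn x (e x) (e x) = 1.
Proof.
move=> Ax; rewrite ipE X0 // mk4_0 sp_mk4 dotZl dotZr WW //.
by move: (F0 Ax); move: (F x) => a n0; field.
Qed.

Lemma rot_normal_tangent x : A x -> tangent_part g X x (e x) = 0.
Proof. by move=> Ax; apply: (tangent_part_eq0 D_neq0 Ax) => k; exact: inn_e. Qed.

Let normal_cv_e (d : R) k x : A x -> normal_part g X x (cv f X k (fun y => d *: e y) x) = 0.
Proof.
move=> Ax; rewrite (cv_scale f X k d (smooth_on_diff se Ax)) cv_e // scalerA.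
have := normal_part_lin D_neq0 (d * (- (2 * H0) * (k == 1)%:R)) (dv 1 X x) 0 0 Ax.
by rewrite (normal_part_dv D_neq0 1 Ax) !scaler0 !scale0r !addr0.
Qed.

Lemma rot_parallel x k : A x -> normal_cov g X k (mean_curv g X) x = 0.
Proof.
move=> Ax; rewrite /normal_cov (cov_alongE f_smooth f_neq0 XI) //.
by rewrite (cv_eq_on f X oA k rot_mean_curv Ax) normal_cv_e.
Qed.

(** The tangential bitension is proportional to the time component of the tension field, and that of
    [e] is zero. *)
Lemma rot_biconservative x : A x -> tangent_part g X x (bitension g X x) = 0.
Proof.
move=> Ax; apply: (tangent_part_eq0 D_neq0 Ax) => m.
have stau : smooth_on A (fun y => (2 * H0) *: e y).
  by apply: (smooth_Zv oA _ se); exact: smooth_cst.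
have tauE y : A y -> tension g X y = (2 * H0) *: e y.
  by move=> Ay; rewrite (tensionE f_smooth f_neq0 oA sX XI Ay) rot_mean_curv // scalerA.
have tau_n y l : A y -> inn y ((2 * H0) *: e y) (dv l X y) = 0.
  by move=> Ay; rewrite ipZl inn_e // mulr0.
have tau_p y k : A y -> normal_part g X y (cv f X k (fun y => (2 * H0) *: e y) y) = 0.
  by move=> Ay; exact: normal_cv_e.
rewrite (bitension_tangent I_int f_smooth f_neq0 oA sX XI D_neq0 stau tauE tau_n tau_p m Ax).
by rewrite e0Z mk4_0 !mulr0 mul0r.
Qed.

End RotGeometry.

(** * Trigonometric functions and the frame of the rotational surface *)

Section SmoothTrigo.
Context {R : realType}.

(** The span of sine and cosine is closed under derivation, so one induction with varying
    coefficients covers all orders. *)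
Let trig (p q : R) (s : R) : R := p * sin s + q * cos s.

Let is_derive_trig (p q s : R) : is_derive s (1 : R) (trig p q : R -> R^o) (trig (- q) p s).
Proof.
have := is_deriveD (is_deriveZ p (is_derive_sin s)) (is_deriveZ q (is_derive_cos s)).
move=> h; apply: (is_derive_eq h).
by rewrite /trig /GRing.scale /= mulrN mulNr addrC.
Qed.

Lemma smooth_on1_trig p q : smooth_on1 [set: R] (fun s => p * sin s + q * cos s).
Proof.
move=> n t _; rewrite -/(trig p q); elim: n p q => [|n IH] p q.
  by rewrite derive1n0; exact: ex_derive.
rewrite derive1Sn.
have -> : derive1 (trig p q) = trig (- q) p.
  by apply/funext => s; rewrite derive1E; apply: derive_val.
exact: IH.
Qed.

Lemma smooth_on1_sin : smooth_on1 [set: R] (@sin R).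
Proof.
have := @smooth_on1_trig 1 0; congr smooth_on1.
by apply/funext => s; rewrite mul1r mul0r addr0.
Qed.

Lemma smooth_on1_cos : smooth_on1 [set: R] (@cos R).
Proof.
have := @smooth_on1_trig 0 1; congr smooth_on1.
by apply/funext => s; rewrite mul1r mul0r add0r.
Qed.

Lemma d1_sin : d1 (@sin R) = cos.
Proof. by rewrite d1E; apply/funext => s; rewrite derive1E; apply: derive_val. Qed.

Lemma d1_cos : d1 (@cos R) = fun s => - sin s.
Proof. by rewrite d1E; apply/funext => s; rewrite derive1E; apply: derive_val. Qed.

End SmoothTrigo.

Section RotFrame.
Context {R : realType}.
Variables (a : R).
Implicit Types x : 'rV[R]_2.

Definition rot_n x : 'rV[R]_3 := row3 (sin (a * x 0 1)) (cos (a * x 0 1)) 0.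
Definition rot_t x : 'rV[R]_3 := row3 (cos (a * x 0 1)) (- sin (a * x 0 1)) 0.
Definition rot_axis : 'rV[R]_3 := row3 0 0 1.

Lemma dot_row3 (p q r p' q' r' : R) :
  dot (row3 p q r) (row3 p' q' r') = p * p' + q * q' + r * r'.
Proof.
have [r0 r1 r2] := row3E p q r; have [s0 s1 s2] := row3E p' q' r'.
by rewrite dot3 r0 r1 r2 s0 s1 s2.
Qed.

Lemma rot_dots x : [/\ dot (rot_n x) (rot_n x) = 1, dot (rot_t x) (rot_t x) = 1,
  dot rot_axis rot_axis = 1, dot (rot_n x) (rot_t x) = 0 &
  dot (rot_n x) rot_axis = 0 /\ dot (rot_t x) rot_axis = 0].
Proof.
have cs := cos2Dsin2 (a * x 0 1).
rewrite !dot_row3 !mulr0 !mul0r !mulr1 !addr0 !add0r; split=> //.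
- by rewrite -cs; ring.
- by rewrite -cs; ring.
- by ring.
Qed.

Variable (A : set 'rV[R]_2).
Hypothesis oA : open A.

Lemma smooth_row3 (p q r : 'rV[R]_2 -> R) : smooth_on A (p : _ -> R^o) ->
  smooth_on A (q : _ -> R^o) -> smooth_on A (r : _ -> R^o) ->
  smooth_on A (fun x => row3 (p x) (q x) (r x)).
Proof.
move=> sp sq sr; apply/(smooth_rowP oA); apply: ord3P.
- by apply: (smooth_eq_on oA _ sp) => x _; have [-> _ _] := row3E (p x) (q x) (r x).
- by apply: (smooth_eq_on oA _ sq) => x _; have [_ -> _] := row3E (p x) (q x) (r x).
by apply: (smooth_eq_on oA _ sr) => x _; have [_ _ ->] := row3E (p x) (q x) (r x).
Qed.

Lemma dv_row3 (p q r : 'rV[R]_2 -> R) k x : A x -> smooth_on A (p : _ -> R^o) ->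
  smooth_on A (q : _ -> R^o) -> smooth_on A (r : _ -> R^o) ->
  dv k (fun x => row3 (p x) (q x) (r x)) x = row3 (ds k p x) (ds k q x) (ds k r x).
Proof.
move=> Ax sp sq sr; have d := smooth_on_diff (smooth_row3 sp sq sr) Ax.
have [r0 r1 r2] := row3E (ds k p x) (ds k q x) (ds k r x).
apply: eq_row3; rewrite ?r0 ?r1 ?r2 (dv_row k _ d); apply: (ds_eq_on oA k _ Ax) => y _.
- by have [-> _ _] := row3E (p y) (q y) (r y).
- by have [_ -> _] := row3E (p y) (q y) (r y).
by have [_ _ ->] := row3E (p y) (q y) (r y).
Qed.

Let sv : smooth_on A (fun x : 'rV[R]_2 => a * x 0 1 : R^o).
Proof. by apply: (smooth_M oA); [exact: smooth_cst|exact: smooth_coord]. Qed.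

Let s_sin : smooth_on A (fun x : 'rV[R]_2 => sin (a * x 0 1) : R^o).
Proof. exact: (smooth_comp1 oA smooth_on1_sin (fun x _ => I) sv). Qed.

Let s_cos : smooth_on A (fun x : 'rV[R]_2 => cos (a * x 0 1) : R^o).
Proof. exact: (smooth_comp1 oA smooth_on1_cos (fun x _ => I) sv). Qed.

Let s_msin : smooth_on A (fun x : 'rV[R]_2 => - sin (a * x 0 1) : R^o).
Proof. exact: (smooth_N oA). Qed.

Let s0 : smooth_on A (fun x : 'rV[R]_2 => 0 : R^o).
Proof. exact: smooth_cst. Qed.

Let dsv k x : A x -> ds k (fun x : 'rV[R]_2 => a * x 0 1) x = a * (k == 1)%:R.
Proof.
move=> Ax; have dc : differentiable (fun _ : 'rV[R]_2 => a : R^o) x by exact: differentiable_cst.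
have sc : smooth_on A (fun x : 'rV[R]_2 => x 0 1 : R^o) by exact: smooth_coord.
by rewrite (dsM k dc (smooth_on_diff sc Ax)) ds_cst ds_coord mul0r add0r.
Qed.

Let ds_sin k x : A x ->
  ds k (fun x : 'rV[R]_2 => sin (a * x 0 1)) x = cos (a * x 0 1) * (a * (k == 1)%:R).
Proof.
move=> Ax; rewrite (ds_comp1 k (@derivable_sin R (a * x 0 1)) (smooth_on_diff sv Ax)).
by rewrite d1_sin dsv.
Qed.

Let ds_cos k x : A x ->
  ds k (fun x : 'rV[R]_2 => cos (a * x 0 1)) x = - sin (a * x 0 1) * (a * (k == 1)%:R).
Proof.
move=> Ax; rewrite (ds_comp1 k (@derivable_cos R (a * x 0 1)) (smooth_on_diff sv Ax)).
by rewrite d1_cos dsv.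
Qed.

Lemma smooth_rot_n : smooth_on A rot_n. Proof. exact: smooth_row3. Qed.
Lemma smooth_rot_t : smooth_on A rot_t. Proof. exact: smooth_row3. Qed.

Let row3Z (d p q r : R) : d *: row3 p q r = row3 (d * p) (d * q) (d * r).
Proof.
have [r0 r1 r2] := row3E p q r; have [s0' s1 s2] := row3E (d * p) (d * q) (d * r).
by apply: eq_row3; rewrite rowZE ?r0 ?r1 ?r2 ?s0' ?s1 ?s2.
Qed.

Lemma dv_rot_n k x : A x -> dv k rot_n x = (a * (k == 1)%:R) *: rot_t x.
Proof.
move=> Ax; rewrite (dv_row3 k Ax s_sin s_cos s0) ds_sin // ds_cos // ds_cst row3Z mulr0.
by congr row3; rewrite mulrC.
Qed.

Lemma dv_rot_t k x : A x -> dv k rot_t x = (- (a * (k == 1)%:R)) *: rot_n x.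
Proof.
move=> Ax; rewrite (dv_row3 k Ax s_cos s_msin s0) (dsN k (smooth_on_diff s_sin Ax)).
rewrite ds_sin // ds_cos // ds_cst row3Z mulr0.
by congr row3; ring.
Qed.

Variables (H0 c : R).
Hypotheses (a_neq0 : a != 0) (ac : 4 * H0 ^+ 2 + c ^+ 2 = a ^+ 2).

(* The adapted frame of the rotational surface: (rot_n, rot_axis) turned by the
   angle with cosine c / a and sine 2 H0 / a. *)
Definition rot_w x := (c / a) *: rot_n x + (2 * H0 / a) *: rot_axis.
Definition rot_e4 x := (- (2 * H0 / a)) *: rot_n x + (c / a) *: rot_axis.

Lemma rot_frame_dots x : [/\ dot (rot_w x) (rot_w x) = 1, dot (rot_e4 x) (rot_e4 x) = 1,
  dot (rot_w x) (rot_t x) = 0, dot (rot_w x) (rot_e4 x) = 0 & dot (rot_t x) (rot_e4 x) = 0].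
Proof.
have [nn tt kk nt [nk tk]] := rot_dots x; rewrite /rot_w /rot_e4.
move: nn tt kk nt nk tk; move: (rot_n x) (rot_t x) rot_axis => N T E nn tt kk nt nk tk.
rewrite !(dotDl, dotDr, dotZl, dotZr) (dotC E N) (dotC E T) (dotC T N) nn kk nt nk tk.
have a2 : a ^+ 2 != 0 by rewrite expf_neq0.
split; try by ring.
- by apply: (mulfI a2); rewrite mulr1 -{2}ac; field.
- by apply: (mulfI a2); rewrite mulr1 -{2}ac; field.
Qed.

Lemma smooth_rot_w : smooth_on A rot_w.
Proof.
apply: (smooth_D oA); last exact: smooth_cst.
by apply: (smooth_Zv oA _ smooth_rot_n); exact: smooth_cst.
Qed.

Lemma smooth_rot_e4 : smooth_on A rot_e4.
Proof.
apply: (smooth_D oA); last exact: smooth_cst.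
by apply: (smooth_Zv oA _ smooth_rot_n); exact: smooth_cst.
Qed.

Let dv_comb (p : R) (u : 'rV[R]_3) k x : A x ->
  dv k (fun x => p *: rot_n x + u) x = (p * a * (k == 1)%:R) *: rot_t x.
Proof.
move=> Ax; have sp : smooth_on A (fun x => p *: rot_n x).
  by apply: (smooth_Zv oA _ smooth_rot_n); exact: smooth_cst.
have du : differentiable (fun _ : 'rV[R]_2 => u) x by exact: differentiable_cst.
rewrite (dvD k (smooth_on_diff sp Ax) du) (dv_scale k p (smooth_on_diff smooth_rot_n Ax)).
have -> : dv k (fun _ : 'rV[R]_2 => u) x = 0.
  by apply/rowP => j; rewrite (dv_row k j du) ds_cst mxE.
by rewrite addr0 dv_rot_n // scalerA mulrA.
Qed.

Lemma dv_rot_w k x : A x -> dv k rot_w x = (c * (k == 1)%:R) *: rot_t x.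
Proof. by move=> Ax; rewrite dv_comb // divfK. Qed.

Lemma dv_rot_e4 k x : A x -> dv k rot_e4 x = (- (2 * H0) * (k == 1)%:R) *: rot_t x.
Proof. by move=> Ax; rewrite dv_comb // mulNr divfK. Qed.

Lemma dv_rot_t_frame k x : A x ->
  dv k rot_t x = (- (k == 1)%:R) *: (c *: rot_w x - (2 * H0) *: rot_e4 x).
Proof.
move=> Ax; rewrite dv_rot_t // /rot_w /rot_e4; move: (rot_n x) rot_axis => N E.
apply/rowP => j; rewrite !rowE_; move: (N 0 j) (E 0 j) => n e.
have -> : a * (k == 1)%:R = (4 * H0 ^+ 2 + c ^+ 2) / a * (k == 1)%:R.
  by rewrite ac expr2 mulfK.
by field.
Qed.

Lemma rot_surface_frame (f : R -> R) x : c != 0 -> f (x 0 0) != 0 ->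
  rot_surface f H0 a (c / a) x = mk4 (x 0 0) ((c * f (x 0 0))^-1 *: rot_w x).
Proof.
move=> c0 F0; rewrite rot_surfaceE; congr mk4; rewrite /rot_w /rot_n /rot_axis.
rewrite scalerDr !scalerA !row3Z.
set u := row3 _ _ _; set v := row3 _ _ _; set y := row3 _ _ _.
have uE := row3E (1 / (a * f (x 0 0)) * sin (a * x 0 1))
    (1 / (a * f (x 0 0)) * cos (a * x 0 1)) (2 * H0 / (a ^+ 2 * (c / a) * f (x 0 0))).
rewrite -/u in uE; case: uE => u0 u1 u2.
apply: eq_row3; rewrite rowDE ?u0 ?u1 ?u2 /v /y !mxE /=;
  move: F0; move: (f (x 0 0)) (sin (a * x 0 1)) (cos (a * x 0 1)) => F s s' F0; by field; rewrite ?a_neq0 ?c0 ?F0.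
Qed.

End RotFrame.

(** * The strip J x R as an abstract surface *)

Section StripSurface.
Context {R : realType}.
Variable J : set R.
Hypothesis J_int : open_interval J.

Definition strip : set 'rV[R]_2 := [set x | J (x 0 0)].
Local Notation S := (set_type strip).

Lemma open_strip : open strip.
Proof.
have [_ oJ _] := J_int.
by apply: (@open_comp _ _ (fun x : 'rV[R]_2 => x 0 0) J) => // x _; exact: coord_continuous.
Qed.

Lemma strip_nbhsP (p : S) (U : set S) :
  nbhs p U <-> exists2 V, nbhs (set_val p) V & set_val @^-1` V `<=` U.
Proof.
split; last first.
  move=> [V pV VU]; apply: filterS VU _.
  exact: (@initial_continuous S _ set_val p).
case=> _ /= [] [V oV <- /= Vp] VU; exists V => //.
exact: open_nbhs_nbhs.
Qed.

Lemma strip_point : exists x, strip x.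
Proof. by have [[t Jt] _ _] := J_int; exists (\row_j t); rewrite /strip /= mxE. Qed.

Definition strip0 : S := SigSub (mem_set (projT2 (cid strip_point))).

(* Junk value strip0 outside the strip. *)
Definition strip_param (x : 'rV[R]_2) : S :=
  if pselect (strip x) is left h then SigSub (mem_set h) else strip0.

Lemma strip_paramK x : strip x -> set_val (strip_param x) = x.
Proof. by move=> h; rewrite /strip_param; case: pselect. Qed.

Lemma strip_valK p : strip_param (set_val p) = p.
Proof. by apply: val_inj; rewrite -[RHS]/(set_val p) -[LHS]/(set_val _) strip_paramK //; exact: set_valP. Qed.

Lemma strip_val_range : set_val @` [set: S] = strip.
Proof.
apply/seteqP; split=> [_ [p _ <-]|x Sx]; first exact: set_valP.
by exists (strip_param x) => //; exact: strip_paramK.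
Qed.

Lemma strip_param_continuous x : strip x -> {for x, continuous strip_param}.
Proof.
move=> Sx U /strip_nbhsP[V + VU]; rewrite strip_paramK // => xV.
have nS : nbhs x strip by apply: open_nbhs_nbhs; split => //; exact: open_strip.
suff : nbhs x [set y | U (strip_param y)] by [].
by apply: filterS2 nS xV => y Sy Vy; apply: VU => /=; rewrite strip_paramK.
Qed.

(** The strip is star-shaped: it is the union of the segments from one of its points. Connectedness
    is then transported by the continuous parametrization. *)
Lemma strip_connected : connected [set: S].
Proof.
have -> : [set: S] = strip_param @` strip.
  apply/seteqP; split=> // p _; exists (set_val p); [exact: set_valP|exact: strip_valK].
apply: connected_continuous_connected; last first.
  by apply: continuous_in_subspaceT => x /set_mem; exact: strip_param_continuous.
have [x0 Sx0] := strip_point; have [_ _ iJ] := J_int.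
pose seg x (s : R) := x0 + s *: (x - x0).
have -> : strip = \bigcup_(x in strip) (seg x @` `[0, 1]).
  apply/seteqP; split=> [x Sx|_ [x Sx [s s01 <-]]].
    by exists x => //; exists 1; rewrite /= ?in_itv /= ?ler01 ?lexx // /seg scale1r addrC subrK.
  move: s01; rewrite /= in_itv /= => /andP[s0 s1]; rewrite /strip /= /seg !mxE.
  have [le|/ltW le] := leP (x0 0 0) (x 0 0).
    apply: (iJ _ _ Sx0 Sx); apply/andP; split; first by rewrite lerDl mulr_ge0 // subr_ge0.
    by rewrite -lerBrDl ler_piMl // subr_ge0.
  apply: (iJ _ _ Sx Sx0); apply/andP; split; last by rewrite gerDl mulr_ge0_le0 // subr_le0.
  by rewrite -lerBlDl; rewrite ler_niMl // subr_le0.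
apply: bigcup_connected.
  by exists x0 => x Sx; exists 0; rewrite /= ?in_itv /= ?ler01 ?lexx // /seg scale0r addr0.
move=> x Sx; apply: connected_continuous_connected; first exact: segment_connected.
apply: continuous_subspaceT => s; apply: cvgD; first exact: cvg_cst.
by apply: cvgZr_tmp; exact: cvg_id.
Qed.

Lemma strip_hausdorff : hausdorff_space S.
Proof.
move=> p q pq; apply: val_inj.
apply: (@norm_hausdorff R 'rV[R]_2) => U V pU qV.
have [||r [Ur Vr]] := pq (set_val @^-1` U) (set_val @^-1` V).
- by apply/strip_nbhsP; exists U.
- by apply/strip_nbhsP; exists V.
by exists (set_val r).
Qed.

Lemma strip_second_countable : @second_countable S.
Proof.
pose b (i : rat * rat * nat) : set S := set_val @^-1`
  (ball (\row_j (if j == 0 then ratr i.1.1 else ratr i.1.2) : 'rV[R]_2) i.2.+1%:R^-1).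
exists (range b).
  exact: (card_le_trans (card_image_le b setT) (countableP _)).
split.
  move=> _ [i _ <-]; apply: open_comp; last exact: ball_open.
  by move=> p _; exact: (@initial_continuous S _ set_val p).
move=> p U /strip_nbhsP[V /nbhs_ballP[e /= e0 eV] VU].
have [n nP] : exists n : nat, n.+1%:R^-1 < e / 2.
  have := near_infty_natSinv_lt (PosNum (divr_gt0 e0 (ltr0n R 2))).
  by case=> N _ /(_ N (leqnn N)) h; exists N.
set r : R := n.+1%:R^-1 in nP; have r0 : 0 < r by rewrite invr_gt0.
have rat_near (s : R) : exists q : rat, `|ratr q - s| < r.
  have /rat_in_itvoo[q] : s - r < s + r by rewrite ltrD2l gtrN.
  by rewrite in_itv /= -ltr_distl => h; exists q.
have [q0 h0] := rat_near (set_val p 0 0); have [q1 h1] := rat_near (set_val p 0 1).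
pose c : 'rV[R]_2 := \row_j (if j == 0 then ratr q0 else ratr q1).
have cp : ball c r (set_val p).
  split=> // i j; rewrite (ord1 i) {i}; move: j; apply: ord2P; by rewrite !mxE /ball /=.
exists (set_val @^-1` ball c r); first by split; [exists (q0, q1, n)|].
move=> y cy; apply: VU; apply: eV.
have -> : e = e / 2 + e / 2 by rewrite -splitr.
apply: (@le_ball _ _ _ (r + r)); first by rewrite lerD // ltW.
exact: (ball_triangle (ball_sym cp) cy).
Qed.

Lemma strip_val_continuous (p : S) : {for p, continuous (set_val : S -> 'rV[R]_2)}.
Proof. exact: (@initial_continuous S _ set_val p). Qed.

Lemma strip_transition (B : set 'rV[R]_2) : open B -> B `<=` strip ->
  smooth_on B (set_val \o strip_param).
Proof.
move=> oB BS; apply: (smooth_eq_on oB (F := id)).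
  by move=> x /BS Sx; rewrite /= strip_paramK.
by apply/(smooth_rowP oB) => j; exact: smooth_coord.
Qed.

Lemma strip_jacobian x : strip x -> jacobian (set_val \o strip_param) x = 1%:M.
Proof.
move=> Sx; have sid := strip_transition open_strip (fun y h => h).
have d := smooth_on_diff sid Sx.
apply/matrixP => k j; rewrite -(pd_jacobian k j d) -dvE (dv_row k j d).
rewrite (ds_eq_on open_strip k (G := fun y => y 0 j) _ Sx); first by rewrite ds_coord mxE.
by move=> y Sy; rewrite /= strip_paramK.
Qed.

Let strip_range : set_val @` [set: S] `&` strip_param @^-1` [set: S] = strip.
Proof. by rewrite preimage_setT setIT strip_val_range. Qed.

(** One global chart, the inclusion in the plane: the transition map is the identity on the strip,
    which settles smoothness and orientation. *)
Definition strip_surface : surface R.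
Proof.
refine (@Surface R S _ strip_connected strip_hausdorff strip_second_countable unit
  (fun _ => setT) (fun _ => set_val) (fun _ => strip_param) _ _ _ _ _ _ _ _).
- by exists strip0.
- by move=> _; exact: openT.
- by move=> p; exists tt.
- by move=> _; rewrite strip_val_range; exact: open_strip.
- by move=> _ p _; exact: strip_valK.
- by move=> _ p _; exact: strip_val_continuous.
- by move=> _ x; rewrite strip_val_range; exact: strip_param_continuous.
- move=> _ _; rewrite strip_range; apply: strip_transition => //.
  exact: open_strip.
- move=> _ _ x; rewrite strip_range => Sx.
  by rewrite (strip_jacobian Sx) det1.
Defined.

End StripSurface.

(** * A surface for every solution of the differential equation *)

Section Existence.
Context {R : realType}.
Variables (I : set R) (f : R -> R) (H0 : R).
Hypotheses (I_int : open_interval I) (f_smooth : smooth_on1 I f)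
  (f_neq0 : forall t, I t -> f t != 0).
Variable J : set R.
Hypotheses (J_int : open_interval J) (JI : J `<=` I).
Variable a : R.
Hypotheses (a_gt : 0 < a ^+ 2 - 4 * H0 ^+ 2) (ode : rw_ode f H0 a J)
  (spacelike : rot_spacelike f H0 a J).

Lemma surface_of_ode : exists (M : surface R) (phi : M -> 'rV[R]_4),
  bicons_pmcv_surface I f phi H0 /\ time_range phi = J.
Proof.
(* The constant b of the frame. The parameter [c2] of the rotational surface is c / a, of the sign
   of a; its sign does not matter for existence. *)
pose c := Num.sqrt (a ^+ 2 - 4 * H0 ^+ 2).
have c0 : c != 0 by rewrite gt_eqF // sqrtr_gt0.
have cE : c ^+ 2 = a ^+ 2 - 4 * H0 ^+ 2 by rewrite sqr_sqrtr // ltW.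
have ac : 4 * H0 ^+ 2 + c ^+ 2 = a ^+ 2 by rewrite cE addrC subrK.
have a0 : a != 0.
  apply: contraTneq a_gt => ->; rewrite expr0n sub0r oppr_gt0 -leNgt.
  by rewrite mulr_ge0 // sqr_ge0.
pose M := strip_surface J_int.
pose phi (p : M) := rot_surface f H0 a (c / a) (set_val p).
pose X := phi \o strip_param J_int.
pose e4 (p : M) := rot_normal f (rot_e4 a H0 c) (set_val p).
set A := strip J; have oA : open A by exact: open_strip.
have AI x : A x -> I (x 0 0) by move=> /JI.
have XE x : A x -> X x = mk4 (x 0 0) ((c * f (x 0 0))^-1 *: rot_w a H0 c x).
  move=> Ax; rewrite /X /phi /= strip_paramK // rot_surface_frame //.
  exact/f_neq0/AI.
have dots x := rot_frame_dots a0 ac x.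
have tt x : A x -> dot (rot_t a x) (rot_t a x) = 1 by move=> _; case: (rot_dots a x).
have ww x : A x -> dot (rot_w a H0 c x) (rot_w a H0 c x) = 1 by move=> _; case: (dots x).
have WW x : A x -> dot (rot_e4 a H0 c x) (rot_e4 a H0 c x) = 1 by move=> _; case: (dots x).
have wT x : A x -> dot (rot_w a H0 c x) (rot_t a x) = 0 by move=> _; case: (dots x).
have wW x : A x -> dot (rot_w a H0 c x) (rot_e4 a H0 c x) = 0 by move=> _; case: (dots x).
have TW x : A x -> dot (rot_t a x) (rot_e4 a H0 c x) = 0 by move=> _; case: (dots x).
have sw := smooth_rot_w a oA H0 c; have sT := smooth_rot_t a oA.
have sW := smooth_rot_e4 a oA H0 c.
have dw k x (Ax : A x) := dv_rot_w oA H0 c a0 k Ax.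
have dT k x (Ax : A x) := dv_rot_t_frame oA a0 ac k Ax.
have dW k x (Ax : A x) := dv_rot_e4 oA H0 c a0 k Ax.
have ode' x : A x -> c ^+ 2 * f (x 0 0) ^+ 3 * d1 (d1 f) (x 0 0)
    - (d1 f (x 0 0) ^+ 2 - c ^+ 2 * f (x 0 0) ^+ 2) ^+ 2 - d1 f (x 0 0) ^+ 4 = 0.
  by move=> Ax; rewrite cE d1d1E d1E; exact: ode.
have sl x : A x -> c ^+ 2 * f (x 0 0) ^+ 2 < d1 f (x 0 0) ^+ 2.
  by move=> Ax; rewrite cE d1E; exact: spacelike.
have rngA (i : cidx M) : crange i = A by exact: strip_val_range.
have X00 x : A x -> X x 0 0 = x 0 0 by move=> Ax; rewrite XE // mk4_0.
have eE x : A x -> e4 (strip_param J_int x) = rot_normal f (rot_e4 a H0 c) x.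
  by move=> Ax; rewrite /e4 strip_paramK.
exists M, phi; split; last first.
  apply/seteqP; split=> [_ [p _ <-]|t Jt].
    by rewrite /phi rot_surfaceE mk4_0; exact: (set_valP p).
  have St : strip J (\row_j t) by rewrite /strip /= mxE.
  exists (strip_param J_int (\row_j t)) => //.
  by rewrite /phi rot_surfaceE mk4_0 strip_paramK // mxE.
split.
- split.
  + move=> i; rewrite rngA; exact: (smooth_rot f_smooth f_neq0 oA AI sw XE).
  + by move=> p; rewrite /rw_space /= /phi rot_surfaceE mk4_0; apply: JI; exact: (set_valP p).
  + move=> i x; rewrite rngA => Ax v v0.
    exact: (rot_spacelike_immersion f_smooth f_neq0 c0 oA AI sw ww tt wT dw XE sl Ax v0).
- move=> i x; rewrite rngA => Ax.
  exact: (rot_dt f_smooth f_neq0 c0 oA AI sw ww tt wT dw XE sl Ax).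
- move=> i x; rewrite rngA => Ax k.
  exact: (rot_parallel f_smooth f_neq0 c0 oA AI sw sT sW ww tt wT wW TW dw dT dW XE ode' sl _ Ax).
- move=> i x; rewrite rngA => Ax.
  exact: (rot_biconservative I_int f_smooth f_neq0 c0 oA AI sw sT sW ww tt wT wW TW dw dT dW XE ode' sl Ax).
exists e4.
  move=> i; rewrite rngA.
  apply: (smooth_eq_on oA (F := rot_normal f (rot_e4 a H0 c))); first by move=> x Ax; rewrite /= eE.
  exact: (smooth_rot_normal f_smooth f_neq0 oA AI sW).
move=> i x; rewrite rngA => Ax.
have eEx : e4 (param i x) = rot_normal f (rot_e4 a H0 c) x by exact: eE.
rewrite eEx; split.
- rewrite inner_ip.
  have := rot_normal_unit f_neq0 AI WW XE Ax.
  by rewrite -[phi _]/(X x) => ->; rewrite normr1.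
- exact: (rot_normal_tangent f_smooth f_neq0 c0 oA AI sw ww tt wT wW TW dw XE sl Ax).
exact: (rot_mean_curv f_smooth f_neq0 c0 oA AI sw sT ww tt wT wW TW dw dT XE ode' sl).
Qed.

End Existence.

Theorem theorem4p3 (R : realType) (I : set R) (f : R -> R) (H0 : R)
  (I_int : open_interval I)
  (f_smooth : smooth_on1 I f)
  (f_neq0 : forall t, I t -> f t != 0)
  (f_standing : forall t, I t ->
     derive1n 2 f t / f t - derive1 f t ^+ 2 / f t ^+ 2 != 0)
  (H0_neq0 : H0 != 0) :
  forall J : set R, open_interval J -> J `<=` I ->
  ((exists (M : surface R) (phi : M -> 'rV[R]_4),
      bicons_pmcv_surface I f phi H0 /\ time_range phi = J)
   <->
   (exists a : R,
      [/\ 0 < a ^+ 2 - 4 * H0 ^+ 2, rw_ode f H0 a J & rot_spacelike f H0 a J]))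
  /\
  (forall (M : surface R) (phi : M -> 'rV[R]_4),
     bicons_pmcv_surface I f phi H0 -> time_range phi = J ->
     forall a : R, 0 < a ^+ 2 - 4 * H0 ^+ 2 -> rw_ode f H0 a J ->
     exists c2 : R,
       [/\ 0 < c2, 4 * H0 ^+ 2 + c2 ^+ 2 * a ^+ 2 = a ^+ 2 &
           locally_congruent I f phi
             [set x : 'rV[R]_2 | I (x 0 0)] (rot_surface f H0 a c2)]).
Proof.
move=> J J_int JI; split; last first.
  by move=> M phi bic rng a a_gt ode;
    exact: (surface_locally_congruent I_int f_smooth f_neq0 H0_neq0 f_standing bic rng a_gt ode).
split=> [[M [phi [bic rng]]]|[a [a_gt ode sl]]].
  exact: (ode_of_surface I_int f_smooth f_neq0 H0_neq0 f_standing bic rng).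
exact: (surface_of_ode I_int f_smooth f_neq0 J_int JI a_gt ode sl).
Qed.
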